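(* Let $A\in\mathbb R^{n_x\times n_x}$, $B\in\mathbb R^{n_x\times n_u}$, $C\in\mathbb R^{n_y\times n_x}$, with $(A,B)$ stabilizable and $(A,C)$ observable, let $d(t)=[w(t)^\top,v(t)^\top]^\top$ be i.i.d. $\mathcal N(0,V_d)$ with $V_d=\mathrm{diag}(V_w,V_v)\ge 0$ and $V_v>0$, and let $Q>0$, $R>0$. Let $L\in\mathbb N$ and suppose that the plant ${}^{s}\Sigma$ is $L$-step observable, that the set $\mathbb K=\{K\in\mathbb R^{n_u\times n_z}: \Theta_K:=\Theta+\Pi_uK\Gamma \text{ is Schur stable}\}$ is nonempty, and that the minimal realization of the LQG controller ${}^{s}K_{\rm LQG}$ is $L$-step observable (all objects as in the context). Define $$K_\star:=\operatorname{argmin}_{K\in\mathbb K}J(K),$$ and let ${}^{s}K_\star$ be the dynamic controller constructed from $K_\star$ by the realization $(G,H,F)$ given in the context. Then $$J(K)\ \ge\ J(K_\star)={}^{s}J({}^{s}K_\star)={}^{s}J({}^{s}K_{\rm LQG})$$ holds for any $K\in\mathbb R^{n_u\times n_z}$. Moreover, when $n_u=1$, the $L$-dimensional controller ${}^{s}K_\star$ is an optimal solution of the problem of minimizing ${}^{s}J({}^{s}K)$ over all dynamic controllers ${}^{s}K:\ \xi(t+1)=G\xi(t)+Hy(t),\ u(t)=F\xi(t)$ with state dimension $n_\xi=L$.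
   Context: Plant ${}^{s}\Sigma$: $x(t+1)=Ax(t)+Bu(t)+w(t)$, $y(t)=Cx(t)+v(t)$, $t\ge0$, $x(0)=0$, with $x\in\mathbb R^{n_x}$, $u\in\mathbb R^{n_u}$, $y\in\mathbb R^{n_y}$, $w\in\mathbb R^{n_w}$, $v\in\mathbb R^{n_v}$, $n_w=n_x$, $n_v=n_y$. Dynamic controllers: ${}^{s}K:\ \xi(t+1)=G\xi(t)+Hy(t),\ u(t)=F\xi(t)$, $\xi\in\mathbb R^{n_\xi}$, $t\ge0$. Cost: ${}^{s}J({}^{s}K):=\lim_{T\to\infty}\mathbb E\big[\frac1T\sum_{t=0}^{T}y(t)^\top Qy(t)+u(t)^\top Ru(t)\big]$ along the closed loop $({}^{s}\Sigma,{}^{s}K)$. LQG controller ${}^{s}K_{\rm LQG}$: the controller of this form with $G_{\rm LQG}=A+BF_{\rm LQG}-H_{\rm LQG}C$, $H=H_{\rm LQG}$, $F=F_{\rm LQG}$, where $F_{\rm LQG}$ and $H_{\rm LQG}$ are determined by the two standard Riccati equations: $F_{\rm LQG}=-(R+B^\top PB)^{-1}B^\top PA$, $H_{\rm LQG}=AYC^\top(CYC^\top+V_v)^{-1}$, with $P=A^\top PA-A^\top PB(R+B^\top PB)^{-1}B^\top PA+C^\top QC$ and $Y=AYA^\top-AYC^\top(CYC^\top+V_v)^{-1}CYA^\top+V_w$ (the standard positive semidefinite solutions). It is taken as well known that ${}^{s}K_{\rm LQG}$ attains the minimum of ${}^{s}J$ over all dynamic controllers of the form $\xi(t+1)=G\xi(t)+Hy(t),\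 u(t)=F\xi(t)$. Notation: $[x]_{t_1}^{t_2}:=[x(t_1)^\top,\dots,x(t_2)^\top]^\top$; $\mathcal R_L(A,B):=[A^{L-1}B,\dots,AB,B]$; $\mathcal O_L(A,C):=[C^\top,(CA)^\top,\dots,(CA^{L-1})^\top]^\top$; $\mathcal H_L(A,B,C)$ is the $L\times L$ block matrix with $(i,j)$ block $0$ if $i\le j$ and $CA^{i-j-1}B$ if $i>j$; $\dagger$ is the Moore–Penrose inverse. A system with state matrix $A_\eta\in\mathbb R^{n_\eta\times n_\eta}$ and output matrix $C_\eta$ is $L$-step observable if $\operatorname{rank}\mathcal O_L(A_\eta,C_\eta)=n_\eta$ (for ${}^{s}\Sigma$: $(A,C)$; for ${}^{s}K$: $(G,F)$). ''Schur stable'' means spectral radius $<1$. Histories, for $t\ge L$: $z(t):=[([u]_{t-L}^{t-1})^\top,([y]_{t-L}^{t-1})^\top]^\top\in\mathbb R^{n_z}$, $n_z=L(n_u+n_y)$; $e(t):=[([w]_{t-L}^{t-1})^\top,([v]_{t-L}^{t-1})^\top]^\top\in\mathbb R^{n_e}$, $n_e=L(n_w+n_v)$; $h(t):=[z(t)^\top,e(t)^\top]^\top\in\mathbb R^{n_h}$, $n_h=n_z+n_e$. History dynamics $\Sigma$, $t\ge L$: $h(t+1)=\Theta h(t)+\Pi_dd(t)+\Pi_uu(t)$, $y(t)=\Psi h(t)+\Upsilon d(t)$, $z(t)=\Gamma h(t)$, where $J_n\in\mathbb R^{Ln\times Ln}$ is the block shift with $I_n$ on the first block superdiagonal and zeros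 elsewhere, $E_n=[0,\dots,0,I_n]^\top\in\mathbb R^{Ln\times n}$, and, in the block partition of sizes $Ln_u,Ln_y,Ln_w,Ln_v$, $$\Theta=\mathrm{diag}(J_{n_u},J_{n_y},J_{n_w},J_{n_v})+\begin{bmatrix} 0 \\ E_{n_y}C[M_1\ M_2\ M_3\ M_4] \\ 0 \\ 0 \end{bmatrix},\quad \Pi_d=\begin{bmatrix} 0 & 0 \\ 0 & E_{n_y} \\ E_{n_w} & 0 \\ 0 & E_{n_v} \end{bmatrix},\quad \Pi_u=\begin{bmatrix} E_{n_u} \\ 0 \\ 0 \\ 0 \end{bmatrix},$$ $\Psi=C[M_1,M_2,M_3,M_4]$, $\Gamma=[I_{n_z},0]$, $\Upsilon=[0,I_{n_y}]$, $M_1=\mathcal R_L(A,B)-A^L\mathcal O_L^\dagger(A,C)\mathcal H_L(A,B,C)$, $M_2=A^L\mathcal O_L^\dagger(A,C)$, $M_3=\mathcal R_L(A,I)-A^L\mathcal O_L^\dagger(A,C)\mathcal H_L(A,I,C)$, $M_4=-A^L\mathcal O_L^\dagger(A,C)$. The initial state $h(L)$ is the actual history of $\{u,y,w,v\}$ on $\{0,\dots,L-1\}$. For $K\in\mathbb R^{n_u\times n_z}$ the IOH control law is $u(t)=Kz(t)$, $t\ge L$, and $J(K):=\lim_{T\to\infty}\mathbb E\big[\frac1T\sum_{t=L}^{T}y(t)^\top Qy(t)+u(t)^\top Ru(t)\big]$ along the closed loop of $\Sigma$ with this law. Construction of ${}^{s}K$ from $K$: partition $K=[K^u_L,\dots,K^u_1,K^y_L,\dots,K^y_1]$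 with $K^u_i\in\mathbb R^{n_u\times n_u}$, $K^y_i\in\mathbb R^{n_u\times n_y}$; then $$G=\begin{bmatrix} & & & K^u_L \\ I & & & K^u_{L-1} \\ & \ddots & & \vdots \\ & & I & K^u_1 \end{bmatrix},\quad H=\begin{bmatrix} K^y_L \\ K^y_{L-1} \\ \vdots \\ K^y_1 \end{bmatrix},\quad F=[0,\dots,0,I_{n_u}],$$ (for $L=1$: $G=K_1^u$, $H=K_1^y$, $F=I$), with initial state $\xi(0)=\mathcal O_L^{-1}(G,F)[I_{Ln_u},-\mathcal H_L(G,H,F)]z(L)$; this makes ${}^{s}K$ and the law $u=Kz$ generate the same inputs.
   Formalization: The filter Riccati solution Y is required to be the unique positive semidefinite one and stabilizing (in effect (A,V_w) stabilizable; otherwise the claim can fail). Unspecified initial inputs and controller states are taken square-integrable and not anticipating the noise from time L on. *)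

(* Defs.v *)
From HB Require Import structures.
From mathcomp Require Import all_boot all_order all_algebra.
From mathcomp Require Import all_classical all_reals all_analysis.
From mathcomp Require Import complex.

Set Implicit Arguments.
Unset Strict Implicit.
Unset Printing Implicit Defensive.

Import Order.TTheory GRing.Theory Num.Theory.
Import numFieldNormedType.Exports.
Local Open Scope classical_set_scope.
Local Open Scope ring_scope.

(* A stacked vector of L blocks of size n has the dimension of the library's
   block-matrix notations; it equals L * n, propositionally only. *)
Notation blk L n := (\sum_(i < L) n)%N.

Section LinearAlgebra.
Context {R : realType}.

Definition quad n (M : 'M[R]_n) (v : 'cV[R]_n) : R := (v^T *m M *m v) 0 0.

Definition psdmx n (M : 'M[R]_n) : Prop :=
  M^T = M /\ forall v, 0 <= quad M v.

Definition posdefmx n (M : 'M[R]_n) : Prop :=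
  M^T = M /\ forall v, v != 0 -> 0 < quad M v.

Definition schur_stable n (M : 'M[R]_n) : Prop :=
  forall l : R[i], eigenvalue (map_mx (real_complex R) M) l -> `|l| < 1.

Definition moore_penrose m n (M : 'M[R]_(m, n)) (X : 'M[R]_(n, m)) : Prop :=
  [/\ M *m X *m M = M, X *m M *m X = X,
      (M *m X)^T = M *m X & (X *m M)^T = X *m M].

(* The pseudo-inverse is picked by (classical) choice; the Penrose equations
   always have exactly one solution, so the default value 0 is never used. *)
Definition pinv m n (M : 'M[R]_(m, n)) : 'M[R]_(n, m) :=
  xget 0 [set X | moore_penrose M X].

Definition stabilizable n m (A : 'M[R]_n) (B : 'M[R]_(n, m)) : Prop :=
  exists F : 'M[R]_(m, n), schur_stable (A + B *m F).

End LinearAlgebra.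

Section BlockMatrices.
Context {R : realType} (L : nat).

Definition ctrb_mx n m (A : 'M[R]_n) (B : 'M[R]_(n, m)) : 'M[R]_(n, blk L m) :=
  \mxrow_(j < L) (A ^+ (L - j.+1) *m B).

Definition obsv_mx n p (A : 'M[R]_n) (C : 'M[R]_(p, n)) : 'M[R]_(blk L p, n) :=
  \mxcol_(i < L) (C *m A ^+ i).

Definition markov_mx n m p (A : 'M[R]_n) (B : 'M[R]_(n, m)) (C : 'M[R]_(p, n)) :
    'M[R]_(blk L p, blk L m) :=
  \mxblock_(i < L, j < L)
    (if (j < i)%N then C *m A ^+ (i - j.+1) *m B else 0).

Definition lstep_observable n p (A : 'M[R]_n) (C : 'M[R]_(p, n)) : Prop :=
  \rank (obsv_mx A C) = n.

Definition shift_mx n : 'M[R]_(blk L n) :=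
  \mxblock_(i < L, j < L) (if j == i.+1 :> nat then 1%:M else 0 : 'M[R]_n).

Definition last_mx n : 'M[R]_(blk L n, n) :=
  \mxcol_(i < L) (if i.+1 == L then 1%:M else 0 : 'M[R]_n).

(* [s]_{t0}^{t0+L-1} *)
Definition stack n (s : nat -> 'cV[R]_n) (t0 : nat) : 'cV[R]_(blk L n) :=
  \mxcol_(i < L) s (t0 + i)%N.

End BlockMatrices.

Definition observable (R : realType) n p (A : 'M[R]_n) (C : 'M[R]_(p, n)) : Prop :=
  lstep_observable n A C.

Definition nz (L nu ny : nat) : nat := (blk L nu + blk L ny)%N.
Definition nh (L nx nu ny : nat) : nat :=
  (nz L nu ny + (blk L nx + blk L ny))%N.

Section HistoryDynamics.
Context {R : realType} (L : nat) {nx nu ny : nat}.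
Variables (A : 'M[R]_nx) (B : 'M[R]_(nx, nu)) (C : 'M[R]_(ny, nx)).

Definition AOpinv : 'M[R]_(nx, blk L ny) := A ^+ L *m pinv (obsv_mx L A C).
Definition M1 : 'M[R]_(nx, blk L nu) :=
  ctrb_mx L A B - AOpinv *m markov_mx L A B C.
Definition M2 : 'M[R]_(nx, blk L ny) := AOpinv.
Definition M3 : 'M[R]_(nx, blk L nx) :=
  ctrb_mx L A 1%:M - AOpinv *m markov_mx L A 1%:M C.
Definition M4 : 'M[R]_(nx, blk L ny) := - AOpinv.

Definition Psi : 'M[R]_(ny, nh L nx nu ny) :=
  C *m row_mx (row_mx M1 M2) (row_mx M3 M4).

Definition Theta : 'M[R]_(nh L nx nu ny) :=
  block_mx (block_mx (shift_mx L nu) 0 0 (shift_mx L ny)) 0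
           0 (block_mx (shift_mx L nx) 0 0 (shift_mx L ny))
  + col_mx (col_mx 0 (last_mx L ny *m Psi)) 0.

Definition Pi_d : 'M[R]_(nh L nx nu ny, nx + ny) :=
  col_mx (col_mx 0 (row_mx 0 (last_mx L ny)))
         (col_mx (row_mx (last_mx L nx) 0) (row_mx 0 (last_mx L ny))).

Definition Pi_u : 'M[R]_(nh L nx nu ny, nu) :=
  col_mx (col_mx (last_mx L nu) 0) 0.

Definition Gamma : 'M[R]_(nz L nu ny, nh L nx nu ny) := row_mx 1%:M 0.

Definition Upsilon : 'M[R]_(ny, nx + ny) := row_mx 0 1%:M.

Definition Theta_cl (K : 'M[R]_(nu, nz L nu ny)) : 'M[R]_(nh L nx nu ny) :=
  Theta + Pi_u *m K *m Gamma.

Definition stabilizing_gains : set 'M[R]_(nu, nz L nu ny) :=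
  [set K | schur_stable (Theta_cl K)].

End HistoryDynamics.
Arguments stabilizing_gains {R} L {nx nu ny} A B C _.

Record controller (R : realType) (nu ny : nat) := Controller {
  xdim : nat;
  cG : 'M[R]_xdim;
  cH : 'M[R]_(xdim, ny);
  cF : 'M[R]_(nu, xdim) }.

Definition realizes (R : realType) nu ny (k k' : controller R nu ny) : Prop :=
  forall i : nat, cF k *m cG k ^+ i *m cH k = cF k' *m cG k' ^+ i *m cH k'.

Definition minimal_realization (R : realType) nu ny
    (k k' : controller R nu ny) : Prop :=
  realizes k k' /\
  forall k'' : controller R nu ny, realizes k'' k' -> (xdim k <= xdim k'')%N.

Section LQG.
Context {R : realType} {nx nu ny : nat}.

Definition dare n m (A : 'M[R]_n) (B : 'M[R]_(n, m)) (S : 'M[R]_n)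
    (W : 'M[R]_m) (X : 'M[R]_n) : Prop :=
  X = A^T *m X *m A
      - A^T *m X *m B *m invmx (W + B^T *m X *m B) *m B^T *m X *m A + S.

(* The standard solution: the unique positive semidefinite one, which is
   moreover stabilizing.  When W > 0, this package is available exactly when
   (A, B) is stabilizable and (A, S) is detectable.  Without it, a semidefinite
   solution is in general neither unique nor the one giving the optimal
   internally stable loop: for n = m = 1, S = 0, B != 0 and `|A| > 1, both 0
   and (A ^+ 2 - 1) * W / B ^+ 2 solve the equation. *)
Definition standard_dare_solution n m (A : 'M[R]_n) (B : 'M[R]_(n, m))
    (S : 'M[R]_n) (W : 'M[R]_m) (X : 'M[R]_n) : Prop :=
  [/\ psdmx X, dare A B S W X,
      forall X', psdmx X' -> dare A B S W X' -> X' = X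
    & schur_stable
        (A - B *m invmx (W + B^T *m X *m B) *m B^T *m X *m A)].

Variables (A : 'M[R]_nx) (B : 'M[R]_(nx, nu)) (C : 'M[R]_(ny, nx)).

Definition F_lqg (Wu : 'M[R]_nu) (X : 'M[R]_nx) : 'M[R]_(nu, nx) :=
  - (invmx (Wu + B^T *m X *m B) *m B^T *m X *m A).

Definition H_lqg (Vv : 'M[R]_ny) (Y : 'M[R]_nx) : 'M[R]_(nx, ny) :=
  A *m Y *m C^T *m invmx (C *m Y *m C^T + Vv).

Definition lqg_controller (Wu : 'M[R]_nu) (Vv : 'M[R]_ny) (X Y : 'M[R]_nx) :
    controller R nu ny :=
  Controller (A + B *m F_lqg Wu X - H_lqg Vv Y *m C) (H_lqg Vv Y) (F_lqg Wu X).

End LQG.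

Section Realization.
Context {R : realType} {L nu ny : nat}.
Variable K : 'M[R]_(nu, nz L nu ny).

(* K is partitioned as [K^u_L, ..., K^u_1, K^y_L, ..., K^y_1], so block number
   i of its u-part (counted from 0) is K^u_(L-i); likewise for y. *)
Definition Ku (i : 'I_L) : 'M[R]_nu :=
  submxrow (lsubmx K : 'M[R]_(nu, blk L nu)) i.
Definition Ky (i : 'I_L) : 'M[R]_(nu, ny) :=
  submxrow (rsubmx K : 'M[R]_(nu, blk L ny)) i.

Definition iohG : 'M[R]_(blk L nu) :=
  \mxblock_(i < L, j < L)
    (if j.+1 == L then Ku i else if i == j.+1 :> nat then 1%:M else 0).
Definition iohH : 'M[R]_(blk L nu, ny) := \mxcol_(i < L) Ky i.
Definition iohF : 'M[R]_(nu, blk L nu) :=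
  \mxrow_(j < L) (if j.+1 == L then 1%:M else 0 : 'M[R]_nu).

Definition ioh_controller : controller R nu ny := Controller iohG iohH iohF.

(* Computed from z(L), hence only known at time L: it is the state at time 0
   for which the controller reproduces the given inputs on {0, ..., L-1}. *)
Definition ioh_xi0 (zL : 'cV[R]_(nz L nu ny)) : 'cV[R]_(xdim ioh_controller) :=
  invmx (obsv_mx L iohG iohF) *m row_mx 1%:M (- markov_mx L iohG iohH iohF)
    *m zL.

End Realization.

(* Trajectories, for one realization dw of the noise d = [w; v]. *)
Section Trajectories.
Context {R : realType} {nx nu ny : nat}.
Variables (A : 'M[R]_nx) (B : 'M[R]_(nx, nu)) (C : 'M[R]_(ny, nx)).
Variable dw : nat -> 'cV[R]_(nx + ny).

Definition wn t : 'cV[R]_nx := usubmx (dw t).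
Definition vn t : 'cV[R]_ny := dsubmx (dw t).

Section ClosedLoopController.
Variables (k : controller R nu ny) (xi0 : 'cV[R]_(xdim k)).

Fixpoint s_state (t : nat) : 'cV[R]_nx * 'cV[R]_(xdim k) :=
  if t is s.+1 then
    let: (x, xi) := s_state s in
    (A *m x + B *m (cF k *m xi) + wn s,
     cG k *m xi + cH k *m (C *m x + vn s))
  else (0, xi0).

Definition s_u t : 'cV[R]_nu := cF k *m (s_state t).2.
Definition s_y t : 'cV[R]_ny := C *m (s_state t).1 + vn t.

End ClosedLoopController.

Section InitialHistory.
Variables (L : nat) (uini : nat -> 'cV[R]_nu).

Fixpoint ini_x (t : nat) : 'cV[R]_nx :=
  if t is s.+1 then A *m ini_x s + B *m uini s + wn s else 0.

Definition ini_y t : 'cV[R]_ny := C *m ini_x t + vn t.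

Definition ini_z : 'cV[R]_(nz L nu ny) :=
  col_mx (stack L uini 0) (stack L ini_y 0).

Definition ini_h : 'cV[R]_(nh L nx nu ny) :=
  col_mx ini_z (col_mx (stack L wn 0) (stack L vn 0)).

Variable K : 'M[R]_(nu, nz L nu ny).

(* h_from s is h(L + s). *)
Fixpoint h_from (s : nat) : 'cV[R]_(nh L nx nu ny) :=
  if s is r.+1 then
    Theta L A B C *m h_from r + Pi_d L *m dw (L + r)%N
      + Pi_u L *m (K *m (Gamma L *m h_from r))
  else ini_h.

Definition h_state t := h_from (t - L).
Definition h_u t : 'cV[R]_nu := K *m (Gamma L *m h_state t).
Definition h_y t : 'cV[R]_ny := Psi L A B C *m h_state t + Upsilon *m dw t.

End InitialHistory.
End Trajectories.

Section Probability.
Context {R : realType} {dp : measure_display} {Om : measurableType dp}.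
Variable P : probability Om R.

Definition coord n (X : Om -> 'cV[R]_n) (i : 'I_n) : Om -> R := fun om => X om i 0.

(* generators of the sigma-algebra of X *)
Definition events n (X : Om -> 'cV[R]_n) : set (set Om) :=
  [set E | exists i (D : set R), measurable D /\ E = coord X i @^-1` D].

(* Every linear functional of X is normal; a normal law of variance 0 is the
   Dirac mass, which is not what normal_prob returns for standard deviation 0. *)
Definition gaussian n (V : 'M[R]_n) (X : Om -> 'cV[R]_n) : Prop :=
  (forall i, measurable_fun setT (coord X i)) /\
  forall (a : 'cV[R]_n) (D : set R), measurable D ->
    P [set om | D ((a^T *m X om) 0 0)] =
      (if quad V a == 0 then \d_(0 : R) D
       else normal_prob 0 (Num.sqrt (quad V a)) D).

Definition independent_seq (F : nat -> set (set Om)) : Prop :=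
  forall (s : seq nat) (E : nat -> set Om), uniq s ->
    (forall t, t \in s -> F t (E t)) ->
    P (\bigcap_(t in [set` s]) E t) = (\prod_(t <- s) P (E t))%E.

Definition iid_gaussian n (V : 'M[R]_n) (d : nat -> Om -> 'cV[R]_n) : Prop :=
  (forall t, gaussian V (d t)) /\
  independent_seq (fun t => <<s events (d t) >>).

(* Square-integrable initial data that do not anticipate the noise from time L
   on: jointly with d(0), ..., d(L-1), they are independent of d(L), d(L+1), etc.
   All deterministic data are admissible. *)
Definition admissible n nd (d : nat -> Om -> 'cV[R]_nd) (L : nat)
    (X : Om -> 'cV[R]_n) : Prop :=
  [/\ forall i, measurable_fun setT (coord X i),
      forall i, P.-integrable setT (fun om => (coord X i om ^+ 2)%:E)
    & forall E E' : set Om,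
        <<s events X `|` \bigcup_(t in [set t | (t < L)%N]) events (d t) >> E ->
        <<s \bigcup_(t in [set t | (L <= t)%N]) events (d t) >> E' ->
        P (E `&` E') = (P E * P E')%E].

Definition average_cost ny nu (Q : 'M[R]_ny) (Wu : 'M[R]_nu) (t0 : nat)
    (y : nat -> Om -> 'cV[R]_ny) (u : nat -> Om -> 'cV[R]_nu) : \bar R :=
  limn (fun T : nat =>
    'E_P[(fun om => T%:R^-1 *
            \sum_(t0 <= t < T.+1) (quad Q (y t om) + quad Wu (u t om)))%R])%E.

Context {nx nu ny : nat}.
Variables (A : 'M[R]_nx) (B : 'M[R]_(nx, nu)) (C : 'M[R]_(ny, nx)).
Variables (Q : 'M[R]_ny) (Wu : 'M[R]_nu).
Variable d : nat -> Om -> 'cV[R]_(nx + ny).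

Definition s_cost (k : controller R nu ny) (xi0 : Om -> 'cV[R]_(xdim k)) : \bar R :=
  average_cost Q Wu 0
    (fun t om => s_y A B C (d ^~ om) (xi0 om) t)
    (fun t om => s_u A B C (d ^~ om) (xi0 om) t).

Definition h_cost L (uini : nat -> Om -> 'cV[R]_nu)
    (K : 'M[R]_(nu, nz L nu ny)) : \bar R :=
  average_cost Q Wu L
    (fun t om => h_y A B C (d ^~ om) (uini ^~ om) K t)
    (fun t om => h_u A B C (d ^~ om) (uini ^~ om) K t).

Definition optimal_gain L (uini : nat -> Om -> 'cV[R]_nu)
    (K : 'M[R]_(nu, nz L nu ny)) : Prop :=
  stabilizing_gains L A B C K /\
  forall K', stabilizing_gains L A B C K' ->
    (h_cost uini K <= h_cost uini K')%E.

(* Initial states of the competing controllers range over all admissible ones. *)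
Definition optimal_controller L (n : nat) (k : controller R nu ny)
    (xi0 : Om -> 'cV[R]_(xdim k)) : Prop :=
  xdim k = n /\
  forall (k' : controller R nu ny) (xi0' : Om -> 'cV[R]_(xdim k')),
    xdim k' = n -> admissible d L xi0' ->
    (s_cost xi0 <= s_cost xi0')%E.

End Probability.

(* Main.v *)
(** The second moment of the state of any control loop dominates that of the
    Kalman filter error, and completing the square in the control Riccati
    recursion turns the cost of [T] steps into a telescoping sum plus stage
    costs of the two Riccati iterations started at [0].  These iterations
    converge to the standard solutions, so no causal linear loop, stable or not,
    has a smaller average cost than the LQG loop.  The average costs converge in
    [[0, +oo]] because the expected stage cost is a nonnegative solution of a
    linear recurrence.

    From time [L] on, a history law [u = K z] and the controller built from it
    produce the same signals, so the bound also applies to every history gain.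
    It is attained: eliminating the state of the minimal LQG realization [kmin]
    from a window of [L] inputs and outputs gives a gain [K0] that the LQG loop
    obeys.  An unstable mode of the history dynamics under [K0] would be a window
    of a mode of the plant in feedback with [kmin], hence of the LQG loop; so
    [K0] is stabilizing, the loop started from other histories approaches the
    LQG loop, and its cost is the LQG cost. *)

Require Import Defs.
From mathcomp Require Import all_boot all_order all_algebra.
From mathcomp Require Import all_classical all_reals all_analysis.
From mathcomp Require Import complex measurable_realfun ring lra zify.

Set Implicit Arguments.
Unset Strict Implicit.
Unset Printing Implicit Defensive.

Import Order.TTheory GRing.Theory Num.Theory.
Import numFieldNormedType.Exports.
Local Open Scope classical_set_scope.
Local Open Scope ring_scope.

(** Competing loops may be unstable, which rules out a proof with the stationary solutions alone:
    the boundary term [\tr (X *m S T)] could grow without bound. The iterates started at [0] avoid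
    it. The control iterates run backwards from a zero terminal weight, so nothing is left at the
    horizon; the filter iterates run forwards from a zero error covariance, which lies below every
    initial second moment. The price, for each accuracy, is a fixed number of inaccurate stages at
    both ends, and it averages out.

    The cost is a [limn], which bounds nothing unless the averages converge, and this is needed for
    every competitor, whatever its spectrum. Hence the Cesaro theorem for nonnegative linear
    recurrences.

    Initial controller states may depend on the noise of the first [L] steps, so moment recursions
    start at time [L]. Normality enters only through zero mean and covariance, independence only
    through absence of correlation. *)

Local Notation cnorm := ComplexField.Normc.normc.

(** * Real-valued modulus of complex numbers *)

Section ComplexNorm.
Context {R : realType}.
Implicit Types x y z : R[i].

Lemma cnormE z : (cnorm z)%:C%C = `|z|.
Proof. by []. Qed.

Lemma cnorm_ge0 z : 0 <= cnorm z.
Proof. by case: z => a b /=; exact: sqrtr_ge0. Qed.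

Lemma cnormD x y : cnorm (x + y) <= cnorm x + cnorm y.
Proof. by rewrite -lecR rmorphD/= !cnormE ler_normD. Qed.

Lemma cnormN x : cnorm (- x) = cnorm x.
Proof. by apply: complexI; rewrite !cnormE normrN. Qed.

Lemma cnormM x y : cnorm (x * y) = cnorm x * cnorm y.
Proof. exact: ComplexField.Normc.normcM. Qed.

Lemma cnormX x n : cnorm (x ^+ n) = cnorm x ^+ n.
Proof.
elim: n => [|n IH]; first by rewrite !expr0 ComplexField.Normc.normc1.
by rewrite !exprS cnormM IH.
Qed.

Lemma cnorm0 : cnorm (0 : R[i]) = 0.
Proof. exact: ComplexField.Normc.normc0. Qed.

Lemma cnorm_eq0 x : (cnorm x == 0) = (x == 0).
Proof.
apply/idP/idP => [/eqP/ComplexField.Normc.eq0_normc ->//|/eqP ->].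
by rewrite cnorm0.
Qed.

Lemma cnorm_real (a : R) : cnorm a%:C%C = `|a|.
Proof. by rewrite /= expr0n addr0 sqrtr_sqr. Qed.

Lemma cnorm_lt1 z : (`|z| < 1) = (cnorm z < 1).
Proof. by rewrite -cnormE (ltcR (cnorm z) 1). Qed.

Lemma cnorm_sum (I : Type) (r : seq I) (F : I -> R[i]) :
  cnorm (\sum_(i <- r) F i) <= \sum_(i <- r) cnorm (F i).
Proof.
elim: r => [|i r IH]; first by rewrite !big_nil cnorm0.
by rewrite !big_cons (le_trans (cnormD _ _))// lerD2l.
Qed.

End ComplexNorm.

(** * Sequences satisfying a linear recurrence *)

Section ShiftAction.
Context {F : fieldType}.
Implicit Types (p q : {poly F}) (a b : nat -> F).

(** [p] evaluated at the shift operator: sequences form a module over the polynomials, with ['X]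
    acting as the shift. *)
Definition act p a : nat -> F := fun t => \sum_(i < size p) p`_i * a (t + i)%N.

Lemma actE p a t n : (size p <= n)%N ->
  act p a t = \sum_(i < n) p`_i * a (t + i)%N.
Proof.
move=> pn; rewrite /act (big_ord_widen n (fun i => p`_i * a (t + i)%N))// big_mkcond/=.
apply: eq_bigr => i _; case: ifPn => //; rewrite -leqNgt => ip.
by rewrite nth_default// mul0r.
Qed.

Lemma actDl p q a t : act (p + q) a t = act p a t + act q a t.
Proof.
set n := maxn (size p) (size q).
rewrite (@actE (p + q) a t n) ?size_polyD// (@actE p a t n) ?leq_maxl//.
rewrite (@actE q a t n) ?leq_maxr// -big_split/=.
by apply: eq_bigr => i _; rewrite coefD mulrDl.
Qed.

Lemma actZl c p a t : act (c *: p) a t = c * act p a t.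
Proof.
rewrite (@actE _ a t (size p)) ?size_scale_leq// mulr_sumr.
by apply: eq_bigr => i _; rewrite coefZ mulrA.
Qed.

Lemma actBl p q a t : act (p - q) a t = act p a t - act q a t.
Proof. by rewrite actDl -scaleN1r actZl mulN1r. Qed.

Lemma actDr p a b t : act p (fun s => a s + b s) t = act p a t + act p b t.
Proof. by rewrite /act -big_split/=; apply: eq_bigr => i _; rewrite mulrDr. Qed.

Lemma actZr p c a t : act p (fun s => c * a s) t = c * act p a t.
Proof. by rewrite /act mulr_sumr; apply: eq_bigr => i _; rewrite mulrCA. Qed.

Lemma actC c a t : act c%:P a t = c * a t.
Proof.
by rewrite (@actE _ a t 1) ?size_polyC_leq1// big_ord1 coefC eqxx addn0.
Qed.

Lemma act_mulX p a t : act (p * 'X) a t = act p a t.+1.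
Proof.
rewrite (@actE _ a t (size p).+1) ?(leq_trans (size_polyMleq _ _))//; last first.
  by rewrite size_polyX addn2.
rewrite big_ord_recl coefMX eqxx mul0r add0r.
by apply: eq_bigr => i _; rewrite coefMX/= addnS.
Qed.

Lemma actM p q a : act (p * q) a = act p (act q a).
Proof.
elim/poly_ind: p => [|p c IH]; apply/funext => t.
  by rewrite mul0r /act size_poly0 !big_ord0.
rewrite mulrDl !actDl mul_polyC actZl actC mulrAC !act_mulX.
by rewrite IH.
Qed.

Lemma act_XsubC l a t : act ('X - l%:P) a t = a t.+1 - l * a t.
Proof. by rewrite actBl actC -['X]mul1r act_mulX (actC 1) mul1r. Qed.

Definition annihilates p a := forall t, act p a t = 0.

Lemma act0r p t : act p (fun=> 0) t = 0.
Proof. by rewrite /act big1// => i _; rewrite mulr0. Qed.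

Lemma annihilates_mull p q a : annihilates q a -> annihilates (p * q) a.
Proof.
move=> qa t; rewrite actM; have -> : act q a = fun=> 0 by apply/funext.
exact: act0r.
Qed.

Lemma annihilates_XsubC l a : annihilates ('X - l%:P) a ->
  forall t, a t = l ^+ t * a 0%N.
Proof.
move=> la; elim=> [|t IH]; first by rewrite expr0 mul1r.
by have := la t; rewrite act_XsubC => /eqP; rewrite subr_eq0 => /eqP ->; rewrite IH exprS mulrA.
Qed.

(** Cayley-Hamilton: letting [p] act on this sequence inserts the factor [p(M)]. *)
Lemma annihilates_charpoly n (M : 'M[F]_n) (b : 'rV[F]_n) (c : 'cV[F]_n) :
  annihilates (char_poly M) (fun t => (b *m M ^+ t *m c) 0 0).
Proof.
case: n M b c => [|n] M b c t.
  by rewrite /act big1// => i _; rewrite [b]thinmx0 mul0mx mul0mx mxE mulr0.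
have CH := Cayley_Hamilton M.
have -> : act (char_poly M) (fun t => (b *m M ^+ t *m c) 0 0) t =
    (b *m M ^+ t *m horner_mx M (char_poly M) *m c) 0 0.
  rewrite -[char_poly M in RHS]coefK poly_def rmorph_sum/= mulmx_sumr mulmx_suml summxE.
  apply: eq_bigr => i _.
  rewrite linearZ/= rmorphXn/= horner_mx_X -scalemxAr -scalemxAl [RHS]mxE.
  by congr (_ * (_ *m _) _ _); rewrite exprD -mulmxA.
by rewrite CH mulmx0 mul0mx mxE.
Qed.

End ShiftAction.

(** * Cesaro means and stable recurrences *)

Section Means.
Context {R : realType}.

Definition mean (a : nat -> R) (n : nat) : R := n%:R^-1 * \sum_(t < n) a t.

Lemma cvg_mean a (l : R) : a @ \oo --> l -> mean a @ \oo --> l.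
Proof.
move=> /cesaro al; rewrite -cvg_shiftS.
have -> // : [sequence mean a n.+1]_n = arithmetic_mean a.
by apply/funext => n; rewrite /mean /arithmetic_mean/= /series/= big_mkord.
Qed.

Lemma cvg_natV : (n%:R^-1 : R) @[n --> \oo] --> (0 : R).
Proof. by rewrite -cvg_shiftS; exact: cvg_harmonic. Qed.

Lemma null_contract (x b : nat -> R) (rho : R) : 0 <= rho < 1 ->
  (forall t, 0 <= x t) -> (forall t, x t.+1 <= rho * x t + b t) ->
  b @ \oo --> (0 : R) -> x @ \oo --> (0 : R).
Proof.
move=> /andP[rho0 rho1] x0 xrec b0.
apply/cvgr0Pnorm_le => e e0.
(* [e / 2] is the fixed point of [x |-> rho * x + e / 2 * (1 - rho)], so the perturbations add up to
   at most [e / 2]. *)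
have e' : 0 < e / 2 * (1 - rho) by rewrite mulr_gt0 ?divr_gt0// subr_gt0.
move/cvgr0Pnorm_le : b0 => /(_ _ e') [N _ bN].
have bound k : x (N + k)%N <= rho ^+ k * x N + e / 2.
  elim: k => [|k IH]; first by rewrite expr0 mul1r addn0 lerDl divr_ge0// ltW.
  rewrite addnS (le_trans (xrec _))//.
  have bk : b (N + k)%N <= e / 2 * (1 - rho).
    by rewrite (le_trans (ler_norm _))// bN//= leq_addr.
  have := ler_wpM2l rho0 IH; rewrite mulrDr mulrA -exprS => IH'.
  by rewrite (le_trans (lerD IH' bk))//; lra.
have geo : rho ^+ k * x N @[k --> \oo] --> (0 : R).
  have -> : (fun k => rho ^+ k * x N) = geometric (x N) rho.
    by apply/funext => k; rewrite /geometric/= mulrC.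
  by apply: cvg_geometric; rewrite ger0_norm.
have e2 : 0 < e / 2 by rewrite divr_gt0.
move/cvgr0Pnorm_le : geo => /(_ _ e2) [K _ geoK].
exists (N + K)%N => // t /= NKt.
rewrite ger0_norm//.
have -> : t = (N + (t - N))%N by rewrite subnKC// (leq_trans _ NKt)// leq_addr.
rewrite (le_trans (bound _))// [leRHS]splitr lerD2r.
by rewrite (le_trans (ler_norm _))// geoK//= leq_subRL// (leq_trans _ NKt)// leq_addr.
Qed.

(** One root at a time: [b], the image of [a] under ['X - r], tends to zero by induction, and [a]
    follows a contraction by [r] perturbed by [b]. *)
Lemma null_of_stable_roots (rs : seq R[i]) (a : nat -> R[i]) :
  all (fun r => cnorm r < 1) rs ->
  annihilates (\prod_(r <- rs) ('X - r%:P)) a ->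
  (fun t => cnorm (a t)) @ \oo --> (0 : R).
Proof.
elim: rs a => [|r rs IH] a.
  rewrite big_nil => _ a0.
  have -> : (fun t => cnorm (a t)) = fun=> 0.
    apply/funext => t; have := a0 t; rewrite -[1]/(1%:P) actC mul1r => ->.
    exact: cnorm0.
  exact: cvg_cst.
rewrite big_cons mulrC => /andP[r1 rs1] ann.
set b := act ('X - r%:P) a.
have annb : annihilates (\prod_(r <- rs) ('X - r%:P)) b.
  by move=> t; rewrite /b -actM ann.
apply: (@null_contract _ (fun t => cnorm (b t)) (cnorm r)) => //.
- by rewrite cnorm_ge0.
- by move=> t; exact: cnorm_ge0.
- move=> t; have -> : a t.+1 = r * a t + b t.
    by rewrite /b act_XsubC addrC subrK.
  by rewrite (le_trans (cnormD _ _))// cnormM.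
- exact: IH.
Qed.

(** The roots of the characteristic polynomial are the eigenvalues, so the recurrence it imposes on
    the entries of the powers replaces a Jordan form. *)
Lemma null_pow_schur n (M : 'M[R]_n) (b : 'rV[R]_n) (c : 'cV[R]_n) :
  schur_stable M -> (fun t => (b *m M ^+ t *m c) 0 0) @ \oo --> (0 : R).
Proof.
move=> sM; pose toC := real_complex R.
pose Mc := map_mx toC M.
have [rs prs] := closed_field_poly_normal (char_poly Mc).
rewrite (eqP (char_poly_monic Mc)) scale1r in prs.
have st : all (fun r => cnorm r < 1) rs.
  apply/allP => r rrs; rewrite -cnorm_lt1; apply: sM.
  by rewrite eigenvalue_root_char -/Mc prs root_prod_XsubC.
have := annihilates_charpoly Mc (map_mx toC b) (map_mx toC c).
rewrite prs => /(null_of_stable_roots st).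
have -> : (fun t => cnorm ((map_mx toC b *m Mc ^+ t *m map_mx toC c) 0 0)) =
          (fun t => `|(b *m M ^+ t *m c) 0 0|).
  apply/funext => t; rewrite -cnorm_real.
  have -> : Mc ^+ t = map_mx toC (M ^+ t).
    elim: t => [|t IH]; first by rewrite !expr0 map_mx1.
    by rewrite !exprS [LHS]/(_ *m _) [M * _]/(_ *m _) map_mxM IH.
  by rewrite -!map_mxM mxE.
move=> h; apply/cvgr0Pnorm_le => e e0; move/cvgr0Pnorm_le : h => /(_ e e0).
by apply: filterS => t; rewrite normr_id.
Qed.

End Means.

(** * Cesaro limits of nonnegative linear recurrences *)

Section CesaroLimit.
Context {R : realType}.
Local Notation toC := (real_complex R).

Definition cmean (a : nat -> R[i]) (n : nat) : R[i] :=
  (toC n%:R^-1) * \sum_(t < n) a t.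

Definition cmean_cvg (a : nat -> R[i]) (w : R[i]) :=
  (fun n => cnorm (cmean a n - w)) @ \oo --> (0 : R).

Lemma null_dominated (x y : nat -> R) : (forall t, 0 <= x t <= y t) ->
  y @ \oo --> (0 : R) -> x @ \oo --> (0 : R).
Proof.
move=> xy y0; apply: (squeeze_cvgr _ (cvg_cst 0) y0).
by near=> t; exact: xy.
Unshelve. all: by end_near. Qed.

Lemma cmean_cvgD a b w z : cmean_cvg a w -> cmean_cvg b z ->
  cmean_cvg (fun t => a t + b t) (w + z).
Proof.
move=> aw bz; rewrite /cmean_cvg.
apply: (@null_dominated _ (fun n => cnorm (cmean a n - w) + cnorm (cmean b n - z))).
  move=> n; rewrite cnorm_ge0/=.
  have -> : cmean (fun t => a t + b t) n - (w + z) = (cmean a n - w) + (cmean b n - z).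
    by rewrite /cmean big_split/= mulrDr; ring.
  exact: cnormD.
by rewrite -[X in _ --> X](addr0 0); apply: cvgD.
Qed.

Lemma cmean_null a : (fun t => cnorm (a t)) @ \oo --> (0 : R) -> cmean_cvg a 0.
Proof.
move=> /cvg_mean a0; apply: null_dominated a0 => n.
rewrite cnorm_ge0/= subr0 /cmean /mean cnormM cnorm_real ger0_norm ?invr_ge0//.
by rewrite ler_wpM2l ?invr_ge0//; exact: cnorm_sum.
Qed.

Lemma cmean_unit r (c : R[i]) : cnorm r = 1 ->
  exists w, cmean_cvg (fun t => r ^+ t * c) w.
Proof.
move=> r1; have [->|rn1] := eqVneq r 1.
  exists c; rewrite /cmean_cvg -cvg_shiftS.
  have -> : [sequence cnorm (cmean (fun t => 1 ^+ t * c) n.+1 - c)]_n = fun=> 0.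
    apply/funext => n; rewrite /= /cmean.
    under eq_bigr do rewrite expr1n mul1r.
    rewrite sumr_const card_ord -[c *+ _]mulr_natl mulrA.
    rewrite -(rmorph_nat toC) -rmorphM mulVf ?pnatr_eq0//.
    by rewrite rmorph1 mul1r subrr cnorm0.
  exact: cvg_cst.
exists 0; rewrite /cmean_cvg.
(* Geometric sums with a ratio [r != 1] on the unit circle are bounded by [2 / |r - 1|]. *)
pose K := 2 * cnorm c / cnorm (r - 1).
have rn0 : 0 < cnorm (r - 1).
  by rewrite lt_neqAle cnorm_ge0 andbT eq_sym cnorm_eq0 subr_eq0.
apply: (@null_dominated _ (fun n => n%:R^-1 * K)) => [n|].
  rewrite cnorm_ge0/= subr0 /cmean cnormM cnorm_real ger0_norm ?invr_ge0//.
  rewrite ler_wpM2l ?invr_ge0// -mulr_suml cnormM.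
  have geo : (r - 1) * (\sum_(i < n) r ^+ i) = r ^+ n - 1 by rewrite -subrX1.
  have : cnorm (r - 1) * cnorm (\sum_(i < n) r ^+ i) <= 2.
    rewrite -cnormM geo (le_trans (cnormD _ _))// cnormX r1 expr1n cnormN.
    by rewrite ComplexField.Normc.normc1.
  rewrite -ler_pdivlMl// => h.
  have -> : K = (cnorm (r - 1))^-1 * 2 * cnorm c by rewrite /K; ring.
  by apply: ler_wpM2r => //; exact: cnorm_ge0.
by rewrite -[X in _ --> X](mul0r K); apply: cvgM; [exact: cvg_natV|exact: cvg_cst].
Qed.

(* One unit root is split off by evaluating the cofactor [g] of ['X - r]:
   [a = g(shift) a / g(r) + (1 - g / g(r))(shift) a]. *)
Lemma cmean_of_roots (us ss : seq R[i]) (a : nat -> R[i]) :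
  uniq us -> all (fun r => cnorm r == 1) us -> all (fun r => cnorm r < 1) ss ->
  annihilates (\prod_(r <- us) ('X - r%:P) * \prod_(r <- ss) ('X - r%:P)) a ->
  exists w, cmean_cvg a w.
Proof.
elim: us a => [|r us IH] a.
  rewrite big_nil mul1r => _ _ sss ann.
  by exists 0; apply: cmean_null; exact: null_of_stable_roots ann.
move=> /= /andP[rus uus] /andP[/eqP r1 us1] ss1.
rewrite big_cons -mulrA.
set g := \prod_(j <- us) _ * _ => ann.
have gr : g.[r] != 0.
  rewrite -/(root g r) /g rootM !root_prod_XsubC (negbTE rus)/=.
  by apply/negP => /(allP ss1); rewrite r1 ltxx.
pose u t := g.[r]^-1 * act g a t.
have annu : annihilates ('X - r%:P) u.
  by move=> t; rewrite /u actZr -actM ann mulr0.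
have uE := annihilates_XsubC annu.
pose b t := a t - u t.
have annb : annihilates g b.
  have : root (g - (g.[r])%:P) r by rewrite /root hornerD hornerN hornerC subrr.
  case/factor_theorem => h gE t.
  have -> : b = fun s => a s + (- g.[r]^-1) * act g a s.
    by apply/funext => s; rewrite /b /u mulNr.
  rewrite actDr actZr -actM.
  have -> : g * g = h * (('X - r%:P) * g) + g.[r] *: g.
    by rewrite mulrA -gE mulrBl -mul_polyC subrK.
  rewrite actDl actZl (annihilates_mull h ann) add0r mulNr mulKf//.
  by rewrite subrr.
have [w bw] := IH b uus us1 ss1 annb.
have [z uz] := cmean_unit (u 0%N) r1.
exists (z + w); have -> : a = fun t => r ^+ t * u 0%N + b t.
  by apply/funext => t; rewrite -uE /b addrC subrK.
exact: cmean_cvgD.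
Qed.

(** The polynomial is complex so that it splits into linear factors. *)
Definition linrec (q : nat -> R) :=
  exists2 p : {poly R[i]}, p != 0 & annihilates p (fun t => toC (q t)).

(** Serves to refute growth: filtered values that grow linearly have quadratically growing sums,
    against sums that are at most linear infinitely often. *)
Lemma quadratic_beats_linear (m : nat) (delta K M : R) : 0 < delta ->
  exists N, forall n, (N <= n)%N ->
    M * n%:R < \sum_(t < n - m) (delta * t%:R - K).
Proof.
move=> d0.
have sumE k : \sum_(t < k) (delta * t%:R - K) =
    k%:R * (delta * (k%:R - 1) - 2 * K) / 2.
  elim: k => [|k IH]; first by rewrite big_ord0 !mul0r.
  by rewrite big_ord_recr/= IH -natr1; field.
(* Beyond [B] both [k1] and [k2] hold: the first absorbs the shift by [m], the second makes the sum
   exceed [(|M| + 1) * k]. *)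
pose B := `|M| * m%:R + 1 + `|(2 * K + 2 * `|M| + 2) / delta + 1|.
exists (m + (Num.truncn B).+1)%N => n Nn.
rewrite sumE; set k := (n - m)%N.
have nE : n = (k + m)%N by rewrite subnK// (leq_trans _ Nn)// leq_addr.
have kB : B < k%:R.
  rewrite (lt_le_trans (truncnS_gt B))// ler_nat.
  by rewrite /k leq_subRL// (leq_trans _ Nn)// leq_addr.
have M0 := normr_ge0 M; have m0 : (0 : R) <= m%:R by exact: ler0n.
have k1 : `|M| * m%:R + 1 < k%:R.
  by apply: le_lt_trans kB; rewrite /B lerDl.
have k2 : 2 * K + 2 * `|M| + 2 < delta * (k%:R - 1).
  rewrite -ltr_pdivrMl// ltrBrDr [_^-1 * _]mulrC (le_lt_trans (ler_norm _))//.
  apply: le_lt_trans kB; rewrite /B lerDr.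
  by rewrite addr_ge0// mulr_ge0.
rewrite nE natrD; have := ler_norm M => MM.
have k0 : (0 : R) <= k%:R by exact: ler0n.
apply: (@le_lt_trans _ _ (`|M| * (k%:R + m%:R))).
  by rewrite ler_wpM2r// addr_ge0.
apply: (@lt_le_trans _ _ (k%:R * (2 * `|M| + 2) / 2)); first lra.
rewrite ler_pM2r ?invr_gt0// ler_wpM2l//; lra.
Qed.

(** Each [q t] is met at most once per coefficient of [g]; stopping [size g] short of [n] keeps all
    shifted indices below [n]. *)
Lemma sum_act_le (q : nat -> R) (g : {poly R[i]}) n :
  (forall t, 0 <= q t) ->
  \sum_(t < n - size g) cnorm (act g (fun t => toC (q t)) t) <=
  (\sum_(i < size g) cnorm g`_i) * \sum_(t < n) q t.
Proof.
move=> q0.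
apply: (@le_trans _ _ (\sum_(t < n - size g) \sum_(i < size g) cnorm g`_i * q (t + i)%N)).
  apply: ler_sum => t _; rewrite (le_trans (cnorm_sum _ _))//.
  by apply: ler_sum => i _; rewrite cnormM cnorm_real ger0_norm.
rewrite exchange_big/= mulr_suml; apply: ler_sum => i _.
rewrite -mulr_sumr ler_wpM2l ?cnorm_ge0//.
have [ng|gn] := leqP n (size g).
  by rewrite (eqP ng) big_ord0 sumr_ge0.
have le1 : (n - size g + i <= n)%N.
  by rewrite -[leqRHS](subnK (ltnW gn)) leq_add2l ltnW.
rewrite -(big_mkord xpredT q) -(big_mkord xpredT (fun t => q (t + i)%N)).
have in_ : (i <= n)%N := leq_trans (leq_addl _ _) le1.
rewrite (big_cat_nat (leq0n i) in_)/= (big_cat_nat (leq_addl _ _) le1)/=.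
have -> : \sum_(0 <= t < n - size g) q (t + i)%N =
          \sum_(i <= t < n - size g + i) q t.
  by rewrite -{2}[i : nat]add0n big_addn addnK.
rewrite addrCA lerDl addr_ge0// sumr_ge0//.
Qed.

(** If the means do not tend to infinity, the partial sums stay below [A * n] for infinitely many
    [n]. Cancelling all roots of a minimal annihilator except one of modulus above 1, or except a
    double root on the unit circle, would leave a sequence of at least linear growth, which this
    bound and [0 <= q] exclude. Simple unit roots and roots inside the disc remain, and for these
    the means converge. *)
Theorem cesaro_linrec (q : nat -> R) : (forall t, 0 <= q t) -> linrec q ->
  (exists l, mean q @ \oo --> (l : R)) \/ mean q @ \oo --> +oo.
Proof.
move=> q0 [p0 p0n0 p0q].
(* Minimality ensures that every root contributes: no proper part of the root list annihilates [q],
   so [b] in [geom] is nonzero. *)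
have [p pn0 [pq pmin]] : exists2 p : {poly R[i]}, p != 0 &
    annihilates p (fun t => toC (q t)) /\
    forall g, g != 0 -> annihilates g (fun t => toC (q t)) -> (size p <= size g)%N.
  have ex : exists n, `[< exists2 p : {poly R[i]}, p != 0 &
      annihilates p (fun t => toC (q t)) /\ size p = n >].
    by exists (size p0); apply/asboolP; exists p0.
  case: (ex_minnP ex) => n /asboolP[p pn0 [pq pn]] nmin.
  exists p => //; split => // g gn0 gq; rewrite pn; apply: nmin.
  by apply/asboolP; exists g.
have [|fin] := pselect (forall A : R, \forall n \near \oo, A <= mean q n).
  by right; apply/cvgryPge.
have [A freq] : exists A : R, forall N, exists2 n, (N <= n)%N & \sum_(t < n) q t <= A * n%:R.
  have [A nA] : exists A : R, ~ \forall n \near \oo, A <= mean q n.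
    by apply/existsNP.
  exists A => N; apply: contrapT => nex; apply: nA.
  exists N.+1 => // n /= Nn; rewrite leNgt; apply/negP => nA; apply: nex.
  exists n; first exact: ltnW.
  rewrite -ler_pdivrMr ?ltr0n ?(leq_ltn_trans _ Nn)// mulrC ltW//.
have [rs prs] := closed_field_poly_normal p.
pose pi (s : seq R[i]) : {poly R[i]} := \prod_(r <- s) ('X - r%:P).
have pi_n0 s : pi s != 0 by rewrite monic_neq0// monic_prod_XsubC.
have lcn0 : lead_coef p != 0 by rewrite lead_coef_eq0.
have piq : annihilates (pi rs) (fun t => toC (q t)).
  move=> t; have := pq t; rewrite prs actZl => /eqP.
  by rewrite mulf_eq0 (negbTE lcn0) => /eqP.
have not_ann s : (size s < size rs)%N -> ~ annihilates (pi s) (fun t => toC (q t)).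
  move=> srs /(pmin _ (pi_n0 s)).
  by rewrite prs size_scale// !size_prod_XsubC ltnNge srs.
have grow s (delta K : R) : 0 < delta ->
    (forall t, delta * t%:R - K <= cnorm (act (pi s) (fun t => toC (q t)) t)) -> False.
  move=> d0 low; set S := \sum_(i < size (pi s)) cnorm (pi s)`_i.
  have [N hN] := quadratic_beats_linear (size (pi s)) K (S * A) d0.
  have [n Nn /(ler_wpM2l (_ : 0 <= S)) hn] := freq N.
  have S0 : 0 <= S by apply: sumr_ge0 => i _; exact: cnorm_ge0.
  have := hN n Nn; rewrite ltNge => /negP; apply.
  rewrite -mulrA (le_trans _ (hn S0))// (le_trans _ (sum_act_le _ _ q0))//.
  by apply: ler_sum => t _; exact: low.
have geom r s : perm_eq rs (r :: s) -> exists2 b : R[i], b != 0 &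
    forall t, act (pi s) (fun t => toC (q t)) t = r ^+ t * b.
  move=> rs_rs; have rsE : pi rs = ('X - r%:P) * pi s.
    by rewrite /pi (perm_big _ rs_rs) big_cons.
  have ann : annihilates ('X - r%:P) (act (pi s) (fun t => toC (q t))).
    by move=> t; rewrite -actM -rsE piq.
  exists (act (pi s) (fun t => toC (q t)) 0%N); last exact: annihilates_XsubC.
  apply/eqP => b0; apply: (not_ann s); first by rewrite (perm_size rs_rs).
  by move=> t; rewrite (annihilates_XsubC ann) b0 mulr0.
have rs_le1 r : r \in rs -> cnorm r <= 1.
  move=> rrs; rewrite leNgt; apply/negP => r1.
  have [b bn0 gb] := geom r _ (perm_to_rem rrs).
  have b0 : 0 < cnorm b by rewrite lt_neqAle cnorm_ge0 eq_sym cnorm_eq0 bn0.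
  apply: (grow (rem r rs) ((cnorm r - 1) * cnorm b) 0 _ _) => [|t].
    by rewrite mulr_gt0// subr_gt0.
  rewrite subr0 gb cnormM cnormX mulrAC ler_pM2r//.
  (* Bernoulli's inequality turns geometric growth into linear growth. *)
  have bern : 1 + (cnorm r - 1) * t%:R <= cnorm r ^+ t.
    elim: t => [|t IH]; first by rewrite mulr0 addr0 expr0.
    rewrite exprS; have := ler_wpM2l (cnorm_ge0 r) IH.
    apply: le_trans; rewrite -natr1.
    have : 0 <= (cnorm r - 1) * ((cnorm r - 1) * t%:R).
      by rewrite !mulr_ge0// subr_ge0 ltW.
    lra.
  by apply: le_trans bern; rewrite lerDr.
have rs_simple r : cnorm r = 1 -> (count_mem r rs <= 1)%N.
  move=> r1; rewrite leqNgt; apply/negP => c2.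
  have rrs : r \in rs by rewrite -has_pred1 has_count (ltn_trans _ c2).
  have p1 := perm_to_rem rrs.
  have rrs2 : r \in rem r rs.
    by rewrite -has_pred1 has_count; move: c2; rewrite (permP p1)/= eqxx add1n ltnS.
  have p2 := perm_to_rem rrs2; set s := rem r (rem r rs) in p2.
  have [b bn0 gb] := geom r _ p1.
  have b0 : 0 < cnorm b by rewrite lt_neqAle cnorm_ge0 eq_sym cnorm_eq0 bn0.
  set c := act (pi s) (fun t => toC (q t)).
  have crec t : c t.+1 = r * c t + r ^+ t * b.
    rewrite -gb; have -> : pi (rem r rs) = ('X - r%:P) * pi s.
      by rewrite /pi (perm_big _ p2) big_cons.
    by rewrite actM act_XsubC addrC subrK.
  (* A double unit root yields [r ^+ t] times an affine function of [t] with slope [b], hence linear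
     growth of the modulus. *)
  have cE t : r * c t = r ^+ t * (r * c 0%N + t%:R * b).
    elim: t => [|t IH]; first by rewrite expr0 mul1r mul0r addr0.
    by rewrite crec mulrDr IH exprS -natr1; ring.
  apply: (grow s (cnorm b) (cnorm (c 0%N)) b0) => t.
  have -> : cnorm (c t) = cnorm (r * c 0%N + t%:R * b).
    have -> : cnorm (c t) = cnorm (r * c t) by rewrite cnormM r1 mul1r.
    by rewrite cE cnormM cnormX r1 expr1n mul1r.
  have := cnormD (r * c 0%N + t%:R * b) (- (r * c 0%N)).
  rewrite addrAC subrr add0r cnormN cnormM cnormM r1 mul1r -(rmorph_nat toC) cnorm_real.
  by rewrite ger0_norm// lerBlDr mulrC.
pose us := [seq r <- rs | cnorm r == 1]; pose ss := [seq r <- rs | cnorm r != 1].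
have us_uniq : uniq us.
  apply: count_mem_uniq => r; have [rus|/count_memPn->//] := boolP (r \in us).
  have := rus; rewrite mem_filter => /andP[/eqP r1 _].
  apply/eqP; rewrite eqn_leq -has_count has_pred1 rus andbT.
  apply: leq_trans (rs_simple r r1); rewrite count_filter.
  by apply: sub_count => z /andP[].
have [|||w qw] := @cmean_of_roots us ss (fun t => toC (q t)) us_uniq.
- by apply/allP => r; rewrite mem_filter => /andP[].
- apply/allP => r; rewrite mem_filter => /andP[r1 /rs_le1]; rewrite le_eqVlt (negbTE r1)//.
- have e : pi us * pi ss = pi rs.
    rewrite /pi -big_cat/=; apply: perm_big.
    by rewrite perm_sym -(perm_filterC (fun r => cnorm r == 1)).
  by rewrite -/(pi us) -/(pi ss) e.
(* The means are real, so they converge to the real part of their complex limit. *)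
left; exists (complex.Re w); apply/cvgrPdist_le => e e0.
move/cvgr0Pnorm_le : qw => /(_ e e0); apply: filterS => n.
rewrite (ger0_norm (cnorm_ge0 _)); apply: le_trans.
have -> : cmean (fun t => toC (q t)) n = toC (mean q n).
  by rewrite /cmean /mean rmorphM rmorph_sum.
rewrite distrC; have -> : mean q n - complex.Re w = complex.Re (toC (mean q n) - w).
  by case: w.
by rewrite -lecR cnormE normc_ge_Re.
Qed.

End CesaroLimit.

(** * Positive semidefinite matrices *)

Section Psd.
Context {R : realType}.

Lemma mxDE (V : nmodType) m n (A B : 'M[V]_(m, n)) i j : (A + B) i j = A i j + B i j.
Proof. by rewrite mxE. Qed.

Lemma mxNE (V : zmodType) m n (A : 'M[V]_(m, n)) i j : (- A) i j = - A i j.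
Proof. by rewrite mxE. Qed.

Lemma trmxD m n (A B : 'M[R]_(m, n)) : (A + B)^T = A^T + B^T.
Proof. by rewrite linearD. Qed.

Lemma trmxN m n (A : 'M[R]_(m, n)) : (- A)^T = - A^T.
Proof. by rewrite linearN. Qed.

Lemma psdmx0 n : psdmx (0 : 'M[R]_n).
Proof. by split=> [|v]; rewrite ?trmx0// /quad mulmx0 mul0mx mxE. Qed.

Lemma quadD n (X Y : 'M[R]_n) v : quad (X + Y) v = quad X v + quad Y v.
Proof. by rewrite /quad mulmxDr mulmxDl mxDE. Qed.

Lemma quadN n (X : 'M[R]_n) v : quad (- X) v = - quad X v.
Proof. by rewrite /quad mulmxN mulNmx mxNE. Qed.

Lemma psdmxD n (X Y : 'M[R]_n) : psdmx X -> psdmx Y -> psdmx (X + Y).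
Proof.
move=> [tX qX] [tY qY]; split=> [|v]; first by rewrite trmxD tX tY.
by rewrite quadD addr_ge0.
Qed.

Lemma psdmx_conj m n (M : 'M[R]_(m, n)) (X : 'M[R]_n) :
  psdmx X -> psdmx (M *m X *m M^T).
Proof.
move=> [tX qX]; split=> [|v]; first by rewrite !trmx_mul trmxK tX mulmxA.
have -> : quad (M *m X *m M^T) v = quad X (M^T *m v).
  by rewrite /quad trmx_mul trmxK !mulmxA.
exact: qX.
Qed.

Lemma psdmx_conjt m n (M : 'M[R]_(n, m)) (X : 'M[R]_n) :
  psdmx X -> psdmx (M^T *m X *m M).
Proof. by move=> /(psdmx_conj M^T); rewrite trmxK. Qed.

Lemma posdef_psd n (X : 'M[R]_n) : posdefmx X -> psdmx X.
Proof.
move=> [tX qX]; split=> // v; have [->|v0] := eqVneq v 0; last exact/ltW/qX.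
by rewrite /quad mulmx0 mxE.
Qed.

Lemma posdef_addpsd n (X Y : 'M[R]_n) : posdefmx X -> psdmx Y -> posdefmx (X + Y).
Proof.
move=> [tX qX] [tY qY]; split=> [|v v0]; first by rewrite trmxD tX tY.
by rewrite quadD ltr_pwDl// qX.
Qed.

Lemma posdef_unit n (X : 'M[R]_n) : posdefmx X -> X \in unitmx.
Proof.
move=> [tX qX]; rewrite unitmxE unitfE; apply/negP => /det0P[v v0 vX].
have vT0 : v^T != 0 by apply: contra v0 => /eqP v0; rewrite -[v]trmxK v0 trmx0.
by have := qX _ vT0; rewrite /quad trmxK vX mul0mx mxE ltxx.
Qed.

(** With [X i i = 0] the form at [t *: e_i + e_j] is affine in [t], and an affine function bounded
    below is constant. *)
Lemma psd_diag0 n (X : 'M[R]_n) i j : psdmx X -> X i i = 0 -> X i j = 0.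
Proof.
move=> [tX qX] Xii.
have Xji : X j i = X i j by rewrite -[in LHS]tX mxE.
have q (t : R) : 0 <= 2 * t * X i j + X j j.
  have := qX (t *: delta_mx i 0 + delta_mx j 0).
  have e (k l : 'I_n) : ((delta_mx k 0 : 'cV[R]_n)^T *m X *m (delta_mx l 0 : 'cV[R]_n)) 0 0 = X k l.
    by rewrite trmx_delta -rowE -colE !mxE.
  rewrite /quad trmxD linearZ/= !mulmxDl !mulmxDr -!scalemxAl -!scalemxAr.
  rewrite !mxDE !scalerA.
  have zE (c : R) (M : 'M[R]_1) : (c *: M) 0 0 = c * M 0 0 by rewrite mxE.
  rewrite !zE !e Xii Xji; lra.
(* At this [t] the form would be [-1]. *)
apply/eqP; apply: contraT => x0; have := q (- (X j j + 1) / (2 * X i j)).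
have -> : 2 * (- (X j j + 1) / (2 * X i j)) * X i j + X j j = - 1 by field.
by rewrite oppr_ge0 ler10.
Qed.

(** Cholesky by induction: subtracting [a^-1 *: (c *m c^T)], built from the first column, clears the
    first row and column. This reduces traces of products to values of quadratic forms. *)
Lemma psd_rank_one_sum n (X : 'M[R]_n) : psdmx X ->
  exists s : seq 'cV[R]_n, X = \sum_(v <- s) v *m v^T.
Proof.
elim: n X => [|n IH] X psdX.
  by exists [::]; rewrite big_nil; apply/matrixP => -[].
have zero (Z : 'M[R]_n.+1) : psdmx Z -> Z 0 0 = 0 ->
    exists s : seq 'cV[R]_n.+1, Z = \sum_(v <- s) v *m v^T.
  move=> psdZ Z0; pose D := drsubmx (Z : 'M[R]_(1 + n)).
  have symZ i j : Z i j = Z j i by rewrite -[in LHS]psdZ.1 mxE.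
  have ZE : Z = block_mx 0 0 0 D :> 'M[R]_(1 + n).
    rewrite -[LHS](@submxK _ 1 n 1 n); congr block_mx; apply/matrixP => i j.
    - by rewrite !mxE !ord1 lshift0.
    - by rewrite !mxE !ord1 lshift0 psd_diag0.
    - by rewrite !mxE !ord1 lshift0 symZ psd_diag0.
  have psdD : psdmx D.
    have -> : D = row_mx 0 1%:M *m (Z : 'M[R]_(1 + n)) *m (row_mx 0 1%:M)^T.
      rewrite ZE tr_row_mx mul_row_block mul_row_col.
      by rewrite trmx0 trmx1 !mulmx0 mul1mx mulmx1 !add0r.
    exact: psdmx_conj.
  have [s sD] := IH D psdD.
  exists [seq (col_mx 0 v : 'cV[R]_(1 + n)) | v <- s].
  rewrite big_map ZE sD.
  have vE (v : 'cV[R]_n) :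
      (col_mx 0 v : 'cV[R]_(1 + n)) *m (col_mx 0 v : 'cV[R]_(1 + n))^T =
      (block_mx 0 0 0 (v *m v^T) : 'M[R]_(1 + n)).
    by rewrite tr_col_mx mul_col_row trmx0 !mulmx0 !mul0mx.
  elim: s {sD} => [|v s IHs]; first by rewrite !big_nil block_mx0.
  rewrite 2!big_cons.
  transitivity ((block_mx 0 0 0 (v *m v^T) : 'M[R]_(1 + n)) +
      block_mx 0 0 0 (\sum_(v <- s) v *m v^T)).
    by rewrite (@add_block_mx _ 1 n 1 n) !addr0.
  by congr (_ + _); [exact/esym/vE|exact: IHs].
pose a := X 0 0; pose c := col 0 X.
have a_ge0 : 0 <= a.
  have := psdX.2 (delta_mx 0 0); rewrite /quad trmx_delta -rowE -colE.
  by rewrite !mxE.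
have [a0|an0] := eqVneq a 0; first exact: zero.
have a_gt0 : 0 < a by rewrite lt_neqAle eq_sym an0.
have bE u v (s t : R) : quad X (u + s *: v) = quad X u +
    s * (u^T *m X *m v) 0 0 + s * (v^T *m X *m u) 0 0 + s ^+ 2 * quad X v.
  have zE (k : R) (M : 'M[R]_1) : (k *: M) 0 0 = k * M 0 0 by rewrite mxE.
  rewrite /quad trmxD linearZ/= !mulmxDl !mulmxDr -!scalemxAl -!scalemxAr.
  by rewrite !mxDE !zE; ring.
pose e : 'cV[R]_n.+1 := delta_mx 0 0.
have cE : c = X *m e by rewrite -colE.
have cTE : c^T = e^T *m X by rewrite cE trmx_mul psdX.1.
have eXe : quad X e = a by rewrite /quad trmx_delta -rowE -colE !mxE.
pose Y := X - a^-1 *: (c *m c^T).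
have m11 (M N : 'M[R]_1) : (M *m N) 0 0 = M 0 0 * N 0 0 by rewrite mxE big_ord1.
have psdY : psdmx Y.
  split=> [|u].
    by rewrite /Y linearB/= linearZ/= trmx_mul trmxK psdX.1.
  pose s := (c^T *m u) 0 0.
  have sE : (u^T *m c) 0 0 = s by rewrite /s -[u^T *m c]trmxK trmx_mul trmxK mxE.
  (* The form of the Schur complement at [u] is the minimum of the form of [X] along the line
     [u + t *: e], attained at this [t]. *)
  have -> : quad Y u = quad X (u + (- (a^-1 * s)) *: e).
    rewrite bE// eXe -mulmxA -cE -cTE sE -/s.
    rewrite /Y quadD quadN /quad -scalemxAr -scalemxAl.
    rewrite [((a^-1 *: _) : 'M[R]_1) 0 0]mxE mulmxA -[u^T *m c *m c^T *m u]mulmxA m11 sE -/s.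
    by field.
  exact: psdX.2.
have [|s sY] := zero Y psdY.
  by rewrite /Y !mxE big_ord1 !mxE -/a mulKf// subrr.
exists ((Num.sqrt a)^-1 *: c :: s); rewrite big_cons -sY.
rewrite linearZ/= -scalemxAl -scalemxAr scalerA -invfM -expr2 sqr_sqrtr//.
by rewrite /Y addrC subrK.
Qed.

Lemma tr_rank_one n (W : 'M[R]_n) (v : 'cV[R]_n) : \tr (W *m (v *m v^T)) = quad W v.
Proof. by rewrite mulmxA mxtrace_mulC mulmxA /mxtrace big_ord1. Qed.

Lemma tr_psd_ge0 n (W X : 'M[R]_n) : psdmx W -> psdmx X -> 0 <= \tr (W *m X).
Proof.
move=> psdW /psd_rank_one_sum[s ->]; rewrite mulmx_sumr raddf_sum/=.
by apply: sumr_ge0 => v _; rewrite tr_rank_one; exact: psdW.2.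
Qed.

Lemma psdmx_block_diag_ul m n (V : 'M[R]_m) (W : 'M[R]_n) :
  psdmx (block_mx V 0 0 W) -> psdmx V.
Proof.
move=> psdVW; have := psdmx_conj (row_mx 1%:M 0 : 'M[R]_(m, m + n)) psdVW.
rewrite mul_row_block tr_row_mx mul_row_col.
by rewrite !(trmx0, trmx1, mulmx0, mul0mx, mul1mx, mulmx1, addr0).
Qed.

End Psd.

(** Decides additive identities of matrices; products are atoms and have to be expanded
    beforehand. *)
Ltac mxring := apply/matrixP => ? ?; rewrite ?(mxDE, mxNE); ring.

(** * Entrywise limits of matrices *)

Section MatrixLimits.
Context {R : realType} {T : Type} {F : set_system T} {FF : Filter F}.

(** The filter is general because [stage_cost_cvg] lets two indices tend to infinity
    independently. *)
Definition mcvg m n (M : T -> 'M[R]_(m, n)) (M0 : 'M[R]_(m, n)) :=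
  forall i j, (fun t => M t i j) @ F --> M0 i j.

Lemma mcvg_cst m n (M : 'M[R]_(m, n)) : mcvg (fun=> M) M.
Proof. by move=> i j; exact: cvg_cst. Qed.

Lemma mcvgD m n (M N : T -> 'M[R]_(m, n)) M0 N0 :
  mcvg M M0 -> mcvg N N0 -> mcvg (fun t => M t + N t) (M0 + N0).
Proof.
move=> cM cN i j; rewrite mxE; under eq_fun do rewrite mxE.
exact: cvgD (cM i j) (cN i j).
Qed.

Lemma mcvgN m n (M : T -> 'M[R]_(m, n)) M0 :
  mcvg M M0 -> mcvg (fun t => - M t) (- M0).
Proof.
move=> cM i j; rewrite mxE; under eq_fun do rewrite mxE.
exact: cvgN (cM i j).
Qed.

Lemma cvg_bigsum (I : Type) (r : seq I) (P : pred I) (f : I -> T -> R) (l : I -> R) :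
  (forall i, f i @ F --> l i) ->
  (fun t => \sum_(i <- r | P i) f i t) @ F --> \sum_(i <- r | P i) l i.
Proof.
move=> fl; elim: r => [|i r IH].
  by rewrite big_nil; under eq_fun do rewrite big_nil; exact: cvg_cst.
rewrite big_cons; under eq_fun do rewrite big_cons.
by case: ifP => // _; exact: cvgD (fl i) IH.
Qed.

Lemma cvg_bigprod (I : Type) (r : seq I) (P : pred I) (f : I -> T -> R) (l : I -> R) :
  (forall i, f i @ F --> l i) ->
  (fun t => \prod_(i <- r | P i) f i t) @ F --> \prod_(i <- r | P i) l i.
Proof.
move=> fl; elim: r => [|i r IH].
  by rewrite big_nil; under eq_fun do rewrite big_nil; exact: cvg_cst.
rewrite big_cons; under eq_fun do rewrite big_cons.
by case: ifP => // _; exact: cvgM (fl i) IH.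
Qed.

Lemma mcvg_mul m n p (M : T -> 'M[R]_(m, n)) (N : T -> 'M[R]_(n, p)) M0 N0 :
  mcvg M M0 -> mcvg N N0 -> mcvg (fun t => M t *m N t) (M0 *m N0).
Proof.
move=> cM cN i j; rewrite mxE; under eq_fun do rewrite mxE.
apply: (@cvg_bigsum _ _ _ (fun k t => M t i k * N t k j)) => k.
exact: cvgM (cM i k) (cN k j).
Qed.

Lemma mcvg_tr m n (M : T -> 'M[R]_(m, n)) M0 :
  mcvg M M0 -> mcvg (fun t => (M t)^T) M0^T.
Proof. by move=> cM i j; rewrite mxE; under eq_fun do rewrite mxE; exact: cM. Qed.

Lemma cvg_mxtrace n (M : T -> 'M[R]_n) M0 :
  mcvg M M0 -> (fun t => \tr (M t)) @ F --> \tr M0.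
Proof. by move=> cM; apply: (@cvg_bigsum _ _ _ (fun i t => M t i i)) => i; exact: cM. Qed.

Lemma cvg_quad n (M : T -> 'M[R]_n) M0 v :
  mcvg M M0 -> (fun t => quad (M t) v) @ F --> quad M0 v.
Proof.
move=> cM; have : mcvg (fun t => v^T *m M t *m v) (v^T *m M0 *m v).
  apply: mcvg_mul; last exact: mcvg_cst.
  by apply: mcvg_mul => //; exact: mcvg_cst.
by move=> /(_ 0 0).
Qed.

Lemma cvg_det n (M : T -> 'M[R]_n) M0 :
  mcvg M M0 -> (fun t => \det (M t)) @ F --> \det M0.
Proof.
move=> cM; rewrite /determinant.
apply: cvg_bigsum => s.
apply: cvgM; first exact: cvg_cst.
by apply: cvg_bigprod => i; exact: cM.
Qed.

(** The inverse is the adjugate divided by the determinant, a rational function of the entries. *)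
Lemma mcvg_inv n (M : T -> 'M[R]_n) M0 :
  (forall t, M t \in unitmx) -> M0 \in unitmx ->
  mcvg M M0 -> mcvg (fun t => invmx (M t)) (invmx M0).
Proof.
move=> uM uM0 cM i j; rewrite /invmx uM0 mxE.
under eq_fun do rewrite uM mxE.
apply: cvgM.
  by apply: cvgV; [rewrite -unitfE -unitmxE|exact: cvg_det].
rewrite mxE; under eq_fun do rewrite mxE.
apply: cvgM; first exact: cvg_cst.
apply: cvg_det => k l; rewrite !mxE; under eq_fun do rewrite !mxE.
exact: cM.
Qed.

End MatrixLimits.

(** * Riccati recursions *)

Section Riccati.
Context {R : realType} {n m : nat}.
Variables (A : 'M[R]_n) (B : 'M[R]_(n, m)) (S : 'M[R]_n) (W : 'M[R]_m).
Hypotheses (psdS : psdmx S) (posW : posdefmx W).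

(** Written like the right-hand side of [dare], so that [dare A B S W X] is [X = ric X] by
    conversion. *)
Definition ric (X : 'M[R]_n) : 'M[R]_n :=
  A^T *m X *m A
  - A^T *m X *m B *m invmx (W + B^T *m X *m B) *m B^T *m X *m A + S.

Definition ric_weight (X : 'M[R]_n) : 'M[R]_m := W + B^T *m X *m B.

Lemma ric_weight_posdef X : psdmx X -> posdefmx (ric_weight X).
Proof. by move=> psdX; apply: posdef_addpsd => //; exact: psdmx_conjt. Qed.

Lemma ric_weight_unit X : psdmx X -> ric_weight X \in unitmx.
Proof. by move=> psdX; apply: posdef_unit; exact: ric_weight_posdef. Qed.

Lemma ric_gainE X : psdmx X ->
  ric_weight X *m F_lqg A B W X = - (B^T *m X *m A).
Proof.
move=> psdX; rewrite /F_lqg mulmxN !mulmxA mulmxV ?mul1mx//.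
exact: ric_weight_unit.
Qed.

Lemma ric_gainET X : psdmx X ->
  (F_lqg A B W X)^T *m ric_weight X = - (A^T *m X *m B).
Proof.
move=> psdX; have := congr1 trmx (ric_gainE psdX).
rewrite trmx_mul (ric_weight_posdef psdX).1 => ->.
by rewrite trmxN !trmx_mul trmxK psdX.1 mulmxA.
Qed.

Lemma ricE X : psdmx X ->
  ric X = A^T *m X *m A + S - (F_lqg A B W X)^T *m ric_weight X *m F_lqg A B W X.
Proof.
move=> psdX; rewrite ric_gainET// /ric /F_lqg mulmxN mulNmx opprK !mulmxA.
mxring.
Qed.

(** One step of dynamic programming: any gain [F] exceeds the optimal value [ric X] by a square in
    its distance to the optimal gain. Positivity and monotonicity of [ric] follow from it. *)
Lemma ric_complete_square X (F : 'M[R]_(m, n)) : psdmx X ->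
  (A + B *m F)^T *m X *m (A + B *m F) + F^T *m W *m F + S =
  ric X + (F - F_lqg A B W X)^T *m ric_weight X *m (F - F_lqg A B W X).
Proof.
move=> psdX; rewrite ricE//.
have wE : ric_weight X = W + B^T *m X *m B by [].
move: (ric_weight X) (F_lqg A B W X) (ric_gainE psdX) (ric_gainET psdX) wE.
move=> w F0 wF0 F0w wE.
rewrite !(trmxD, trmxN, mulmxDl, mulmxDr, mulNmx, mulmxN).
rewrite F0w -[F^T *m _ *m F0]mulmxA wF0 wE.
rewrite !(trmx_mul, mulmxDl, mulmxDr, mulNmx, mulmxN, mulmxA).
mxring.
Qed.

Lemma ric_psd X : psdmx X -> psdmx (ric X).
Proof.
move=> psdX; have := ric_complete_square (F_lqg A B W X) psdX.
rewrite subrr mulmx0 addr0 => <-; apply: psdmxD => //.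
by apply: psdmxD; apply: psdmx_conjt => //; exact: posdef_psd.
Qed.

(** Both values are computed under the gain that is optimal for [Y]; for [X] it is suboptimal, and
    the resulting square has the right sign. *)
Lemma ric_mono X Y : psdmx X -> psdmx Y -> psdmx (Y - X) -> psdmx (ric Y - ric X).
Proof.
move=> psdX psdY psdYX; pose F := F_lqg A B W Y.
have := ric_complete_square F psdY; rewrite subrr mulmx0 addr0 => <-.
have -> : ric X = (A + B *m F)^T *m X *m (A + B *m F) + F^T *m W *m F + S
    - (F - F_lqg A B W X)^T *m ric_weight X *m (F - F_lqg A B W X).
  by rewrite ric_complete_square// addrK.
set G := A + B *m F; set Z := _ *m _ *m (F - _).
have -> : G^T *m Y *m G + F^T *m W *m F + S -
    (G^T *m X *m G + F^T *m W *m F + S - Z) = G^T *m (Y - X) *m G + Z.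
  move: (F^T *m W *m F) => FWF; clearbody G Z; rewrite mulmxDr mulmxDl mulmxN mulNmx; mxring.
apply: psdmxD; apply: psdmx_conjt => //.
exact/posdef_psd/ric_weight_posdef.
Qed.

(** Value matrices of the [k]-step problem with zero terminal cost. *)
Definition ric_iter (k : nat) : 'M[R]_n := iter k ric 0.

Lemma ric_iter_psd k : psdmx (ric_iter k).
Proof. by elim: k => [|k IH]; [exact: psdmx0|exact: ric_psd]. Qed.

Lemma ric_iter_incr k : psdmx (ric_iter k.+1 - ric_iter k).
Proof.
elim: k => [|k IH]; first by rewrite subr0; exact: ric_iter_psd.
exact: (ric_mono (ric_iter_psd k) (ric_iter_psd k.+1) IH).
Qed.

Lemma ric_iter_le X : psdmx X -> X = ric X -> forall k, psdmx (X - ric_iter k).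
Proof.
move=> psdX XE; elim=> [|k IH]; first by rewrite subr0.
by rewrite [X in X - _]XE; exact: (ric_mono (ric_iter_psd k) psdX IH).
Qed.

(** Polarization: it transfers convergence from the quadratic forms, which are monotone along the
    iterates, to the entries. *)
Lemma psd_polar (M : 'M[R]_n) i j : M^T = M ->
  M i j = (quad M (delta_mx i 0 + delta_mx j 0) - quad M (delta_mx i 0)
           - quad M (delta_mx j 0)) / 2.
Proof.
move=> tM; have e (k l : 'I_n) :
    ((delta_mx k 0 : 'cV[R]_n)^T *m M *m (delta_mx l 0 : 'cV[R]_n)) 0 0 = M k l.
  by rewrite trmx_delta -rowE -colE !mxE.
rewrite /quad trmxD !mulmxDl !mulmxDr !mxDE !e.
have -> : M j i = M i j by rewrite -[in LHS]tM mxE.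
by field.
Qed.

(* The iterates increase and are bounded by any fixed point, so they converge to
   a semidefinite fixed point. *)
Lemma ric_iter_cvg X : psdmx X -> X = ric X ->
  (forall X', psdmx X' -> X' = ric X' -> X' = X) ->
  mcvg (F := \oo) ric_iter X.
Proof.
move=> psdX XE Xuniq.
have cq v : cvgn (fun k => quad (ric_iter k) v).
  apply: nondecreasing_is_cvgn.
    apply/nondecreasing_seqP => k.
    have := (ric_iter_incr k).2 v; rewrite quadD quadN; lra.
  exists (quad X v) => _ [k _ <-].
  have := (ric_iter_le psdX XE k).2 v; rewrite quadD quadN; lra.
pose q v := limn (fun k => quad (ric_iter k) v).
have cqE v : (fun k => quad (ric_iter k) v) @ \oo --> q v by exact: cq.
pose Y : 'M[R]_n := \matrix_(i, j) ((q (delta_mx i 0 + delta_mx j 0) -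
  q (delta_mx i 0) - q (delta_mx j 0)) / 2).
have cY : mcvg (F := \oo) ric_iter Y.
  move=> i j; rewrite mxE.
  under eq_fun do rewrite (psd_polar _ _ (ric_iter_psd _).1).
  by apply: cvgM; [|exact: cvg_cst]; apply: cvgB; [apply: cvgB|].
have psdY : psdmx Y.
  split=> [|v].
    apply/matrixP => i j; rewrite mxE.
    apply: cvg_unique (cY j i) _ => //.
    have -> : (fun k => ric_iter k j i) = (fun k => ric_iter k i j).
      by apply/funext => k; rewrite -[in LHS](ric_iter_psd k).1 mxE.
    exact: cY.
  have cqY : (fun k => quad (ric_iter k) v) @ \oo --> quad Y v by exact: cvg_quad.
  rewrite -(cvg_lim _ cqY)//.
  apply: limr_ge; first exact: cvgP cqY.
  by apply: nearW => k; exact: (ric_iter_psd k).2.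
(* Uniqueness identifies the limit as soon as it is a fixed point. *)
suff -> : X = Y by [].
apply/esym/Xuniq => //; apply/matrixP => i j.
have cY1 : (fun k => ric_iter k.+1 i j) @ \oo --> Y i j.
  by have := cY i j; rewrite -cvg_shiftS.
apply: (cvg_unique _ cY1) => //=.
rewrite /ric; apply: mcvgD; last exact: mcvg_cst.
apply: mcvgD.
  by repeat (apply: mcvg_mul => //); exact: mcvg_cst.
apply: mcvgN.
have cw : mcvg (F := \oo) (fun k => ric_weight (ric_iter k)) (ric_weight Y).
  apply: mcvgD; first exact: mcvg_cst.
  by repeat (apply: mcvg_mul => //); exact: mcvg_cst.
have ci : mcvg (F := \oo) (fun k => invmx (ric_weight (ric_iter k))) (invmx (ric_weight Y)).
  apply: mcvg_inv => //; last exact: ric_weight_unit.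
  by move=> k; apply: ric_weight_unit; exact: ric_iter_psd.
by repeat (apply: mcvg_mul => //); exact: mcvg_cst.
Qed.

End Riccati.

(** * Second moments of linear systems *)

Section Lyapunov.
Context {R : realType} {n : nat}.
Variables (Phi N W : 'M[R]_n) (c : R) (S : nat -> 'M[R]_n).
Hypothesis S_rec : forall t, S t.+1 = Phi *m S t *m Phi^T + N.

Lemma lyapunov_psd : psdmx N -> psdmx (S 0%N) -> forall t, psdmx (S t).
Proof.
move=> psdN psdS0; elim=> // t IH; rewrite S_rec.
by apply: psdmxD => //; exact: psdmx_conj.
Qed.

(** The increments of [S] lose the constant [N] and evolve by a fixed linear map on matrices. The
    extra factor ['X - 1] passes to increments and removes [c] as well. *)
Lemma lyapunov_linrec : linrec (fun t => \tr (W *m S t) + c).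
Proof.
(* The map [Z |-> Phi *m Z *m Phi^T] on vectorized matrices, acting on row vectors. *)
pose M := lin_mulmx Phi *m lin_mulmxr Phi^T.
pose D t := S t.+1 - S t.
have DE t : mxvec (D t) = mxvec (D 0%N) *m M ^+ t.
  elim: t => [|t IH]; first by rewrite expr0 mulmx1.
  rewrite exprSr mulmxA -IH /M mulmxA !mul_vec_lin/=; congr mxvec.
  by rewrite /D !S_rec opprD addrACA subrr addr0 mulmxBr mulmxBl.
pose a : 'cV[R]_(n * n) := \col_k \tr (W *m vec_mx (delta_mx 0 k)).
have trE (Z : 'M[R]_n) : \tr (W *m Z) = (mxvec Z *m a) 0 0.
  rewrite mxE -[Z in LHS]mxvecK [mxvec Z in LHS]row_sum_delta.
  rewrite !linear_sum/=; apply: eq_bigr => k _.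
  by rewrite linearZ/= -scalemxAr linearZ/= !mxE.
pose toC := real_complex R.
exists (char_poly (map_mx toC M) * ('X - 1%:P)).
  by rewrite mulf_neq0// ?monic_neq0 ?char_poly_monic ?monicXsubC.
move=> t; rewrite actM.
have -> : act ('X - 1%:P) (fun t => toC (\tr (W *m S t) + c)) = fun s =>
    (map_mx toC (mxvec (D 0%N)) *m map_mx toC M ^+ s *m map_mx toC a) 0 0.
  apply/funext => s; rewrite act_XsubC mul1r -rmorphB/=.
  have -> : map_mx toC M ^+ s = map_mx toC (M ^+ s).
    elim: s => [|s IH]; first by rewrite !expr0 map_mx1.
    by rewrite !exprS IH; exact/esym/map_mxM.
  rewrite -!map_mxM mxE; congr toC.
  rewrite -DE -trE /D mulmxBr linearB/=; ring.
exact: annihilates_charpoly.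
Qed.

End Lyapunov.

Section StablePowers.
Context {R : realType}.

Lemma mcvg_pow n (M : 'M[R]_n) : schur_stable M ->
  mcvg (F := \oo) (fun t => M ^+ t) 0.
Proof.
move=> sM i j; rewrite mxE.
have := null_pow_schur (delta_mx 0 i) (delta_mx j 0) sM.
have -> // : (fun t => ((delta_mx 0 i : 'rV[R]_n) *m M ^+ t *m
  (delta_mx j 0 : 'cV[R]_n)) 0 0) = (fun t => (M ^+ t) i j).
by apply/funext => t; rewrite -rowE -colE !mxE.
Qed.

Lemma trmx_exp n (M : 'M[R]_n) t : (M ^+ t)^T = M^T ^+ t.
Proof.
elim: t => [|t IH]; first by rewrite !expr0 trmx1.
by rewrite exprS exprSr -IH [M * _]/(_ *m _) trmx_mul.
Qed.

(** The filter Riccati equation is that of the dual system, so it provides stability of the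
    transposed error matrix. *)
Lemma mcvg_powT n (M : 'M[R]_n) : schur_stable M^T ->
  mcvg (F := \oo) (fun t => M ^+ t) 0.
Proof.
move=> /mcvg_pow /mcvg_tr; rewrite trmx0.
have -> // : (fun t => (M^T ^+ t)^T) = (fun t => M ^+ t).
by apply/funext => t; rewrite trmx_exp trmxK.
Qed.

End StablePowers.

(** * Bounds on the cost of a control loop *)

Section CostBounds.
Context {R : realType} {nx nu ny nk : nat}.
Variables (A : 'M[R]_nx) (B : 'M[R]_(nx, nu)) (C : 'M[R]_(ny, nx)).
Variables (Vw : 'M[R]_nx) (Vv Q : 'M[R]_ny) (Wu : 'M[R]_nu).
Hypotheses (psdVw : psdmx Vw) (posVv : posdefmx Vv) (posQ : posdefmx Q)
  (posWu : posdefmx Wu).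
Variables (X Y : 'M[R]_nx).
Hypotheses (stdX : standard_dare_solution A B (C^T *m Q *m C) Wu X)
  (stdY : standard_dare_solution A^T C^T Vw Vv Y).

Let psdQC : psdmx (C^T *m Q *m C).
Proof. exact/psdmx_conjt/posdef_psd. Qed.

Local Notation ricc := (ric A B (C^T *m Q *m C) Wu).
Local Notation rice := (ric A^T C^T Vw Vv).
Local Notation wc := (ric_weight B Wu).
Local Notation we := (ric_weight C^T Vv).
Local Notation gc := (F_lqg A B Wu).
Local Notation ge := (F_lqg A^T C^T Vv).

(** Expected cost of one step for value matrix [P] and error covariance [Sig]: measurement noise,
    process noise valued by [P], and the loss from feeding back an estimate instead of the state. *)
Definition stage_cost (P Sig : 'M[R]_nx) : R :=
  \tr (Q *m Vv) + \tr (P *m Vw) + \tr ((gc P)^T *m wc P *m gc P *m Sig).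

Definition lqg_cost : R := stage_cost X Y.

Lemma stage_cost_ge0 P Sig : psdmx P -> psdmx Sig -> 0 <= stage_cost P Sig.
Proof.
move=> psdP psdSig; rewrite !addr_ge0//.
- by apply: tr_psd_ge0; exact: posdef_psd.
- exact: tr_psd_ge0.
- apply: tr_psd_ge0 => //; apply/psdmx_conjt/posdef_psd.
  exact: ric_weight_posdef.
Qed.

Let Pk := ric_iter A B (C^T *m Q *m C) Wu.
Let Sk := ric_iter A^T C^T Vw Vv.

Let psdPk k : psdmx (Pk k). Proof. exact: ric_iter_psd. Qed.
Let psdSk k : psdmx (Sk k). Proof. exact: ric_iter_psd. Qed.

Let psdX : psdmx X. Proof. by case: stdX. Qed.
Let psdY : psdmx Y. Proof. by case: stdY. Qed.
Let fixX : X = ricc X. Proof. by case: stdX. Qed.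
Let fixY : Y = rice Y. Proof. by case: stdY. Qed.

(** The indices are independent because along a horizon the control iterates run backwards and the
    filter iterates forwards. *)
Lemma stage_cost_cvg (e : R) : 0 < e -> exists N, forall k l,
  (N <= k)%N -> (N <= l)%N -> lqg_cost - e <= stage_cost (Pk k) (Sk l).
Proof.
move=> e0.
have cP : mcvg (F := \oo) Pk X.
  by apply: ric_iter_cvg => // P pP; case: stdX => _ _ u _; exact: u.
have cS : mcvg (F := \oo) Sk Y.
  by apply: ric_iter_cvg => // P pP; case: stdY => _ _ u _; exact: u.
have cP1 : mcvg (F := \oo) (fun k => Pk k.+1) X.
  by move=> i j; have := cP i j; rewrite -cvg_shiftS.
have c1 m n (M : nat -> 'M[R]_(m, n)) M0 : mcvg (F := \oo) M M0 ->
    mcvg (F := filter_prod \oo \oo) (fun kl => M kl.1) M0.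
  by move=> cM i j; apply: cvg_comp (cM i j); exact: cvg_fst.
have c2 m n (M : nat -> 'M[R]_(m, n)) M0 : mcvg (F := \oo) M M0 ->
    mcvg (F := filter_prod \oo \oo) (fun kl => M kl.2) M0.
  by move=> cM i j; apply: cvg_comp (cM i j); exact: cvg_snd.
(* The Riccati recursion expresses the weighted gain by two consecutive iterates, which gives its
   limit without inverses. *)
pose gap (P P1 : 'M[R]_nx) := A^T *m P *m A + C^T *m Q *m C - P1.
have gapE P : psdmx P -> (gc P)^T *m wc P *m gc P = gap P (ricc P).
  by move=> psdP; rewrite /gap ricE// opprB addrC subrK.
have cf : (fun kl => stage_cost (Pk kl.1) (Sk kl.2)) @ filter_prod \oo \oo --> lqg_cost.
  rewrite /lqg_cost /stage_cost gapE// -fixX.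
  under eq_fun do rewrite gapE//.
  apply: cvgD.
    apply: cvgD; first exact: cvg_cst.
    by apply: cvg_mxtrace; apply: mcvg_mul; [exact: c1|exact: mcvg_cst].
  apply: cvg_mxtrace; apply: mcvg_mul; last exact: c2.
  apply: mcvgD; last by apply: mcvgN; exact: (c1 _ _ (fun k => Pk k.+1)).
  apply: mcvgD; last exact: mcvg_cst.
  by apply: mcvg_mul; [apply: mcvg_mul; [exact: mcvg_cst|exact: c1]|exact: mcvg_cst].
move/cvgrPdist_le : cf => /(_ e e0) [[U V] /= [[N1 _ NU] [N2 _ NV]] UV].
exists (maxn N1 N2) => k l; rewrite !geq_max => /andP[Nk _] /andP[_ Nl].
have /= := UV (k, l) (conj (NU k Nk) (NV l Nl)).
by rewrite ler_norml lerBlDr -lerBlDl => /andP[_]; lra.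
Qed.

Variables (G : 'M[R]_nk) (H : 'M[R]_(nk, ny)) (F : 'M[R]_(nu, nk)).

Definition loop_mx : 'M[R]_(nx + nk) := block_mx A (B *m F) (H *m C) G.
Definition loop_noise : 'M[R]_(nx + nk) := block_mx Vw 0 0 (H *m Vv *m H^T).
Definition loop_weight : 'M[R]_(nx + nk) :=
  block_mx (C^T *m Q *m C) 0 0 (F^T *m Wu *m F).
Local Notation plant P := (block_mx P 0 0 0 : 'M[R]_(nx + nk)).

(** Kalman update inside an arbitrary loop: the innovation, of covariance [we Sig], enters the plant
    part through the Kalman gain [- (ge Sig)^T] and the controller part through [H]. *)
Lemma loop_filter_identity Sig : psdmx Sig ->
  loop_mx *m plant Sig *m loop_mx^T + loop_noise = plant (rice Sig) +
    col_mx (- (ge Sig)^T) H *m we Sig *m (col_mx (- (ge Sig)^T) H)^T.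
Proof.
move=> psdSig.
have Z1 : (ge Sig)^T *m we Sig = - (A *m Sig *m C^T).
  by rewrite ric_gainET// trmxK.
have Z2 : we Sig *m ge Sig = - (C *m Sig *m A^T).
  by rewrite ric_gainE// trmxK.
have ZE : we Sig = Vv + C *m Sig *m C^T by rewrite /ric_weight trmxK.
have -> : rice Sig = A *m Sig *m A^T + Vw - (ge Sig)^T *m we Sig *m ge Sig.
  by rewrite ricE// trmxK.
move: (ge Sig) (we Sig) Z1 Z2 ZE => Fs Z Z1 Z2 ZE.
rewrite /loop_mx /loop_noise tr_block_mx !mulmx_block tr_col_mx mul_col_mx.
rewrite mul_col_row !add_block_mx !(mulmx0, mul0mx, addr0, add0r).
rewrite !trmxN !trmxK !mulNmx !mulmxN !opprK trmx_mul.
congr block_mx.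
- by rewrite subrK.
- by rewrite Z1 mulNmx opprK !mulmxA.
- by rewrite -[H *m Z *m Fs]mulmxA Z2 mulmxN opprK !mulmxA.
- by rewrite ZE mulmxDr mulmxDl !mulmxA addrC.
Qed.

(** The square penalizes the difference between the input [F xi] and the optimal state feedback
    [gc P x]. *)
Lemma loop_control_identity P : psdmx P ->
  loop_weight + loop_mx^T *m plant P *m loop_mx = plant (ricc P) +
    (row_mx (- gc P) F)^T *m wc P *m row_mx (- gc P) F.
Proof.
move=> psdP.
have Z1 : (gc P)^T *m wc P = - (A^T *m P *m B) by rewrite ric_gainET.
have Z2 : wc P *m gc P = - (B^T *m P *m A) by rewrite ric_gainE.
have ZE : wc P = Wu + B^T *m P *m B by [].
have -> : ricc P = A^T *m P *m A + C^T *m Q *m C - (gc P)^T *m wc P *m gc P.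
  by rewrite ricE.
move: (gc P) (wc P) Z1 Z2 ZE => F0 Z Z1 Z2 ZE.
rewrite /loop_mx /loop_weight tr_block_mx !mulmx_block tr_row_mx mul_col_mx.
rewrite mul_col_row !add_block_mx !(mulmx0, mul0mx, addr0, add0r).
rewrite !trmxN !mulNmx !mulmxN !opprK trmx_mul.
congr block_mx.
- by rewrite subrK addrC.
- by rewrite Z1 mulNmx opprK !mulmxA.
- by rewrite -[F^T *m Z *m F0]mulmxA Z2 mulmxN opprK !mulmxA.
- by rewrite ZE mulmxDr mulmxDl !mulmxA.
Qed.

Section Loop.
Variable S : nat -> 'M[R]_(nx + nk).
Hypothesis S_rec : forall t, S t.+1 = loop_mx *m S t *m loop_mx^T + loop_noise.
Hypothesis psdS0 : psdmx (S 0%N).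

Definition loop_cost t : R := \tr (loop_weight *m S t) + \tr (Q *m Vv).

Lemma psd_plant P : psdmx P -> psdmx (plant P).
Proof.
move=> psdP; have -> : plant P = col_mx 1%:M 0 *m P *m (col_mx 1%:M 0)^T.
  rewrite tr_col_mx mul_col_mx mul_col_row.
  by rewrite !(trmx0, trmx1, mulmx0, mul0mx, mul1mx, mulmx1).
exact: psdmx_conj.
Qed.

Lemma psd_loop_noise : psdmx loop_noise.
Proof.
have -> : loop_noise = plant Vw + col_mx 0 H *m Vv *m (col_mx 0 H)^T.
  rewrite tr_col_mx mul_col_mx mul_col_row !(trmx0, mul0mx, mulmx0).
  by rewrite add_block_mx !addr0 add0r.
by apply: psdmxD; [exact: psd_plant|exact/psdmx_conj/posdef_psd].
Qed.

(* The estimation error of the plant state cannot beat the Kalman filter that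
   knows the state perfectly at time [0]. *)
Lemma loop_second_moment_ge t : psdmx (S t - plant (Sk t)).
Proof.
elim: t => [|t IH].
  by have -> : plant (Sk 0%N) = 0; rewrite ?subr0//; exact: block_mx0.
have := loop_filter_identity (psdSk t) => E.
have -> : S t.+1 - plant (Sk t.+1) = loop_mx *m (S t - plant (Sk t)) *m loop_mx^T +
    col_mx (- (ge (Sk t))^T) H *m we (Sk t) *m (col_mx (- (ge (Sk t))^T) H)^T.
  rewrite S_rec mulmxDr mulmxN mulmxDl mulNmx.
  rewrite -[X in _ = _ + X](addKr (plant (rice (Sk t)))) -E.
  rewrite -[Sk t.+1]/(rice (Sk t)).
  mxring.
apply: psdmxD; first exact: psdmx_conj.
exact/psdmx_conj/posdef_psd/ric_weight_posdef.
Qed.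

Lemma loop_cost_step P t : psdmx P ->
  loop_cost t + \tr (plant P *m S t.+1) = \tr (plant (ricc P) *m S t) +
    \tr (Q *m Vv) + \tr (P *m Vw) +
    \tr ((row_mx (- gc P) F)^T *m wc P *m row_mx (- gc P) F *m S t).
Proof.
move=> psdP; have := loop_control_identity psdP => E.
rewrite /loop_cost S_rec mulmxDr mxtraceD.
have -> : \tr (plant P *m loop_noise) = \tr (P *m Vw).
  by rewrite /loop_noise mulmx_block !mulmx0 !mul0mx !addr0 mxtrace_block mxtrace0 addr0.
have -> : \tr (plant P *m (loop_mx *m S t *m loop_mx^T)) =
    \tr (loop_mx^T *m plant P *m loop_mx *m S t).
  by rewrite !mulmxA mxtrace_mulC !mulmxA.
have : \tr ((loop_weight + loop_mx^T *m plant P *m loop_mx) *m S t) =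
    \tr ((plant (ricc P) + (row_mx (- gc P) F)^T *m wc P *m row_mx (- gc P) F) *m S t).
  by rewrite E.
rewrite !mulmxDl !mxtraceD; lra.
Qed.

(** The penalty in [loop_cost_step] is monotone in the second moment. At [plant (Sk t)] the
    controller block is zero, so what remains is exactly the estimation loss of [stage_cost]. *)
Lemma loop_cost_step_ge P t : psdmx P ->
  \tr (plant (ricc P) *m S t) + stage_cost P (Sk t) <=
  loop_cost t + \tr (plant P *m S t.+1).
Proof.
move=> psdP; rewrite loop_cost_step// /stage_cost.
set E := row_mx _ _; set Z := E^T *m _ *m E.
have psdZ : psdmx Z by apply/psdmx_conjt/posdef_psd; exact: ric_weight_posdef.
have := tr_psd_ge0 psdZ (loop_second_moment_ge t).
have -> : \tr (Z *m (S t - plant (Sk t))) = \tr (Z *m S t) - \tr (Z *m plant (Sk t)).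
  by rewrite mulmxDr mulmxN mxtraceD linearN.
have -> : \tr (Z *m plant (Sk t)) = \tr ((gc P)^T *m wc P *m gc P *m Sk t).
  rewrite /Z /E tr_row_mx mul_col_mx mul_col_row mulmx_block !mulmx0 !addr0.
  by rewrite mxtrace_block mxtrace0 addr0 trmxN !(mulNmx, mulmxN, opprK).
lra.
Qed.

(** As [Pk 0 = 0], no boundary term at the horizon appears. The start [t0] is general because the
    induction peels off the first step. *)
Lemma loop_cost_sum_ge T : forall t0, \tr (plant (Pk T) *m S t0) +
    \sum_(t < T) stage_cost (Pk (T - t.+1)) (Sk (t0 + t)) <=
  \sum_(t < T) loop_cost (t0 + t).
Proof.
elim: T => [|T IH] t0.
  by rewrite !big_ord0 addr0 -[Pk 0]/0 block_mx0 mul0mx mxtrace0.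
rewrite !big_ord_recl/= subn1/= addn0.
have := loop_cost_step_ge t0 (psdPk T); have := IH t0.+1.
rewrite -[ricc (Pk T)]/(Pk T.+1).
have -> : \sum_(i < T) stage_cost (Pk (T.+1 - (bump 0 i).+1)) (Sk (t0 + bump 0 i)) =
    \sum_(i < T) stage_cost (Pk (T - i.+1)) (Sk (t0.+1 + i)).
  by apply: eq_bigr => i _; rewrite /bump leq0n add1n subSS addSn addnS.
have -> : \sum_(i < T) loop_cost (t0 + bump 0 i) =
    \sum_(i < T) loop_cost (t0.+1 + i).
  by apply: eq_bigr => i _; rewrite /bump leq0n add1n addSn addnS.
lra.
Qed.

Lemma loop_cost_lower (e : R) : 0 < e -> exists K, forall T : nat,
  T%:R * (lqg_cost - e) - K <= \sum_(t < T) loop_cost t.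
Proof.
move=> e0; have [N hN] := stage_cost_cvg e0.
have J0 : 0 <= lqg_cost by apply: stage_cost_ge0.
(* At most [N] stages at each end escape [stage_cost_cvg]; since stage costs are nonnegative,
   lowering the bound by [lqg_cost] there is enough. *)
exists (2 * N%:R * lqg_cost) => T.
have := loop_cost_sum_ge T 0; apply: le_trans.
rewrite -[leLHS]add0r lerD//.
  apply: tr_psd_ge0 => //; exact: psd_plant.
have low (t : 'I_T) : (lqg_cost - e) - lqg_cost * ((t < N)%N%:R + ((T - t.+1) < N)%N%:R)
    <= stage_cost (Pk (T - t.+1)) (Sk (0 + t)).
  have f0 := stage_cost_ge0 (psdPk (T - t.+1)) (psdSk (0 + t)).
  have [tN|Nt] := ltnP t N => /=.
    have : 0 <= ((T - t.+1 < N)%N%:R : R) by exact: ler0n.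
    move=> i0; have := mulr_ge0 J0 i0; rewrite mulrDr mulr1; lra.
  have [TN|NT] := ltnP (T - t.+1) N => /=; first by rewrite add0r mulr1; lra.
  by rewrite addr0 mulr0 subr0; apply: hN.
apply: le_trans (ler_sum _ (fun t _ => low t)).
rewrite sumrB sumr_const card_ord -mulr_sumr big_split/=.
have cnt : \sum_(t < T) ((t < N)%N%:R : R) <= N%:R.
  rewrite -natr_sum ler_nat.
  have -> : (\sum_(t < T) (t < N)%N)%N = minn T N.
    elim: T {low} => [|T IH]; first by rewrite big_ord0 min0n.
    rewrite big_ord_recr/= IH; case: (ltnP T N) => TN.
      by rewrite (minn_idPl TN) addn1.
    by rewrite (minn_idPr (leqW TN)) addn0.
  exact: geq_minr.
have cnt2 : \sum_(t < T) (((T - t.+1) < N)%N%:R : R) <= N%:R.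
  rewrite (reindex_inj rev_ord_inj)/=; apply: le_trans cnt; apply: ler_sum => t _.
  by have -> : (T - (T - t.+1).+1 = t)%N by have := ltn_ord t; lia.
rewrite -mulr_natl; have := lerD cnt cnt2 => /(ler_wpM2l J0); lra.
Qed.

End Loop.

End CostBounds.

(** * Upper and lower bounds on averages *)

Section Averages.
Context {R : realType}.
Implicit Types q r : nat -> R.

(** With partial sums and an additive constant no limit has to exist, and finitely many terms do not
    matter. *)
Definition avg_ge q (J : R) := forall e, 0 < e -> exists K, forall T : nat,
  T%:R * (J - e) - K <= \sum_(t < T) q t.

Definition avg_le q (J : R) := forall e, 0 < e -> exists K, forall T : nat,
  \sum_(t < T) q t <= T%:R * (J + e) + K.

Lemma cvg_mean_near (a : nat -> R) (J : R) :
  (forall e, 0 < e -> \forall n \near \oo, J - e <= a n <= J + e) -> a @ \oo --> J.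
Proof.
move=> aJ; apply/cvgrPdist_le => e /aJ; apply: filterS => n.
by rewrite distrC ler_distl.
Qed.

Lemma mean_ge_near q J e : avg_ge q J -> 0 < e ->
  \forall n \near \oo, J - e <= mean q n.
Proof.
move=> qJ e0; have e2 : 0 < e / 2 by rewrite divr_gt0.
have [K hK] := qJ _ e2.
exists (Num.truncn (`|K| / (e / 2))).+1 => // n /= nK.
have n0 : 0 < n%:R :> R by rewrite ltr0n (leq_trans _ nK).
rewrite /mean ler_pdivlMl//; apply: le_trans (hK n).
have : `|K| / (e / 2) < n%:R by rewrite (lt_le_trans (truncnS_gt _))// ler_nat.
rewrite ltr_pdivrMr// => h; have := ler_norm K; lra.
Qed.

Lemma mean_le_near q J e : avg_le q J -> 0 < e ->
  \forall n \near \oo, mean q n <= J + e.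
Proof.
move=> qJ e0; have e2 : 0 < e / 2 by rewrite divr_gt0.
have [K hK] := qJ _ e2.
exists (Num.truncn (`|K| / (e / 2))).+1 => // n /= nK.
have n0 : 0 < n%:R :> R by rewrite ltr0n (leq_trans _ nK).
rewrite /mean ler_pdivrMl//; apply: le_trans (hK n) _.
have : `|K| / (e / 2) < n%:R by rewrite (lt_le_trans (truncnS_gt _))// ler_nat.
rewrite ltr_pdivrMr// => h; have := ler_norm K; lra.
Qed.

Lemma cvg_mean_avg q J : avg_ge q J -> avg_le q J -> mean q @ \oo --> J.
Proof.
move=> qge qle; apply: cvg_mean_near => e e0.
by apply: filterS2 (mean_ge_near qge e0) (mean_le_near qle e0) => n -> ->.
Qed.

Lemma lim_mean_ge q J l : avg_ge q J -> mean q @ \oo --> l -> J <= l.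
Proof.
move=> qge ql; apply/ler_addgt0Pr => e e0; rewrite -lerBlDr.
rewrite -(cvg_lim _ ql)//; apply: limr_ge; first exact: cvgP ql.
exact: mean_ge_near.
Qed.

Lemma avg_le_null r : r @ \oo --> (0 : R) -> avg_le r 0.
Proof.
move=> r0 e e0; move/cvgr0Pnorm_le : r0 => /(_ e e0) [N _ rN].
exists (\sum_(t < N) `|r t|) => T; rewrite add0r.
have step : \sum_(t < T) r t <= \sum_(t < T) e + \sum_(t < minn T N) `|r t|.
  elim: T => [|T IH]; first by rewrite min0n !big_ord0 addr0.
  rewrite !big_ord_recr/=.
  have [TN|NT] := ltnP T N.
    rewrite (minn_idPl TN) big_ord_recr/=.
    move: IH; rewrite (minn_idPl (ltnW TN)); have := ler_norm (r T); lra.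
  rewrite (minn_idPr (leqW NT)); move: IH; rewrite (minn_idPr NT).
  by have := rN T NT; have := ler_norm (r T); rewrite /=; lra.
apply: le_trans step _; rewrite sumr_const card_ord mulr_natl lerD2l.
have -> : \sum_(t < N) `|r t| = \sum_(t < minn T N) `|r t| +
    \sum_(minn T N <= t < N) `|r t|.
  rewrite -(big_mkord xpredT (fun t => `|r t|)) -(big_mkord xpredT (fun t => `|r t|)).
  exact: big_cat_nat (leq0n _) (geq_minr _ _).
by rewrite lerDl sumr_ge0.
Qed.

Lemma avg_leD q r J J' : avg_le q J -> avg_le r J' ->
  avg_le (fun t => q t + r t) (J + J').
Proof.
move=> qJ rJ e e0; have e2 : 0 < e / 2 by rewrite divr_gt0.
have [K hK] := qJ _ e2; have [K' hK'] := rJ _ e2.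
exists (K + K') => T; rewrite big_split/=; have := hK T; have := hK' T; lra.
Qed.

Lemma avg_leZ (c : R) q J : 0 <= c -> avg_le q J -> avg_le (fun t => c * q t) (c * J).
Proof.
move=> c0 qJ e e0; have c1 : 0 < c + 1 by rewrite ltr_wpDl.
have e2 : 0 < e / (c + 1) by rewrite divr_gt0.
have [K hK] := qJ _ e2; exists (c * K) => T; rewrite -mulr_sumr.
apply: le_trans (ler_wpM2l c0 (hK T)) _.
rewrite mulrDr lerD2r mulrCA ler_wpM2l// mulrDr lerD2l.
by rewrite mulrA ler_pdivrMr//; lra.
Qed.

Lemma avg_leW q J J' : J <= J' -> avg_le q J -> avg_le q J'.
Proof.
move=> JJ qJ e e0; have [K hK] := qJ e e0; exists K => T.
by apply: le_trans (hK T) _; rewrite lerD2r ler_wpM2l// lerD2r.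
Qed.

Lemma avg_le_slack q J : (forall e, 0 < e -> avg_le q (J + e)) -> avg_le q J.
Proof.
move=> h e e0; have e2 : 0 < e / 2 by rewrite divr_gt0.
have [K hK] := h _ e2 _ e2; exists K => T; have := hK T.
by have -> : J + e / 2 + e / 2 = J + e by field.
Qed.

Lemma avg_le_le q r J : (forall t, q t <= r t) -> avg_le r J -> avg_le q J.
Proof.
move=> qr rJ e e0; have [K hK] := rJ e e0; exists K => T.
by apply: le_trans (hK T); apply: ler_sum.
Qed.

End Averages.

(** * Cost of the LQG loop *)

Section LqgLoop.
Context {R : realType} {nx nu ny : nat}.
Variables (A : 'M[R]_nx) (B : 'M[R]_(nx, nu)) (C : 'M[R]_(ny, nx)).
Variables (Vw : 'M[R]_nx) (Vv Q : 'M[R]_ny) (Wu : 'M[R]_nu).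
Hypotheses (psdVw : psdmx Vw) (posVv : posdefmx Vv) (posQ : posdefmx Q)
  (posWu : posdefmx Wu).
Variables (X Y : 'M[R]_nx).
Hypotheses (stdX : standard_dare_solution A B (C^T *m Q *m C) Wu X)
  (stdY : standard_dare_solution A^T C^T Vw Vv Y).

Local Notation F := (F_lqg A B Wu X).
Local Notation H := (H_lqg A C Vv Y).

Let psdX : psdmx X. Proof. by case: stdX. Qed.
Let psdY : psdmx Y. Proof. by case: stdY. Qed.

Lemma H_lqgE : H = - (F_lqg A^T C^T Vv Y)^T.
Proof.
rewrite /F_lqg trmxN opprK !trmx_mul !trmxK trmx_inv psdY.1 !mulmxA.
by rewrite trmxD !trmx_mul !trmxK psdY.1 posVv.1 mulmxA addrC.
Qed.

Lemma schur_filter : schur_stable (A - H *m C)^T.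
Proof.
case: stdY => _ _ _; congr schur_stable.
rewrite !trmxK trmxD trmxN trmx_mul H_lqgE trmxN trmxK /F_lqg trmxK mulmxN opprK.
by rewrite mulmxN !mulmxA.
Qed.

Local Notation Phi := (loop_mx A B C (A + B *m F - H *m C) H F).
Local Notation N := (loop_noise Vw Vv H).

Variable S : nat -> 'M[R]_(nx + nx).
Hypothesis S_rec : forall t, S t.+1 = Phi *m S t *m Phi^T + N.
Hypothesis psdS0 : psdmx (S 0%N).

(** The input deviates from the optimal state feedback by [F] times the estimation error, whose
    second moment tends to [Y] since [A - H *m C] is stable. With the fixed point [X] the cost steps
    telescope, and the boundary term at [T] has the favourable sign. *)
Lemma lqg_loop_cost_le :
  avg_le (loop_cost C Vv Q Wu F S) (lqg_cost A B Vw Vv Q Wu X Y).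
Proof.
set J := lqg_cost _ _ _ _ _ _ _ _.
(* [D] sends the loop state to the estimation error [xi - x], which by [DPhi] has autonomous
   dynamics up to noise. *)
pose D : 'M[R]_(nx, nx + nx) := row_mx (- 1%:M) 1%:M.
pose E t := D *m S t *m D^T - Y.
have DPhi : D *m Phi = (A - H *m C) *m D.
  rewrite /D mul_row_block mul_mx_row !(mulmxN, mulNmx, mul1mx, mulmx1).
  by congr row_mx; mxring.
have Erec t : E t.+1 = (A - H *m C) *m E t *m (A - H *m C)^T.
  have fi : Phi *m block_mx Y 0 0 0 *m Phi^T + N =
      block_mx (ric A^T C^T Vw Vv Y) 0 0 0 +
      col_mx (- (F_lqg A^T C^T Vv Y)^T) H *m ric_weight C^T Vv Y *m
      (col_mx (- (F_lqg A^T C^T Vv Y)^T) H)^T.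
    exact: loop_filter_identity.
  have -> : E t.+1 = D *m (Phi *m (S t - block_mx Y 0 0 0) *m Phi^T) *m D^T +
      D *m (Phi *m block_mx Y 0 0 0 *m Phi^T + N) *m D^T - Y.
    rewrite /E S_rec !(mulmxDl, mulmxDr, mulmxN, mulNmx); mxring.
  (* The innovation cancels in the error because [H] is the Kalman gain. *)
  have DM : D *m col_mx (- (F_lqg A^T C^T Vv Y)^T) H = 0.
    by rewrite /D mul_row_col -H_lqgE mulNmx mul1mx addNr.
  have fixY : Y = ric A^T C^T Vw Vv Y by case: stdY.
  rewrite fi -fixY.
  have DY : D *m block_mx Y 0 0 0 *m D^T = Y.
    rewrite /D tr_row_mx mul_row_block mul_row_col.
    by rewrite !(mulmx0, addr0, trmxN, trmx1, mulmx1, mulNmx, mulmxN, mul1mx, opprK).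
  have DPhiZ Z : D *m (Phi *m Z *m Phi^T) *m D^T =
      (A - H *m C) *m (D *m Z *m D^T) *m (A - H *m C)^T.
    have -> : D *m (Phi *m Z *m Phi^T) *m D^T = (D *m Phi) *m Z *m (D *m Phi)^T.
      by rewrite trmx_mul !mulmxA.
    by rewrite DPhi trmx_mul !mulmxA.
  rewrite DPhiZ [D *m (_ + _ *m _)]mulmxDr.
  have -> M Z N : D *m (M *m Z *m N) = D *m M *m Z *m N by rewrite !mulmxA.
  rewrite DM !mul0mx addr0 DY addrK mulmxDr mulmxDl mulmxN mulNmx DY.
  by rewrite /E.
have EE t : E t = (A - H *m C) ^+ t *m E 0%N *m ((A - H *m C) ^+ t)^T.
  elim: t => [|t IH]; first by rewrite expr0 trmx1 mul1mx mulmx1.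
  by rewrite Erec IH exprS -[(A - H *m C) * _]/(_ *m _) trmx_mul !mulmxA.
have E0 : mcvg (F := \oo) E 0.
  have c0 := mcvg_powT schur_filter.
  have -> : E = fun t => (A - H *m C) ^+ t *m E 0%N *m ((A - H *m C) ^+ t)^T.
    by apply/funext.
  have -> : (0 : 'M[R]_nx) = (0 : 'M[R]_nx) *m E 0%N *m (0 : 'M[R]_nx)^T.
    by rewrite trmx0 mulmx0.
  apply: mcvg_mul; last exact: mcvg_tr.
  by apply: mcvg_mul => //; exact: mcvg_cst.
pose Z := F^T *m ric_weight B Wu X *m F.
pose r t := \tr (Z *m E t).
have r0 : r @ \oo --> (0 : R).
  rewrite -(mxtrace0 _ nx) -(mulmx0 nx Z).
  by apply: cvg_mxtrace; apply: mcvg_mul => //; exact: mcvg_cst.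
have step t : loop_cost C Vv Q Wu F S t + \tr (block_mx X 0 0 0 *m S t.+1) =
    \tr (block_mx X 0 0 0 *m S t) + (J + r t).
  have -> : loop_cost C Vv Q Wu F S t + \tr (block_mx X 0 0 0 *m S t.+1) =
      \tr (block_mx (ric A B (C^T *m Q *m C) Wu X) 0 0 0 *m S t) +
      \tr (Q *m Vv) + \tr (X *m Vw) +
      \tr ((row_mx (- F) F)^T *m ric_weight B Wu X *m row_mx (- F) F *m S t).
    by apply: loop_cost_step => //; exact: psdX.
  have <- : X = ric A B (C^T *m Q *m C) Wu X by case: stdX.
  have -> : row_mx (- F) F = F *m D.
    by rewrite /D mul_mx_row mulmxN mulmx1.
  have -> : \tr ((F *m D)^T *m ric_weight B Wu X *m (F *m D) *m S t) =
      \tr (Z *m Y) + r t.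
    rewrite /r -mxtraceD -mulmxDr /E addrC subrK /Z.
    by rewrite trmx_mul -!mulmxA mxtrace_mulC !mulmxA.
  by rewrite /J /lqg_cost /stage_cost -/Z; ring.
have rle := avg_le_null r0.
move=> e e0; have [K hK] := rle e e0.
exists (\tr (block_mx X 0 0 0 *m S 0%N) + K) => T.
have sumE : \sum_(t < T) loop_cost C Vv Q Wu F S t = \tr (block_mx X 0 0 0 *m S 0%N)
    - \tr (block_mx X 0 0 0 *m S T) + T%:R * J + \sum_(t < T) r t.
  elim: T => [|T IH]; first by rewrite !big_ord0; ring.
  rewrite !big_ord_recr/= IH; have := step T; rewrite -natr1; lra.
have posS : 0 <= \tr (block_mx X 0 0 0 *m S T).
  apply: tr_psd_ge0; first exact: psd_plant.
  by apply: (lyapunov_psd S_rec) => //; exact: psd_loop_noise.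
rewrite sumE; have := hK T; lra.
Qed.

End LqgLoop.

(** * Windows of linear systems *)

Section Windows.
Context {R : realType} {c : nat}.
Variable L : nat.

(* [stack] for sequences of matrices with any number of columns. *)
Definition mstack n (s : nat -> 'M[R]_(n, c)) (t0 : nat) : 'M[R]_(blk L n, c) :=
  \mxcol_(i < L) s (t0 + i)%N.

Lemma mstackD n (s s' : nat -> 'M[R]_(n, c)) t0 :
  mstack (fun t => s t + s' t) t0 = mstack s t0 + mstack s' t0.
Proof. by rewrite /mstack mxcolD. Qed.

Lemma mstackN n (s : nat -> 'M[R]_(n, c)) t0 :
  mstack (fun t => - s t) t0 = - mstack s t0.
Proof. by rewrite /mstack mxcolN. Qed.

Lemma mstack_shift n (s : nat -> 'M[R]_(n, c)) t0 : (0 < L)%N ->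
  mstack s t0.+1 = shift_mx L n *m mstack s t0 + last_mx L n *m s (t0 + L)%N.
Proof.
move=> L0; rewrite /shift_mx /last_mx /mstack mul_mxblock_mxrow mxcol_mul -mxcolD.
apply: eq_mxcol => i; have [iL|iL] := eqVneq i.+1 L.
  rewrite mul1mx big1 ?add0r => [|j _]; first by rewrite addSnnS iL.
  by rewrite iL (ltn_eqF (ltn_ord j)) mul0mx.
rewrite mul0mx addr0.
have iL' : (i.+1 < L)%N by rewrite ltn_neqAle iL ltn_ord.
rewrite (bigD1 (Ordinal iL'))//= eqxx mul1mx big1 ?addr0 ?addnS ?addSn// => j ji.
by case: eqP => [e|_]; [rewrite -(inj_eq val_inj)/= e eqxx in ji|rewrite mul0mx].
Qed.

Section System.
Context {n m p : nat}.
Variables (A : 'M[R]_n) (C : 'M[R]_(p, n)).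
Variables (x f : nat -> 'M[R]_(n, c)).
Hypothesis x_rec : forall t, x t.+1 = A *m x t + f t.

Lemma linear_solution t k :
  x (t + k)%N = A ^+ k *m x t + \sum_(j < k) A ^+ (k - j.+1) *m f (t + j)%N.
Proof.
elim: k => [|k IH]; first by rewrite addn0 expr0 mul1mx big_ord0 addr0.
rewrite addnS x_rec IH mulmxDr mulmxA -[A *m A ^+ k]/(A * _) -exprS -addrA.
congr (_ + _); rewrite big_ord_recr/= subnn expr0 mul1mx mulmx_sumr.
congr (_ + _); apply: eq_bigr => j _.
by rewrite mulmxA -[A *m A ^+ _]/(A * _) -exprS subSn.
Qed.

Lemma ctrb_mstack (B : 'M[R]_(n, m)) (u : nat -> 'M[R]_(m, c)) t :
  ctrb_mx L A B *m mstack u t = \sum_(j < L) A ^+ (L - j.+1) *m (B *m u (t + j)%N).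
Proof.
by rewrite /ctrb_mx /mstack mul_mxrow_mxcol; apply: eq_bigr => j _; rewrite mulmxA.
Qed.

Lemma markov_mstack (B : 'M[R]_(n, m)) (u : nat -> 'M[R]_(m, c)) t :
  markov_mx L A B C *m mstack u t =
  \mxcol_(i < L) (C *m \sum_(j < i) A ^+ (i - j.+1) *m (B *m u (t + j)%N)).
Proof.
rewrite /markov_mx /mstack mul_mxblock_mxrow; apply: eq_mxcol => i.
rewrite mulmx_sumr
  (big_ord_widen L (fun j => C *m (A ^+ (i - j.+1) *m (B *m u (t + j)%N))))//; last exact: ltnW.
rewrite [RHS]big_mkcond/=; apply: eq_bigr => j _.
by case: ifP => _; rewrite ?mul0mx// !mulmxA.
Qed.

Lemma window_outputE t :
  mstack (fun s => C *m x s) t = obsv_mx L A C *m x t +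
  \mxcol_(i < L) (C *m \sum_(j < i) A ^+ (i - j.+1) *m f (t + j)%N).
Proof.
rewrite /mstack /obsv_mx mxcol_mul -mxcolD; apply: eq_mxcol => i.
by rewrite linear_solution mulmxDr mulmxA.
Qed.

End System.

Section ControlledSystem.
Context {n m p : nat}.
Variables (A : 'M[R]_n) (B : 'M[R]_(n, m)) (C : 'M[R]_(p, n)).
Variables (x w : nat -> 'M[R]_(n, c)) (u : nat -> 'M[R]_(m, c)).
Hypothesis x_rec : forall t, x t.+1 = A *m x t + B *m u t + w t.

Let x_rec' t : x t.+1 = A *m x t + (B *m u t + w t).
Proof. by rewrite addrA. Qed.

Lemma window_state t : x (t + L)%N = A ^+ L *m x t + ctrb_mx L A B *m mstack u t +
  ctrb_mx L A 1%:M *m mstack w t.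
Proof.
rewrite (linear_solution x_rec') !ctrb_mstack -addrA -big_split/=; congr (_ + _).
by apply: eq_bigr => j _; rewrite mul1mx mulmxDr.
Qed.

Lemma window_output t : mstack (fun s => C *m x s) t = obsv_mx L A C *m x t +
  markov_mx L A B C *m mstack u t + markov_mx L A 1%:M C *m mstack w t.
Proof.
rewrite (window_outputE C x_rec') !markov_mstack -addrA -mxcolD; congr (_ + _).
apply: eq_mxcol => i; rewrite -mulmxDr -big_split/=; congr (_ *m _).
by apply: eq_bigr => j _; rewrite mul1mx mulmxDr.
Qed.

End ControlledSystem.

Section AutonomousNoise.
Context {n m p : nat}.
Variables (A : 'M[R]_n) (B : 'M[R]_(n, m)) (C : 'M[R]_(p, n)).
Variables (x : nat -> 'M[R]_(n, c)) (u : nat -> 'M[R]_(m, c)).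
Hypothesis x_rec : forall t, x t.+1 = A *m x t + B *m u t.

Let x_rec' t : x t.+1 = A *m x t + B *m u t + 0. Proof. by rewrite addr0. Qed.
Let w0 t : mstack (fun=> 0 : 'M[R]_(n, c)) t = 0. Proof. exact: mxcol0. Qed.

Lemma window_state0 t : x (t + L)%N = A ^+ L *m x t + ctrb_mx L A B *m mstack u t.
Proof. by rewrite (window_state x_rec') w0 mulmx0 addr0. Qed.

Lemma window_output0 t : mstack (fun s => C *m x s) t = obsv_mx L A C *m x t +
  markov_mx L A B C *m mstack u t.
Proof. by rewrite (window_output C x_rec') w0 mulmx0 addr0. Qed.

End AutonomousNoise.

End Windows.

(** * Frobenius norm and pseudo-inverse *)

Section Frobenius.
Context {R : realType}.

Definition fro m n (M : 'M[R]_(m, n)) : R := \tr (M^T *m M).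

Lemma froE m n (M : 'M[R]_(m, n)) : fro M = \sum_i \sum_j M i j ^+ 2.
Proof.
rewrite exchange_big/=; apply: eq_bigr => j _; rewrite mxE.
by apply: eq_bigr => i _; rewrite mxE expr2.
Qed.

Lemma fro_ge0 m n (M : 'M[R]_(m, n)) : 0 <= fro M.
Proof. by rewrite froE; do 2 apply: sumr_ge0 => ? _; exact: sqr_ge0. Qed.

Lemma fro_eq0 m n (M : 'M[R]_(m, n)) : fro M = 0 -> M = 0.
Proof.
rewrite froE => /eqP; rewrite psumr_eq0; last first.
  by move=> i _; apply: sumr_ge0 => j _; exact: sqr_ge0.
move/allP => h; apply/matrixP => i j; rewrite mxE; apply/eqP.
have := h i (mem_index_enum i); rewrite /= psumr_eq0; last first.
  by move=> k _; exact: sqr_ge0.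
by move/allP => /(_ j (mem_index_enum j)); rewrite /= sqrf_eq0.
Qed.

Lemma fro_mxcol L n c (s : 'I_L -> 'M[R]_(n, c)) :
  fro (\mxcol_(i < L) s i) = \sum_(i < L) fro (s i).
Proof. by rewrite /fro tr_mxcol mul_mxrow_mxcol raddf_sum. Qed.

(** Pythagoras for an orthogonal projection. *)
Lemma fro_proj m n (P : 'M[R]_m) (M : 'M[R]_(m, n)) : P^T = P -> P *m P = P ->
  fro M = fro ((1%:M - P) *m M) + fro (P *m M).
Proof.
move=> tP iP; rewrite /fro -mxtraceD; congr mxtrace.
rewrite !trmx_mul tP linearB/= trmx1 tP !mulmxA.
rewrite -[M^T *m (1%:M - P) *m (1%:M - P)]mulmxA -[M^T *m P *m P]mulmxA iP.
rewrite mulmxBr mulmx1 mulmxBl mul1mx iP subrr subr0.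
by rewrite mulmxBr mulmx1 mulmxBl subrK.
Qed.

(** Full column rank makes the Gram matrix [Ob^T *m Ob] invertible, which provides a Penrose
    solution; hence the chosen one satisfies the Penrose equations, and cancelling [Ob] in the first
    of them leaves a left inverse. *)
Lemma pinv_spec m n (Ob : 'M[R]_(m, n)) : \rank Ob = n ->
  Defs.pinv Ob *m Ob = 1%:M /\ (Ob *m Defs.pinv Ob)^T = Ob *m Defs.pinv Ob.
Proof.
move=> rO; have /row_fullP[B BO] : row_full Ob by rewrite /row_full rO.
have uG : Ob^T *m Ob \in unitmx.
  rewrite unitmxE unitfE; apply/negP => /det0P[v v0 vO].
  have : fro (Ob *m v^T) = 0.
    by rewrite /fro trmx_mul trmxK -mulmxA [Ob^T *m _]mulmxA mulmxA vO mul0mx mxtrace0.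
  move/fro_eq0 => Ov; case/negP: v0; apply/eqP/trmx_inj.
  by rewrite trmx0 -[v^T]mul1mx -BO -mulmxA Ov mulmx0.
pose X0 := invmx (Ob^T *m Ob) *m Ob^T.
have X0O : X0 *m Ob = 1%:M by rewrite /X0 -mulmxA mulVmx.
have mp0 : moore_penrose Ob X0.
  split.
  - by rewrite -mulmxA X0O mulmx1.
  - by rewrite X0O mul1mx.
  - by rewrite /X0 !trmx_mul trmxK trmx_inv trmx_mul trmxK !mulmxA.
  - by rewrite X0O trmx1.
have [e1 _ e3 _] : moore_penrose Ob (Defs.pinv Ob).
  by apply: (@xgetPex _ _ [set X | moore_penrose Ob X]); exists X0.
split=> //; have := congr1 (mulmx B) e1.
by rewrite -!mulmxA !(mulmxA B) BO !mul1mx.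
Qed.

End Frobenius.

(** * Histories and input-output-history control laws *)

Section History.
Context {R : realType} {nx nu ny : nat}.
Variable L : nat.
Hypothesis L_gt0 : (0 < L)%N.
Variables (A : 'M[R]_nx) (B : 'M[R]_(nx, nu)) (C : 'M[R]_(ny, nx)).
Hypothesis obsA : lstep_observable L A C.
Variables (dw : nat -> 'cV[R]_(nx + ny)) (x : nat -> 'cV[R]_nx) (u : nat -> 'cV[R]_nu).
Hypothesis x_rec : forall t, x t.+1 = A *m x t + B *m u t + wn dw t.

Definition plant_y t : 'cV[R]_ny := C *m x t + vn dw t.

Definition hist t : 'cV[R]_(nh L nx nu ny) :=
  col_mx (col_mx (mstack L u t) (mstack L plant_y t))
         (col_mx (mstack L (wn dw) t) (mstack L (vn dw) t)).

Lemma plant_y_window t : mstack L plant_y t = obsv_mx L A C *m x t +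
  markov_mx L A B C *m mstack L u t + markov_mx L A 1%:M C *m mstack L (wn dw) t +
  mstack L (vn dw) t.
Proof. by rewrite /plant_y mstackD (window_output L C x_rec). Qed.

(** The pseudo-inverse recovers the state at the start of a window from its outputs, inputs and
    noise; [M1] to [M4] then propagate it by [L] steps. Hence [Psi] predicts exactly on actual
    histories. *)
Lemma hist_Psi t : Psi L A B C *m hist t = C *m x (t + L)%N.
Proof.
rewrite /Psi -mulmxA; congr (_ *m _).
rewrite /hist !mul_row_col plant_y_window (window_state L x_rec).
have [OO _] := pinv_spec obsA.
rewrite /M1 /M2 /M3 /M4 /AOpinv.
rewrite !mulmxBl !mulmxDr !mulNmx !mulmxA.
rewrite -[A ^+ L *m _ *m obsv_mx L A C]mulmxA OO mulmx1.
mxring.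
Qed.

Lemma hist_step t : hist t.+1 =
  Theta L A B C *m hist t + Pi_d L *m dw (t + L)%N + Pi_u L *m u (t + L)%N.
Proof.
have Eh := hist_Psi t.
rewrite /Theta mulmxDl !mul_col_mx !mul0mx -[last_mx L ny *m _ *m _]mulmxA Eh.
rewrite [in RHS]/hist /Pi_d /Pi_u -[dw (t + L)%N]vsubmxK.
rewrite !(mul_col_mx, mul_row_col, mul0mx, addr0, add0r).
rewrite !(add_col_mx, addr0, add0r).
rewrite /hist !mstack_shift// /plant_y mulmxDr.
congr (col_mx (col_mx _ _) _).
by rewrite addrA.
Qed.

Lemma hist_y t : plant_y (t + L)%N = Psi L A B C *m hist t + Upsilon *m dw (t + L)%N.
Proof.
rewrite hist_Psi /plant_y; congr (_ + _).
by rewrite -[dw _ in RHS]vsubmxK /Upsilon mul_row_col mul0mx mul1mx add0r.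
Qed.

Lemma hist_Gamma t : Gamma L *m hist t = col_mx (mstack L u t) (mstack L plant_y t).
Proof. by rewrite /Gamma mul_row_col mul1mx mul0mx addr0. Qed.

Variable K : 'M[R]_(nu, nz L nu ny).
Hypothesis u_law : forall t,
  u (t + L)%N = K *m col_mx (mstack L u t) (mstack L plant_y t).

Lemma hist_closed_loop t :
  hist t.+1 = Theta_cl A B C K *m hist t + Pi_d L *m dw (t + L)%N.
Proof.
have -> : Theta_cl A B C K *m hist t =
    Theta L A B C *m hist t + Pi_u L *m K *m Gamma L *m hist t by exact: mulmxDl.
by rewrite hist_step u_law -hist_Gamma -!mulmxA addrAC.
Qed.

Variable uini : nat -> 'cV[R]_nu.
Hypotheses (x0 : x 0%N = 0) (u_ini : forall t, (t < L)%N -> u t = uini t).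

Lemma ini_xE t : (t <= L)%N -> ini_x A B dw uini t = x t.
Proof.
elim: t => [|t IH] tL /=; first by rewrite x0.
by rewrite IH 1?ltnW// x_rec u_ini.
Qed.

Lemma ini_yE t : (t < L)%N -> ini_y A B C dw uini t = plant_y t.
Proof. by move=> tL; rewrite /ini_y ini_xE// ltnW. Qed.

Lemma ini_hE : ini_h A B C dw L uini = hist 0.
Proof.
rewrite /ini_h /ini_z /hist; congr (col_mx (col_mx _ _) _); apply: eq_mxcol => i.
  by rewrite add0n u_ini.
by rewrite add0n ini_yE.
Qed.

Lemma h_fromE s : h_from A B C dw uini K s = hist s.
Proof.
elim: s => [|s IH] /=; first exact: ini_hE.
by rewrite IH hist_step u_law -hist_Gamma (addnC s L).
Qed.

Lemma h_uE t : (L <= t)%N -> h_u A B C dw uini K t = u t.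
Proof.
by move=> Lt; rewrite /h_u /h_state h_fromE hist_Gamma -u_law subnK.
Qed.

Lemma h_yE t : (L <= t)%N -> h_y A B C dw uini K t = plant_y t.
Proof.
by move=> Lt; have := hist_y (t - L); rewrite subnK// => ->; rewrite /h_y /h_state h_fromE.
Qed.

End History.

(** * Controllers seen through input-output windows *)

Section ControllerWindows.
Context {R : realType} {nu ny nk : nat}.
Variable L : nat.
Variables (G : 'M[R]_nk) (H : 'M[R]_(nk, ny)) (F : 'M[R]_(nu, nk)).
Hypothesis obsG : lstep_observable L G F.

(** The counterparts of [M2] and [M1] with the roles of inputs and outputs exchanged, followed by
    the output map [F]. *)
Definition ioh_gain : 'M[R]_(nu, nz L nu ny) :=
  row_mx (F *m (G ^+ L *m Defs.pinv (obsv_mx L G F)))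
    (F *m (ctrb_mx L G H - G ^+ L *m Defs.pinv (obsv_mx L G F) *m markov_mx L G H F)).

Lemma ioh_gainE c (xi : nat -> 'M[R]_(nk, c)) (y : nat -> 'M[R]_(ny, c)) t :
  (forall t, xi t.+1 = G *m xi t + H *m y t) ->
  F *m xi (t + L)%N =
    ioh_gain *m col_mx (mstack L (fun s => F *m xi s) t) (mstack L y t).
Proof.
move=> xi_rec; rewrite mul_row_col (window_output0 L F xi_rec) (window_state0 L xi_rec).
have [OO _] := pinv_spec obsG.
rewrite !(mulmxDr, mulmxDl, mulmxN, mulNmx, mulmxA).
rewrite -[F *m G ^+ L *m _ *m obsv_mx L G F]mulmxA OO mulmx1.
mxring.
Qed.

End ControllerWindows.

Section IohController.
Context {R : realType} {L nu ny : nat}.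
Variable K : 'M[R]_(nu, nz L nu ny).

Lemma mul_gain c (U : 'I_L -> 'M[R]_(nu, c)) (Y : 'I_L -> 'M[R]_(ny, c)) :
  K *m col_mx (\mxcol_i U i) (\mxcol_i Y i) =
  \sum_i (Ku K i *m U i + Ky K i *m Y i).
Proof.
rewrite -[K in LHS]hsubmxK mul_row_col big_split/=.
by rewrite -[lsubmx K in LHS]submxrowK -[rsubmx K in LHS]submxrowK !mul_mxrow_mxcol.
Qed.

Section Response.
Context {c : nat}.
Variables (xi : nat -> 'M[R]_(blk L nu, c)) (y : nat -> 'M[R]_(ny, c)).
Hypothesis xi_rec : forall t, xi t.+1 = iohG K *m xi t + iohH K *m y t.
Local Notation u := (fun t => iohF *m xi t).

Lemma ioh_last (i : 'I_L) t : i.+1 = L -> iohF *m xi t = submxcol (xi t) i.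
Proof.
move=> iL; rewrite -[xi t in LHS]submxcolK /iohF mul_mxrow_mxcol.
rewrite (bigD1 i)//= iL eqxx mul1mx big1 ?addr0// => j ji.
rewrite ifF ?mul0mx//; apply/eqP => jL; case/negP: ji.
by rewrite -(inj_eq val_inj)/= -eqSS jL iL.
Qed.

Lemma ioh_block (i : 'I_L) t : submxcol (xi t.+1) i =
  (\sum_(j < L | i == j.+1 :> nat) submxcol (xi t) j) +
  Ku K i *m (iohF *m xi t) + Ky K i *m y t.
Proof.
rewrite xi_rec submxcolD; congr (_ + _); last first.
  by rewrite /iohH mxcol_mul mxcolK.
have iL : (L.-1 < L)%N by rewrite prednK// (leq_ltn_trans _ (ltn_ord i)).
pose l := Ordinal iL; have lL : l.+1 = L by rewrite /= prednK// (leq_ltn_trans _ (ltn_ord i)).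
rewrite (ioh_last t lL) -[xi t in LHS]submxcolK /iohG mul_mxblock_mxrow mxcolK.
rewrite (bigD1 l)//= prednK ?(leq_ltn_trans _ (ltn_ord i))// eqxx addrC.
congr (_ + _); rewrite [RHS](bigID (pred1 l))/= [X in _ = X + _]big1 ?add0r.
  rewrite big_mkcond [RHS]big_mkcond/=; apply: eq_bigr => j _.
  have [->|jl] := eqVneq j l; first by rewrite andbF.
  rewrite andbT ifF.
    by case: eqP => _; rewrite ?mul1mx ?mul0mx.
  apply/eqP => jL; case/negP: jl; rewrite -(inj_eq val_inj)/= -eqSS jL.
  by rewrite prednK// (leq_ltn_trans _ (ltn_ord i)).
move=> j /andP[/eqP ij /eqP jl]; have := ltn_ord i.
by rewrite ij jl /= prednK ?ltnn// (leq_ltn_trans _ (ltn_ord i)).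
Qed.

(* Block [i] of the state collects the terms of the control law that are still
   to be delayed by [L - 1 - i] steps. *)
Lemma ioh_block_sum (k : nat) (kL : (k < L)%N) t :
  submxcol (xi (t + k.+1)%N) (Ordinal kL) =
  \sum_(j < L | (j <= k)%N)
    (Ku K j *m (iohF *m xi (t + j)%N) + Ky K j *m y (t + j)%N).
Proof.
elim: k kL => [|k IH] kL.
  rewrite addn1 ioh_block big1 ?add0r => [|j /eqP//].
  rewrite [RHS](bigD1 (Ordinal kL))//= (addn0 t) [X in _ = _ + X]big1 ?addr0//.
  by move=> j /andP[]; rewrite leqn0 -(inj_eq val_inj)/= => ->.
have kL' : (k < L)%N by exact: ltnW.
rewrite addnS ioh_block [X in X + _ + _](bigD1 (Ordinal kL'))//=.
rewrite [X in _ + X + _ + _]big1 ?addr0 => [|j]; last first.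
  by move=> /andP[/eqP[kj]]; rewrite -(inj_eq val_inj)/= kj eqxx.
rewrite (IH kL') [RHS](bigD1 (Ordinal kL))//= addrC -addrA; congr (_ + (_ + _)).
apply: eq_bigl => j; rewrite -(inj_eq val_inj)/=; have := ltn_ord j.
by case: ltngtP => //; lia.
Qed.

Lemma ioh_control_law t : (0 < L)%N ->
  iohF *m xi (t + L)%N =
    K *m col_mx (mstack L u t) (mstack L y t).
Proof.
move=> L0; have iL : (L.-1 < L)%N by rewrite prednK.
rewrite (@ioh_last (Ordinal iL)) ?prednK//.
have -> : (t + L = t + L.-1.+1)%N by rewrite prednK.
rewrite ioh_block_sum mul_gain.
by apply: eq_bigl => j; rewrite -ltnS prednK// ltn_ord.
Qed.

End Response.

(** While the outputs vanish, the blocks of the state only move down. Block [i] reaches the output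
    after [L - 1 - i] steps, so it is zero. *)
Lemma ioh_observable (L_gt0 : (0 < L)%N) :
  obsv_mx L (iohG K) iohF \in unitmx.
Proof.
rewrite -unitmx_tr unitmxE unitfE; apply/negP => /det0P[v v0 vO].
case/negP: v0; apply/eqP/trmx_inj; rewrite trmx0.
have Ov : obsv_mx L (iohG K) iohF *m v^T = 0.
  by apply: trmx_inj; rewrite trmx_mul trmxK vO trmx0.
pose xi t := iohG K ^+ t *m v^T.
have xi_rec t : xi t.+1 = iohG K *m xi t + iohH K *m (0 : 'cV[R]_ny).
  by rewrite mulmx0 addr0 /xi exprS -mulmxA.
have u0 t : (t < L)%N -> iohF *m xi t = 0.
  move=> tL; move: Ov; rewrite /obsv_mx mxcol_mul -[0 in RHS](@mxcol0 _ L (fun=> nu)).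
  by move=> /eq_mxcolP/(_ (Ordinal tL)) /=; rewrite /xi mulmxA.
have sh k i (iL : (i < L)%N) (ikL : (i + k < L)%N) :
    submxcol (xi k) (Ordinal ikL) = submxcol (xi 0%N) (Ordinal iL).
  elim: k ikL => [|k IH] ikL.
    by congr (submxcol _ _); apply: val_inj; rewrite /= addn0.
  have ikL' : (i + k < L)%N by rewrite (leq_ltn_trans _ ikL)// addnS.
  rewrite (ioh_block xi_rec) u0 ?mulmx0 ?addr0; last first.
    by rewrite (leq_ltn_trans _ ikL)// addnS ltnW// ltnS leq_addl.
  rewrite [LHS](bigD1 (Ordinal ikL'))/= ?addnS//.
  rewrite big1 ?addr0 ?(IH ikL')// => j /andP[/eqP[ij]].
  by rewrite -(inj_eq val_inj)/= ij eqxx.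
have -> : v^T = xi 0%N by rewrite /xi expr0 mul1mx.
rewrite -[xi 0%N]submxcolK -[0 in RHS](@mxcol0 _ L (fun=> nu)).
apply: eq_mxcol => -[i iL].
have iL1 : (i + (L - i.+1) < L)%N by rewrite -ltn_subRL subnSK// subnn -subnSK.
rewrite -(sh (L - i.+1)%N i iL iL1) -(ioh_last xi).
  by rewrite u0// subnSK// leq_subr.
by rewrite /= -addnS subnSK// subnKC// ltnW.
Qed.

End IohController.

Section ControllerLoop.
Context {R : realType} {nx nu ny : nat}.
Variables (A : 'M[R]_nx) (B : 'M[R]_(nx, nu)) (C : 'M[R]_(ny, nx)).
Variable dw : nat -> 'cV[R]_(nx + ny).

Section Recursion.
Variables (k : controller R nu ny) (xi0 : 'cV[R]_(xdim k)).
Definition s_x t := (s_state A B C dw xi0 t).1.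
Definition s_xi t := (s_state A B C dw xi0 t).2.

Lemma s_x_rec t : s_x t.+1 = A *m s_x t + B *m s_u A B C dw xi0 t + wn dw t.
Proof. by rewrite /s_x /s_u /=; case: (s_state A B C dw xi0 t). Qed.

Lemma s_xi_rec t : s_xi t.+1 = cG k *m s_xi t + cH k *m s_y A B C dw xi0 t.
Proof. by rewrite /s_xi /s_y /=; case: (s_state A B C dw xi0 t). Qed.

Lemma s_yE : s_y A B C dw xi0 = plant_y C dw s_x.
Proof. by []. Qed.

End Recursion.

Section IohLoop.
Variables (L : nat) (K : 'M[R]_(nu, nz L nu ny)) (uini : nat -> 'cV[R]_nu).
Hypothesis L_gt0 : (0 < L)%N.

Let xi0 : 'cV[R]_(xdim (ioh_controller K)) := ioh_xi0 K (ini_z A B C dw L uini).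
Local Notation x := (s_x (k := ioh_controller K) xi0).
Local Notation xi := (s_xi (k := ioh_controller K) xi0).
Local Notation u := (s_u A B C dw (k := ioh_controller K) xi0).
Local Notation y := (s_y A B C dw (k := ioh_controller K) xi0).

Let solution (y' : nat -> 'cV[R]_ny) t : (t < L)%N ->
  (forall j, (j < t)%N -> y j = y' j) ->
  u t = iohF *m (iohG K ^+ t *m xi0 +
    \sum_(j < t) iohG K ^+ (t - j.+1) *m (iohH K *m y' j)).
Proof.
move=> tL yy'; rewrite /s_u -/(xi t); congr (_ *m _).
have xi_rec s : xi s.+1 = iohG K *m xi s + iohH K *m y s by exact: s_xi_rec.
have := linear_solution xi_rec 0 t; rewrite add0n => ->; congr (_ + _); apply: eq_bigr => j _.
by rewrite add0n yy'.
Qed.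

(** The start is computed from outputs that [uini] is supposed to cause, so agreement goes by
    induction on time: equal inputs so far give equal outputs, and the strictly lower triangular
    [markov_mx] makes the next input depend on these alone. *)
Lemma ioh_initial t : (t < L)%N -> u t = uini t.
Proof.
suff xu s : (s <= L)%N -> x s = ini_x A B dw uini s /\
    forall t, (t < s)%N -> u t = uini t.
  by move=> tL; have [_] := xu t.+1 tL; apply.
(* The initial state solves this window equation, as the observability matrix is invertible. *)
have xi0E : obsv_mx L (iohG K) iohF *m xi0 +
    markov_mx L (iohG K) (iohH K) iohF *m mstack L (ini_y A B C dw uini) 0 =
    mstack L uini 0.
  rewrite /xi0 /ioh_xi0 !mulmxA mulmxV ?ioh_observable// mul1mx /ini_z.
  by rewrite mul_row_col mul1mx mulNmx subrK.
elim: s => [|s IH] sL; first by split.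
have [xs us] := IH (ltnW sL).
have ys j : (j < s)%N -> y j = ini_y A B C dw uini j.
  move=> js; have [xj _] : x j = ini_x A B dw uini j /\ True.
    split=> //; elim: j js => // j IHj js.
    rewrite s_x_rec IHj 1?ltnW//=; congr (_ + _ *m _ + _); exact: us (ltnW js).
  by rewrite /s_y -/(x j) xj.
have uE : u s = uini s.
  rewrite (solution sL ys).
  move: xi0E; rewrite markov_mstack /obsv_mx mxcol_mul -mxcolD /mstack.
  move=> /eq_mxcolP/(_ (Ordinal sL))/=.
  by rewrite add0n => <-; rewrite mulmxDr mulmxA.
split.
  by rewrite s_x_rec xs uE.
by move=> r; rewrite ltnS leq_eqVlt => /orP[/eqP ->//|/us].
Qed.

Lemma ioh_law t : u (t + L)%N = K *m col_mx (mstack L u t) (mstack L y t).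
Proof.
have xi_rec s : xi s.+1 = iohG K *m xi s + iohH K *m y s by exact: s_xi_rec.
exact: (ioh_control_law xi_rec).
Qed.

Hypothesis obsA : lstep_observable L A C.

Lemma ioh_h_u t : (L <= t)%N -> h_u A B C dw uini K t = u t.
Proof.
move=> Lt; apply: (h_uE L_gt0 obsA (@s_x_rec _ xi0)) => //.
- exact: ioh_law.
- exact: ioh_initial.
Qed.

Lemma ioh_h_y t : (L <= t)%N -> h_y A B C dw uini K t = y t.
Proof.
move=> Lt; apply: (h_yE L_gt0 obsA (@s_x_rec _ xi0)) => //.
- exact: ioh_law.
- exact: ioh_initial.
Qed.

End IohLoop.

End ControllerLoop.

(** * Eigenmodes *)

Section RealModes.
Context {R : realType}.
Local Notation toC := (real_complex R).

(* The real and imaginary parts of an eigenvector span an invariant plane, on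
   which the matrix acts as multiplication by the eigenvalue. *)
Definition mode_mx (l : R[i]) : 'M[R]_(1 + 1) :=
  block_mx (complex.Re l)%:M (complex.Im l)%:M (- (complex.Im l)%:M) (complex.Re l)%:M.

Lemma mode_mx_conformal l : mode_mx l *m (mode_mx l)^T = (cnorm l ^+ 2)%:M.
Proof.
case: l => a b; rewrite /mode_mx tr_block_mx mulmx_block /= !(trmxN, tr_scalar_mx).
rewrite !(mulmxN, mulNmx, opprK) -!scalar_mxM sqr_sqrtr ?addr_ge0 ?sqr_ge0//.
rewrite (mulrC b a) !addNr -!raddfD/=.
rewrite !expr2 (addrC (b * b)) -scalar_mx_block.
by congr scalar_mx; rewrite !expr2 addrC.
Qed.

Lemma real_mode n (M : 'M[R]_n) (l : R[i]) : eigenvalue (map_mx toC M) l ->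
  exists2 h : 'M[R]_(n, 1 + 1), h != 0 & M *m h = h *m mode_mx l.
Proof.
move=> el.
(* [eigenvalue] refers to row eigenvectors, whereas modes are columns. *)
have : eigenvalue (map_mx toC M)^T l.
  move: el; rewrite !eigenvalue_root_char /char_poly -det_tr.
  suff -> : (char_poly_mx (map_mx toC M))^T = char_poly_mx (map_mx toC M)^T by [].
  by apply/matrixP => i j; rewrite !mxE eq_sym.
move=> /eigenvalueP[v vM v0]; pose z := v^T.
have Mz : map_mx toC M *m z = l *: z.
  by apply: trmx_inj; rewrite trmx_mul /z trmxK vM linearZ/= trmxK.
pose a := map_mx (@complex.Re R) z; pose b := map_mx (@complex.Im R) z.
have ReD : {morph @complex.Re R : x y / x + y >-> x + y} by case=> ? ? [].
have ImD : {morph @complex.Im R : x y / x + y >-> x + y} by case=> ? ? [].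
have Re0 : complex.Re (0 : R[i]) = 0 by [].
have Im0 : complex.Im (0 : R[i]) = 0 by [].
have ReM x w : complex.Re (toC x * w) = x * complex.Re w.
  by case: w => p q /=; rewrite mul0r subr0.
have ImM x w : complex.Im (toC x * w) = x * complex.Im w.
  by case: w => p q /=; rewrite mul0r addr0.
have Ma : M *m a = complex.Re l *: a - complex.Im l *: b.
  apply/matrixP => i j; have := congr1 (@complex.Re R) (congr1 (fun Z : 'cV__ => Z i j) Mz).
  rewrite !mxE (big_morph _ ReD Re0) => e.
  transitivity (\sum_k complex.Re ((map_mx toC M) i k * z k j)).
    by apply: eq_bigr => k _; rewrite !mxE ReM.
  by rewrite e; case: (l) => p q; case: (v j i) => r s /=.
have Mb : M *m b = complex.Im l *: a + complex.Re l *: b.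
  apply/matrixP => i j; have := congr1 (@complex.Im R) (congr1 (fun Z : 'cV__ => Z i j) Mz).
  rewrite !mxE (big_morph _ ImD Im0) => e.
  transitivity (\sum_k complex.Im ((map_mx toC M) i k * z k j)).
    by apply: eq_bigr => k _; rewrite !mxE ImM.
  by rewrite e; case: (l) => p q; case: (v j i) => r s /=; rewrite addrC.
exists (row_mx a b).
  apply: contra v0 => /eqP ab0; apply/eqP/matrixP => i j; rewrite mxE.
  have [a0 b0] : a = 0 /\ b = 0 by apply: eq_row_mx; rewrite row_mx0.
  have := congr1 (fun Z : 'cV__ => Z j i) a0; have := congr1 (fun Z : 'cV__ => Z j i) b0.
  by rewrite !mxE; case: (v i j) => p q /= -> ->.
rewrite /mode_mx mul_mx_row mul_row_block Ma Mb !mulmxN !mul_mx_scalar.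
by congr row_mx; rewrite addrC.
Qed.

Lemma fro_conformal m n (M : 'M[R]_(m, n)) (Lam : 'M[R]_n) (rho : R) :
  Lam *m Lam^T = rho%:M -> fro (M *m Lam) = rho * fro M.
Proof.
move=> LL; rewrite /fro.
have -> : (M *m Lam)^T *m (M *m Lam) = Lam^T *m (M^T *m M *m Lam).
  by rewrite trmx_mul !mulmxA.
by rewrite mxtrace_mulC -[M^T *m M *m Lam *m _]mulmxA LL mul_mx_scalar mxtraceZ.
Qed.

End RealModes.

Section WindowModes.
Context {R : realType} {c n m p : nat}.
Variable L : nat.
Hypothesis L_gt0 : (0 < L)%N.
Variables (Lam : 'M[R]_c) (rho : R).
Hypotheses (LamE : Lam *m Lam^T = rho%:M) (rho_ge1 : 1 <= rho).
Variables (A : 'M[R]_n) (B : 'M[R]_(n, m)) (C : 'M[R]_(p, n)).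
Hypothesis obsA : lstep_observable L A C.
Variables (u : nat -> 'M[R]_(m, c)) (y : nat -> 'M[R]_(p, c)).
Hypotheses (u_mode : forall t, u t.+1 = u t *m Lam)
  (y_mode : forall t, y t.+1 = y t *m Lam).

Local Notation Ob := (obsv_mx L A C).
Local Notation Hm := (markov_mx L A B C).

Definition mode_state : 'M[R]_(n, c) :=
  Defs.pinv Ob *m (mstack L y 0 - Hm *m mstack L u 0).

(* A mode that is consistent with the predictor [y_L = C x_L] but not with the
   plant would have a residual [r], orthogonal to the range of the observability
   matrix, with [r Lam] the projection of the shift of [r]; shifts and
   projections do not increase norms, and the shift is nilpotent. *)
Lemma window_mode :
  y L = C *m (A ^+ L *m mode_state + ctrb_mx L A B *m mstack L u 0) ->
  [/\ mstack L y 0 = Ob *m mode_state + Hm *m mstack L u 0,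
      A *m mode_state + B *m u 0%N = mode_state *m Lam
    & y 0%N = C *m mode_state].
Proof.
move=> yL; set x0 := mode_state.
have [PO OPt] := pinv_spec obsA.
pose x := fix x t := if t is s.+1 then A *m x s + B *m u s else x0.
have x_rec t : x t.+1 = A *m x t + B *m u t by [].
(* Output mismatch of the plant trajectory started at the least-squares state [x0]. *)
pose r t := y t - C *m x t.
have rL : r L = 0.
  by rewrite /r yL -[L in x L]add0n (window_state0 L x_rec) subrr.
have rE t : mstack L r t = mstack L y t - Ob *m x t - Hm *m mstack L u t.
  by rewrite /r mstackD mstackN (window_output0 L C x_rec) opprD addrA.
have shift k (s : nat -> 'M[R]_(k, c)) : (forall t, s t.+1 = s t *m Lam) ->
    mstack L s 1 = mstack L s 0 *m Lam.
  by move=> ss; rewrite /mstack mxcol_mul; apply: eq_mxcol => i; rewrite add1n ss add0n.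
pose Pr := Ob *m Defs.pinv Ob.
have PrPr : Pr *m Pr = Pr by rewrite /Pr mulmxA -[Ob *m _ *m Ob]mulmxA PO mulmx1.
have PrO : Defs.pinv Ob *m Pr = Defs.pinv Ob by rewrite /Pr mulmxA PO mul1mx.
have r0E : mstack L r 0 = (1%:M - Pr) *m (mstack L y 0 - Hm *m mstack L u 0).
  by rewrite rE /= /x0 /mode_state addrAC mulmxBl mul1mx /Pr !mulmxA.
have Pr_r0 : Defs.pinv Ob *m mstack L r 0 = 0.
  by rewrite r0E mulmxA [_ *m (1%:M - Pr)]mulmxBr mulmx1 PrO subrr mul0mx.
have r1E : mstack L r 0 *m Lam = mstack L r 1 + Ob *m (x 1%N - x0 *m Lam).
  rewrite !rE (shift _ _ u_mode) (shift _ _ y_mode) !(mulmxDl, mulmxDr, mulNmx, mulmxN, mulmxA).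
  mxring.
have x1E : x 1%N - x0 *m Lam = - (Defs.pinv Ob *m mstack L r 1).
  have := congr1 (mulmx (Defs.pinv Ob)) r1E.
  rewrite mulmxA Pr_r0 mul0mx mulmxDr [in X in _ + X]mulmxA PO mul1mx => /esym/eqP.
  by rewrite addrC addr_eq0 => /eqP.
have r1P : mstack L r 0 *m Lam = (1%:M - Pr) *m mstack L r 1.
  by rewrite r1E x1E mulmxN mulmxA -/Pr mulmxBl mul1mx.
(* As [r L = 0], moving the window by one step only drops [r 0]. *)
have fro_shift : fro (mstack L r 1) + fro (r 0%N) = fro (mstack L r 0).
  rewrite /mstack !fro_mxcol.
  have fr0 : fro (r L) = 0 by rewrite rL /fro mulmx0 mxtrace0.
  have e : \sum_(i < L.+1) fro (r i) = \sum_(i < L) fro (r i).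
    by rewrite big_ord_recr/= fr0 addr0.
  by rewrite addrC -e big_ord_recl.
have fr1 := fro_proj (mstack L r 1) OPt PrPr.
have fr2 := fro_conformal (mstack L r 0) LamE.
have f0 := fro_ge0 (r 0%N); have fP := fro_ge0 (Pr *m mstack L r 1).
have fr := fro_ge0 (mstack L r 0).
have key : fro (mstack L r 0) <= rho * fro (mstack L r 0) by rewrite ler_peMl.
(* Let [a] and [b] be the squared norms of the windows of [r] at 0 and 1. Then [b] is [rho * a] plus
   the squared norm of the projected window, and also [a] minus that of [r 0]; since [rho >= 1],
   both extra terms vanish. *)
rewrite -r1P fr2 in fr1.
have r00 : r 0%N = 0 by apply: fro_eq0; lra.
have Pr1 : Pr *m mstack L r 1 = 0 by apply: fro_eq0; lra.
have r_mode : mstack L r 0 *m Lam = mstack L r 1.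
  by rewrite r1P mulmxBl mul1mx Pr1 subr0.
have rt t : (t < L)%N -> r t = 0.
  elim: t => [|t IH] tL //.
  move: r_mode; rewrite /mstack mxcol_mul => /eq_mxcolP/(_ (Ordinal (ltnW tL)))/=.
  by rewrite add0n add1n IH 1?ltnW// mul0mx => /esym.
have r0 : mstack L r 0 = 0.
  rewrite -[RHS](@mxcol0 _ L (fun=> p)); apply: eq_mxcol => i.
  by rewrite add0n rt.
have pr1 : Defs.pinv Ob *m mstack L r 1 = 0 by rewrite -r_mode r0 mul0mx mulmx0.
split.
- by move/esym/eqP: (rE 0%N); rewrite r0 -addrA -opprD subr_eq0 => /eqP.
- by move: x1E; rewrite pr1 oppr0 => /eqP; rewrite subr_eq0 => /eqP.
- by move: r00; rewrite /r => /eqP; rewrite subr_eq0 => /eqP.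
Qed.

End WindowModes.

Section LqgLoopSchur.
Context {R : realType}.
Local Notation toC := (real_complex R).

Lemma eigenvalue_tr (K : fieldType) n (M : 'M[K]_n) l :
  eigenvalue M^T l = eigenvalue M l.
Proof.
rewrite !eigenvalue_root_char /char_poly -[in RHS]det_tr.
suff -> : (char_poly_mx M)^T = char_poly_mx M^T by [].
by apply/matrixP => i j; rewrite !mxE eq_sym.
Qed.

Lemma schur_stable_tr n (M : 'M[R]_n) : schur_stable M^T -> schur_stable M.
Proof. by move=> sM l el; apply: sM; rewrite -map_trmx eigenvalue_tr. Qed.

(* The sum of the two blocks of a left eigenvector is a left eigenvector of
   [A + B *m F]; when it vanishes, the first block is one of [A - H *m C]. *)
Lemma schur_separation nx nu ny (A : 'M[R]_nx) (B : 'M[R]_(nx, nu)) (C : 'M[R]_(ny, nx))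
    (F : 'M[R]_(nu, nx)) (H : 'M[R]_(nx, ny)) :
  schur_stable (A + B *m F) -> schur_stable (A - H *m C) ->
  schur_stable (loop_mx A B C (A + B *m F - H *m C) H F).
Proof.
have mF : map_mx toC (A + B *m F) = map_mx toC A + map_mx toC B *m map_mx toC F.
  by rewrite map_mxD map_mxM.
have mH : map_mx toC (A - H *m C) = map_mx toC A - map_mx toC H *m map_mx toC C.
  by rewrite map_mxD map_mxN map_mxM.
have mG : map_mx toC (A + B *m F - H *m C) =
    map_mx toC A + map_mx toC B *m map_mx toC F - map_mx toC H *m map_mx toC C.
  by rewrite !(map_mxD, map_mxN, map_mxM).
have mBF : map_mx toC (B *m F) = map_mx toC B *m map_mx toC F by rewrite map_mxM.
have mHC : map_mx toC (H *m C) = map_mx toC H *m map_mx toC C by rewrite map_mxM.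
move=> sF sH l /eigenvalueP[v]; rewrite -[v]hsubmxK.
move: (lsubmx v) (rsubmx v) => v1 v2; rewrite /loop_mx map_block_mx mul_row_block.
rewrite scale_row_mx => /eq_row_mx[].
rewrite mG mBF mHC => e1 e2 v0.
have e12 : (v1 + v2) *m map_mx toC (A + B *m F) = l *: (v1 + v2).
  rewrite scalerDr -e1 -e2 mF !(mulmxDl, mulmxDr, mulmxN, mulmxA).
  mxring.
have [v12|v12] := eqVneq (v1 + v2) 0; last first.
  by apply: sF; apply/eigenvalueP; exists (v1 + v2).
have v2E : v2 = - v1 by apply/eqP; rewrite -addr_eq0 addrC v12.
apply: sH; apply/eigenvalueP; exists v1.
  by rewrite mH mulmxDr mulmxN -e1 v2E mulNmx.
by apply: contra v0 => /eqP v10; rewrite v2E v10 oppr0 row_mx0.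
Qed.

End LqgLoopSchur.

Lemma realizes_response (R : realType) nu ny (k k' : controller R nu ny) c
    (y : nat -> 'M[R]_(ny, c)) (xi : nat -> 'M[R]_(xdim k, c))
    (xi' : nat -> 'M[R]_(xdim k', c)) :
  realizes k k' ->
  (forall t, xi t.+1 = cG k *m xi t + cH k *m y t) ->
  (forall t, xi' t.+1 = cG k' *m xi' t + cH k' *m y t) ->
  xi 0%N = 0 -> xi' 0%N = 0 -> forall t, cF k *m xi t = cF k' *m xi' t.
Proof.
move=> kk' xi_rec xi'_rec xi0 xi'0 t.
rewrite -(add0n t) (linear_solution xi_rec) (linear_solution xi'_rec) xi0 xi'0.
rewrite !mulmx0 !add0r !mulmx_sumr.
by apply: eq_bigr => j _; rewrite !mulmxA kk'.
Qed.

(** * Minimal realizations *)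

Section Minimal.
Context {R : realType} {nu ny : nat}.

(** By Cayley-Hamilton each further term is a combination of the [n] preceding ones. *)
Lemma power_null n p q (M : 'M[R]_n) (b : 'M[R]_(p, n)) (c : 'M[R]_(n, q)) :
  (forall j, (j < n)%N -> b *m M ^+ j *m c = 0) -> forall j, b *m M ^+ j *m c = 0.
Proof.
move=> h0 j; apply/matrixP => i k; rewrite [RHS]mxE.
pose a t := (row i b *m M ^+ t *m col k c) 0 0.
have aE t : a t = (b *m M ^+ t *m c) i k.
  by rewrite /a rowE colE !mulmxA -colE mxE -!mulmxA -rowE mxE mulmxA.
have pa : annihilates (char_poly M) a by exact: annihilates_charpoly.
have a0 t : (t < n)%N -> a t = 0 by move=> tn; rewrite aE h0// mxE.
rewrite -aE; elim/ltn_ind: j => j IH.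
have [/a0//|nj] := ltnP j n.
have := pa (j - n)%N; rewrite /act size_char_poly big_ord_recr/= subnK// big1 => [|l _].
  have /monicP := char_poly_monic M; rewrite /lead_coef size_char_poly/= => ->.
  by rewrite add0r mul1r.
by rewrite IH ?mulr0//; have := ltn_ord l; lia.
Qed.

(* The column space of the controllability matrix is invariant, so a realization
   that cannot be restricted to a smaller state space is controllable. *)
Lemma minimal_controllable (k k' : controller R nu ny) :
  minimal_realization k k' ->
  row_free (\mxrow_(j < xdim k) (cG k ^+ j *m cH k)).
Proof.
case: k => n G H F /= [kk' kmin] /=; set Cb := \mxrow_(j < n) _.
(* Rank factorization: the columns of [E] are a basis of the column space of [Cb], and [E'] gives
   coordinates in it. *)
have [r [E [E' [Rb [rE E'E CbE]]]]] : exists r (E : 'M[R]_(n, r)) (E' : 'M[R]_(r, n)) Rb,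
    [/\ r = \rank Cb, E' *m E = 1%:M & E *m Rb = Cb].
  have /row_fullP[E' E'E] := col_base_full Cb.
  by exists (\rank Cb), (col_base Cb), E', (row_base Cb); split=> //; exact: mulmx_base.
have EE' j : E *m E' *m G ^+ j *m H = G ^+ j *m H.
  apply/esym/eqP; rewrite -subr_eq0.
  have -> : G ^+ j *m H - E *m E' *m G ^+ j *m H = (1%:M - E *m E') *m G ^+ j *m H.
    by rewrite !mulmxBl mul1mx.
  apply/eqP; apply: power_null => {}j jn.
  have -> : (1%:M - E *m E') *m G ^+ j *m H =
      submxrow ((1%:M - E *m E') *m Cb) (Ordinal jn).
    by rewrite /Cb mul_mxrow mxrowK mulmxA.
  rewrite -CbE !mulmxA mulmxBl mul1mx -[E *m E' *m E]mulmxA E'E mulmx1 subrr.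
  by rewrite mul0mx; apply/matrixP => a b; rewrite !mxE.
have EG j : E *m ((E' *m G *m E) ^+ j *m (E' *m H)) = G ^+ j *m H.
  elim: j => [|j IH]; first by rewrite expr0 mul1mx -[RHS](EE' 0%N) expr0 mulmx1 mulmxA.
  transitivity (E *m E' *m (G *m (E *m ((E' *m G *m E) ^+ j *m (E' *m H))))).
    by rewrite exprS -[_ * _]/(_ *m _) !mulmxA.
  by rewrite IH -[RHS]EE' exprS -!mulmxA.
(* The restriction to this subspace has the same Markov parameters, so minimality bounds [n] by the
   rank. *)
have := kmin (Controller (E' *m G *m E) (E' *m H) (F *m E)).
rewrite -row_leq_rank -rE; apply => j /=.
by rewrite -kk' /= -[RHS]mulmxA -EG !mulmxA.
Qed.

(** Controllability of [k] writes each of its states as reached by some inputs; [T] sends it to the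
    state of [k'] reached by the same inputs. Equal Markov parameters make the free responses of
    both agree. *)
Lemma minimal_intertwining (k k' : controller R nu ny) : minimal_realization k k' ->
  exists T : 'M[R]_(xdim k', xdim k),
    forall j, cF k' *m cG k' ^+ j *m T = cF k *m cG k ^+ j.
Proof.
move=> kk'; have /row_freeP[N CN] := minimal_controllable kk'.
exists ((\mxrow_(j < xdim k) (cG k' ^+ j *m cH k')) *m N) => j.
rewrite mulmxA -[RHS]mulmx1 -CN mulmxA; congr (_ *m _).
rewrite !mul_mxrow; apply: eq_mxrow => i.
by rewrite !mulmxA -!(mulmxA _ (_ ^+ j)) -![_ ^+ j *m _]/(_ * _) -!exprD -kk'.1.
Qed.

End Minimal.

(** * Stability of the history loop under the eliminated gain *)

Section StabilizingGain.
Context {R : realType}.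

Lemma cvg_fro m n (M : nat -> 'M[R]_(m, n)) :
  mcvg (F := \oo) M 0 -> (fun t => fro (M t)) @ \oo --> (0 : R).
Proof.
move=> M0; rewrite -[0 in X in _ --> X](mxtrace0 R n) -(mulmx0 n (0 : 'M[R]_(m, n))^T).
by apply: cvg_mxtrace; apply: mcvg_mul => //; exact: mcvg_tr.
Qed.

(** Turns eigenvectors of the history matrix into trajectories: a mode of a shift register fed by
    [e] is a window of a geometric sequence that continues with [e]. *)
Lemma shift_mode L n c (X : 'M[R]_(blk L n, c)) (e : 'M[R]_(n, c)) (Lam : 'M[R]_c) :
  (0 < L)%N -> shift_mx L n *m X + last_mx L n *m e = X *m Lam ->
  exists x, [/\ forall t, x t.+1 = x t *m Lam, X = mstack L x 0 & e = x L].
Proof.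
move=> L0 XLam; pose x t := iter t (mulmxr Lam) (submxcol X (Ordinal L0)).
(* The blocks of [X] followed by [e]: the default branch is the value at [L]. *)
pose s t := if insub t is Some i then submxcol X i else e : 'M[R]_(n, c).
have sX (i : 'I_L) : s i = submxcol X i by rewrite /s valK.
have Xs : X = mstack L s 0 by rewrite -[LHS]submxcolK; apply: eq_mxcol => i; rewrite sX.
have sL : s L = e by rewrite /s insubN// ltnn.
have sE t : (t < L)%N -> s t.+1 = s t *m Lam.
  move=> tL; have := mstack_shift s 0 L0; rewrite add0n sL -Xs XLam Xs.
  by rewrite /mstack mxcol_mul => /eq_mxcolP/(_ (Ordinal tL)); rewrite add1n add0n.
have sx t : (t <= L)%N -> s t = x t.
  elim: t => [|t IH] tL; first by rewrite (sX (Ordinal L0)).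
  by rewrite sE// IH// ltnW.
exists x; split=> //; last by rewrite -sL sx.
by rewrite Xs; apply: eq_mxcol => i; rewrite add0n sx// ltnW.
Qed.

Lemma fro_mode m c (x : nat -> 'M[R]_(m, c)) (Lam : 'M[R]_c) (rho : R) :
  Lam *m Lam^T = rho%:M -> 1 <= rho -> (forall t, x t.+1 = x t *m Lam) ->
  forall t, fro (x 0%N) <= fro (x t).
Proof.
move=> LL rho1 xE; elim=> // t IH; rewrite xE (fro_conformal _ LL) (le_trans IH)//.
by rewrite ler_peMl// fro_ge0.
Qed.

Variables (L nx nu ny : nat) (L_gt0 : (0 < L)%N).
Variables (A : 'M[R]_nx) (B : 'M[R]_(nx, nu)) (C : 'M[R]_(ny, nx)).
Hypothesis obsA : lstep_observable L A C.
Variables k kmin : controller R nu ny.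
Hypothesis kk : minimal_realization kmin k.
Hypothesis obsK : lstep_observable L (cG kmin) (cF kmin).
Hypothesis stable : schur_stable (loop_mx A B C (cG k) (cH k) (cF k)).

Local Notation K0 := (ioh_gain L (cG kmin) (cH kmin) (cF kmin)).

(* An unstable mode of the history dynamics is a window of an unstable mode of
   the plant in feedback with [kmin], hence with [k]. *)
Lemma ioh_gain_stabilizing : stabilizing_gains L A B C K0.
Proof.
move=> l el; rewrite cnorm_lt1 ltNge; apply/negP => l1.
have [h h0 hE] := real_mode el; case/negP: h0; apply/eqP.
have LL := mode_mx_conformal l; move: (mode_mx l) LL hE => Lam LL hE.
have rho1 : 1 <= cnorm l ^+ 2 by rewrite exprn_ege1.
move: (cnorm l ^+ 2) LL rho1 => rho LL rho1.
move: hE; rewrite -[h]vsubmxK -[usubmx h]vsubmxK -[dsubmx h]vsubmxK.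
move: (usubmx (usubmx h)) (dsubmx (usubmx h)) (usubmx (dsubmx h)) (dsubmx (dsubmx h)).
move=> U Y W V; rewrite /Theta_cl /Theta !mulmxDl.
rewrite !(mul_col_mx, mul_row_col, mul_block_col, mul0mx, addr0, add0r).
rewrite -!mulmxA !(add_col_mx, addr0, add0r).
have GE : Gamma L *m col_mx (col_mx U Y) (col_mx W V) = col_mx U Y.
  by rewrite /Gamma mul_row_col mul1mx mul0mx addr0.
rewrite GE /Psi => /eq_col_mx[/eq_col_mx[eU eY] /eq_col_mx[eW eV]].
(* The noise registers are fed by zero, so a mode there vanishes at time [L]; its norm never
   decreases, so it vanishes throughout. *)
have null p (Z : 'M[R]_(blk L p, 1 + 1)) : shift_mx L p *m Z = Z *m Lam -> Z = 0.
  move=> eZ; have [|z [zE -> z0]] :=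
    shift_mode (e := 0 : 'M[R]_(p, 1 + 1)) (Lam := Lam) (X := Z) L_gt0.
    by rewrite mulmx0 addr0.
  have zz t : z t = 0.
    elim: t => [|t IH]; last by rewrite zE IH mul0mx.
    apply: fro_eq0; apply/eqP; rewrite eq_le fro_ge0 andbT.
    by rewrite (le_trans (fro_mode LL rho1 zE L))// -z0 /fro mulmx0 mxtrace0.
  by rewrite -[RHS](@mxcol0 _ L (fun=> p)); apply: eq_mxcol => i; exact: zz.
have W0 := null _ _ eW; have V0 := null _ _ eV.
have [u [uE UE uL]] := shift_mode L_gt0 eU.
have [y [yE YE yL]] := shift_mode L_gt0 eY.
have [|Yx xLam y0] := window_mode (B := B) LL rho1 obsA uE yE.
  rewrite -yL W0 V0; congr (_ *m _).
  rewrite !mul_row_col !mulmx0 !addr0 /mode_state -UE -YE /M1 /M2 /AOpinv.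
  rewrite !(mulmxDl, mulmxDr, mulmxN, mulNmx, mulmxA).
  mxring.
(* For the controller, [y] is the input and [u] the output. *)
have [|Uxi xiLam u0] := window_mode (B := cH kmin) LL rho1 obsK yE uE.
  rewrite -uL mul_row_col /mode_state -UE -YE.
  rewrite !(mulmxDl, mulmxDr, mulmxN, mulNmx, mulmxA).
  mxring.
move: (mode_state L A B C u y) xLam y0 Yx => x0 xLam y0 Yx.
move: (mode_state L (cG kmin) (cH kmin) (cF kmin) y u) xiLam u0 Uxi => xi0 xiLam u0 Uxi.
have [T TE] := minimal_intertwining kk.
pose loop := loop_mx A B C (cG k) (cH k) (cF k).
pose x t := iter t (mulmxr Lam) x0; pose xi t := iter t (mulmxr Lam) xi0.
have uxi t : u t = cF kmin *m xi t.
  by elim: t => [|t IH]; rewrite // uE IH mulmxA.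
have yx t : y t = C *m x t.
  by elim: t => [|t IH]; rewrite // yE IH mulmxA.
have x_rec t : x t.+1 = A *m x t + B *m u t.
  elim: t => [|t IH]; first by rewrite xLam.
  by rewrite -[x t.+2]/(x t.+1 *m Lam) [in LHS]IH mulmxDl -!mulmxA -uE.
have xi_rec t : xi t.+1 = cG kmin *m xi t + cH kmin *m y t.
  elim: t => [|t IH]; first by rewrite xiLam.
  by rewrite -[xi t.+2]/(xi t.+1 *m Lam) [in LHS]IH mulmxDl -!mulmxA -yE.
(* Started at the image of [xi0] under the intertwining map, [k] produces the same [u] as [kmin]. *)
pose eta := fix eta t := if t is s.+1 then cG k *m eta s + cH k *m y s else T *m xi0.
have eta_rec t : eta t.+1 = cG k *m eta t + cH k *m y t by [].
have uF t : u t = cF k *m eta t.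
  rewrite uxi -(add0n t) (linear_solution xi_rec) (linear_solution eta_rec).
  rewrite !mulmxDr !mulmxA TE; congr (_ + _); rewrite !mulmx_sumr.
  by apply: eq_bigr => j _; rewrite !mulmxA kk.1.
have zE t : col_mx (x t) (eta t) = loop ^+ t *m col_mx x0 (T *m xi0).
  elim: t => [|t IH]; first by rewrite expr0 mul1mx.
  rewrite exprS -[_ * _]/(_ *m _) -mulmxA -IH /loop /loop_mx mul_block_col x_rec eta_rec.
  by rewrite uF yx !mulmxA [X in col_mx _ X]addrC.
(* Signals of the stable loop tend to zero, while the norm of a mode with [rho >= 1] does not
   decrease. *)
have null_out p (N : 'M[R]_(p, _)) (s : nat -> 'M[R]_(p, 1 + 1)) :
    (forall t, s t.+1 = s t *m Lam) -> (forall t, s t = N *m col_mx (x t) (eta t)) ->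
    s 0%N = 0.
  move=> sLam sE; apply: fro_eq0; apply/eqP; rewrite eq_le fro_ge0 andbT.
  have s0 : mcvg (F := \oo) s 0.
    have -> : s = fun t => N *m (loop ^+ t *m col_mx x0 (T *m xi0)).
      by apply/funext => t; rewrite sE zE.
    rewrite -(mulmx0 _ N) -(mul0mx _ (col_mx x0 (T *m xi0))).
    apply: mcvg_mul; first exact: mcvg_cst.
    by apply: mcvg_mul; [exact: mcvg_pow|exact: mcvg_cst].
  apply: (cvgr_to_ge (cvg_fro s0)).
  by near=> t; exact: fro_mode LL rho1 sLam t.
have x00 : x0 = 0.
  by apply: (null_out _ (row_mx 1%:M 0) x) => // t; rewrite mul_row_col mul1mx mul0mx addr0.
have u00 : u 0%N = 0.
  by apply: (null_out _ (row_mx 0 (cF k)) u) => // t; rewrite mul_row_col mul0mx add0r.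
have stack0 p (s : nat -> 'M[R]_(p, 1 + 1)) : (forall t, s t.+1 = s t *m Lam) ->
    s 0%N = 0 -> mstack L s 0 = 0.
  move=> sLam s0; rewrite -[RHS](@mxcol0 _ L (fun=> p)); apply: eq_mxcol => i.
  by elim: (0 + i)%N => // t IH; rewrite sLam IH mul0mx.
by rewrite W0 V0 UE YE !stack0// ?y0 ?x00 ?mulmx0// !col_mx0.
Unshelve. all: by end_near. Qed.

End StabilizingGain.

(** * Second moments of the noise and of the signals *)

Section NormalSecondMoment.
Context {R : realType}.
Local Notation mu := (@lebesgue_measure R).
Variable s : R.
Hypothesis s_gt0 : 0 < s.
Local Notation p := (normal_pdf 0 s).

Let s_neq0 : s != 0. Proof. by rewrite gt_eqF. Qed.

(** Integration by parts: [F] is a primitive of [x ^+ 2 * p x - s ^+ 2 * p x], so its boundary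
    values compare the second moment with [s ^+ 2]. *)
Let F (x : R) : R := - (s ^+ 2 * x * p x).

Let pE x : p x = normal_peak s * expR (- x ^+ 2 / (s ^+ 2 *+ 2)).
Proof. by rewrite normal_pdfE// /normal_fun subr0. Qed.

Let is_derive_p (x : R) : is_derive x 1 p (- (x / s ^+ 2) * p x).
Proof.
have -> : p = (fun x => normal_peak s * expR (- x ^+ 2 / (s ^+ 2 *+ 2))).
  by apply/funext => y; rewrite pE.
apply: is_derive_eq.
rewrite /GRing.scale/= !mulr1; field.
by rewrite s_neq0.
Qed.

Let is_derive_F (x : R) : is_derive x 1 F (x ^+ 2 * p x - s ^+ 2 * p x).
Proof.
rewrite /F; have := is_derive_p x => dp.
apply: is_derive_eq.
rewrite /GRing.scale/= !mulr1; field.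
by rewrite s_neq0.
Qed.

Let continuous_p : continuous p. Proof. exact: continuous_normal_pdf. Qed.

Let continuous_F : continuous F.
Proof. by move=> x; apply/differentiable_continuous/derivable1_diffP; have [] := is_derive_F x. Qed.

Let cvg_F : F x @[x --> +oo] --> (0 : R).
Proof.
rewrite -(oppr0 R); apply: cvgN.
(* From [v <= expR v] at [v = x ^+ 2 / (s ^+ 2 *+ 2)], the density is at most
   [2 * s ^+ 2 * normal_peak s / x ^+ 2]; the factor [s ^+ 2 * x] gives this bound. *)
have cvg0 : (s ^+ 4 * 2 * normal_peak s) * x^-1 @[x --> +oo] --> (0 : R).
  rewrite -[X in _ --> X](mulr0 (s ^+ 4 * 2 * normal_peak s)).
  apply: cvgM; first exact: cvg_cst.
  by apply/gtr0_cvgV0; [near=> x; near: x; exact: nbhs_pinfty_gt|exact: cvg_id].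
apply: (squeeze_cvgr _ (cvg_cst _) cvg0).
near=> x.
have x_gt0 : 0 < x by near: x; exact: nbhs_pinfty_gt.
have pk := normal_peak_gt0 s_neq0.
apply/andP; split.
  by rewrite !mulr_ge0// ?normal_pdf_ge0// ltW// exprn_gt0.
rewrite pE mulNr expRN.
set e := expR _.
have e_ge : x ^+ 2 / (s ^+ 2 *+ 2) <= e.
  by apply: le_trans (expR_ge1Dx _); rewrite lerDr.
have e_gt0 : 0 < e by exact: expR_gt0.
rewrite -subr_ge0.
have -> : s ^+ 4 * 2 * normal_peak s / x - s ^+ 2 * x * (normal_peak s * e^-1)
  = (2 * s ^+ 4 * normal_peak s / (x * e)) * (e - x ^+ 2 / (s ^+ 2 *+ 2)).
  by field; rewrite s_neq0 !gt_eqF.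
by rewrite mulr_ge0 ?subr_ge0// !mulr_ge0// ?invr_ge0 ?mulr_ge0// ltW// exprn_gt0.
Unshelve. all: by end_near. Qed.

Let continuous_x2p : continuous (fun x : R => x ^+ 2 * p x).
Proof. by move=> x; apply: cvgM; [exact: exprn_continuous|exact: continuous_p]. Qed.

Let continuous_s2p : continuous (fun x : R => s ^+ 2 * p x).
Proof. by move=> x; apply: cvgM; [exact: cvg_cst|exact: continuous_p]. Qed.

Let mEFin (D : set R) (f : R -> R) : continuous f -> measurable_fun D (fun x => (f x)%:E).
Proof.
move=> cf; apply/measurable_EFinP; apply: measurable_funTS.
exact: continuous_measurable_fun.
Qed.

(** The cut is at [s], where [x ^+ 2 - s ^+ 2] changes sign, so that each piece has a nonnegative
    integrand. *)
Let half_line (f : R -> R) : continuous f -> (forall x, 0 <= f x) ->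
  (\int[mu]_(x in `[0%R, +oo[) (f x)%:E =
   \int[mu]_(x in `[0%R, s]) (f x)%:E + \int[mu]_(x in `[s, +oo[) (f x)%:E)%E.
Proof.
move=> cf f0.
have -> : `[0%R, +oo[%classic = `[0%R, s] `|` `]s, +oo[ :> set R.
  by rewrite -itv_bndbnd_setU// bnd_simp ltW.
rewrite ge0_integral_setU//=; last 3 first.
- exact: mEFin.
- by move=> x _; rewrite lee_fin.
- apply/disj_setPS => x /= []; rewrite !in_itv/= andbT => /andP[_ xs] sx.
  by move: (lt_le_trans sx xs); rewrite ltxx.
by rewrite integral_itv_obnd_cbnd//; exact: mEFin.
Qed.

Let integral_tail :
  (\int[mu]_(x in `[s, +oo[) (x ^+ 2 * p x)%:E =
   (s ^+ 3 * p s)%:E + \int[mu]_(x in `[s, +oo[) (s ^+ 2 * p x)%:E)%E.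
Proof.
have FTC := @ge0_continuous_FTC2y R (fun x => x ^+ 2 * p x - s ^+ 2 * p x) F s 0.
have -> : (s ^+ 3 * p s)%:E = (0%:E - (F s)%:E)%E.
  by rewrite -EFinB /F; congr EFin; ring.
have ge0 x : s <= x -> 0 <= x ^+ 2 * p x - s ^+ 2 * p x.
  move=> sx; rewrite -mulrBl mulr_ge0 ?normal_pdf_ge0// subr_ge0.
  by rewrite lerXn2r// ?nnegrE ?ltW// (lt_le_trans s_gt0).
rewrite -FTC//; last 4 first.
- apply: continuous_subspaceT => x; apply: cvgB.
    exact: continuous_x2p.
  exact: continuous_s2p.
- by move=> x _; have [] := is_derive_F x.
- by apply: cvg_at_right_filter; exact: continuous_F.
- by move=> x _; rewrite derive1E; have [_ ->] := is_derive_F x.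
rewrite -ge0_integralD//=.
- by apply: eq_integral => x _; rewrite -EFinD subrK.
- by move=> x; rewrite in_itv/= andbT lee_fin; exact: ge0.
- by apply: mEFin => x; apply: cvgB; [exact: continuous_x2p|exact: continuous_s2p].
- by move=> x _; rewrite lee_fin mulr_ge0 ?normal_pdf_ge0// ltW// exprn_gt0.
- exact: mEFin.
Qed.

Let integral_center :
  (\int[mu]_(x in `[0%R, s]) (s ^+ 2 * p x)%:E =
   (s ^+ 3 * p s)%:E + \int[mu]_(x in `[0%R, s]) (x ^+ 2 * p x)%:E)%E.
Proof.
have FTC := @continuous_FTC2 R (fun x => s ^+ 2 * p x - x ^+ 2 * p x) (- F) 0 s s_gt0.
have -> : (s ^+ 3 * p s)%:E = (((- F) s)%:E - ((- F) 0)%:E)%E.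
  by rewrite -EFinB /F /=; congr EFin; rewrite !fctE; ring.
have dNF (x : R) : is_derive x 1 (- F) (s ^+ 2 * p x - x ^+ 2 * p x).
  by have ? := is_derive_F x; apply: is_derive_eq; rewrite opprB.
have cNF : continuous (- F) by move=> x; apply: cvgN; exact: continuous_F.
rewrite -FTC//; last 3 first.
- apply: continuous_subspaceT => x; apply: cvgB.
    exact: continuous_s2p.
  exact: continuous_x2p.
- split => [x _||]; first by have [] := dNF x.
  + by apply: cvg_at_right_filter; exact: cNF.
  + by apply: cvg_at_left_filter; exact: cNF.
- by move=> x _; rewrite derive1E; have [_ ->] := dNF x.
rewrite -ge0_integralD//=.
- by apply: eq_integral => x _; rewrite -EFinD subrK.
- move=> x; rewrite in_itv/= lee_fin => /andP[x0 xs].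
  rewrite -mulrBl mulr_ge0 ?normal_pdf_ge0// subr_ge0.
  by rewrite lerXn2r// ?nnegrE// ltW.
- by apply: mEFin => x; apply: cvgB; [exact: continuous_s2p|exact: continuous_x2p].
- by move=> x _; rewrite lee_fin mulr_ge0 ?normal_pdf_ge0// exprn_even_ge0.
- exact: mEFin.
Qed.

(** The boundary term [s ^+ 3 * p s] enters the tail and the center with opposite signs, so the two
    half-line integrals agree. *)
Lemma lebesgue_integral_sqr_normal_pdf :
  (\int[mu]_x (x ^+ 2 * p x)%:E = (s ^+ 2)%:E)%E.
Proof.
have x2p0 x : 0 <= x ^+ 2 * p x by rewrite mulr_ge0 ?normal_pdf_ge0// exprn_even_ge0.
have s2p0 x : 0 <= s ^+ 2 * p x.
  by rewrite mulr_ge0 ?normal_pdf_ge0// exprn_even_ge0.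
have pN x : p (- x) = p x by rewrite !pE sqrrN.
have -> : (s ^+ 2)%:E = (\int[mu]_x (s ^+ 2 * p x)%:E)%E.
  under eq_integral do rewrite EFinM.
  by rewrite integralZl//= ?integral_normal_pdf ?mule1//; exact: integrable_normal_pdf.
rewrite !ge0_symfun_integralT//; last 2 first.
- by move=> x /=; rewrite pN.
- by move=> x /=; rewrite pN sqrrN.
congr (_ * _)%E; rewrite -set_itvcy !half_line//.
by rewrite integral_tail integral_center addeCA addeA.
Qed.

(** On a bounded interval [x ^+ 2] is integrable from the start, as the Radon-Nikodym change of
    variables requires; monotone convergence later removes the bound. *)
Let integral_sqr_normal_prob_itv (n : R) :
  (\int[normal_prob 0 s]_(x in `[(- n)%R, n]) (x ^+ 2)%:E =
   \int[mu]_(x in `[(- n)%R, n]) (x ^+ 2 * p x)%:E)%E.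
Proof.
have mU : measurable (`[(- n)%R, n] : set R) by exact: measurable_itv.
have msqr : measurable_fun (`[(- n)%R, n] : set R) (fun x : R => (x ^+ 2)%:E).
  by apply: mEFin; exact: exprn_continuous.
have dom := normal_prob_dominates (0 : R) s.
under [RHS]eq_integral do rewrite EFinM.
rewrite -(Radon_Nikodym_change_of_variables dom)//=; last first.
  apply/integrableP; split => //.
  apply: (@le_lt_trans _ _
    (\int[normal_prob 0 s]_(x in `[(- n)%R, n]) (n ^+ 2)%:E)%E).
    apply: ge0_le_integral => //=.
    - apply/measurable_EFinP; apply: measurableT_comp => //.
    - move=> x; rewrite in_itv/= => /andP[nx xn].
      rewrite lee_fin ger0_norm ?exprn_even_ge0//.
      have n0 : 0 <= n by have := le_trans nx xn; rewrite -subr_ge0 opprK; lra.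
      rewrite -[x ^+ 2]real_normK ?num_real// lerXn2r// ?nnegrE ?normr_ge0//.
      by rewrite ler_norml nx.
  rewrite integral_cst// -ge0_fin_numE ?mule_ge0 ?lee_fin ?exprn_even_ge0//.
  by rewrite fin_numM// fin_num_measure.
apply: ae_eq_integral => //.
- apply: emeasurable_funM => //; apply: (measurable_int mu).
  apply: (integrableS _ _ (@subsetT _ _)) => //=.
  by apply: Radon_Nikodym_integrable; exact: dom.
- by apply: emeasurable_funM => //; exact: mEFin.
- apply: ae_eqe_mul2l => /=.
  rewrite Radon_NikodymE/=; case: cid => /= h [h1 h2 h3].
  apply: integral_ae_eq => //=.
  + exact: integrableS h2.
  + exact: mEFin.
  + by move=> E E01 mE; rewrite -h3.
Qed.

Lemma integral_sqr_normal_prob :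
  (\int[normal_prob 0 s]_x (x ^+ 2)%:E = (s ^+ 2)%:E)%E.
Proof.
pose U (n : nat) : set R := `[(- n%:R : R), n%:R]%classic.
have ndU : nondecreasing_seq U.
  move=> m n mn; apply/subsetPset => x; rewrite /U /= !in_itv/= => /andP[mx xm].
  have mnR : (m%:R : R) <= n%:R by rewrite ler_nat.
  by rewrite (le_trans xm)// andbT (le_trans _ mx)// lerN2.
have UT : \bigcup_n U n = setT.
  apply/seteqP; split => // x _.
  exists (Num.truncn `|x|).+1 => //.
  rewrite /U /= in_itv/= -ler_norml.
  exact/ltW/truncnS_gt.
have sqr0 (x : R) : (0 <= (x ^+ 2)%:E)%E by rewrite lee_fin exprn_even_ge0.
have x2p0 (x : R) : (0 <= (x ^+ 2 * p x)%:E)%E.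
  by rewrite lee_fin mulr_ge0 ?normal_pdf_ge0// exprn_even_ge0.
have mU n : measurable (U n) by exact: measurable_itv.
have msqr n : measurable_fun (U n) (fun x : R => (x ^+ 2)%:E).
  by apply: mEFin; exact: exprn_continuous.
have cnu : (\int[normal_prob 0 s]_(x in U n) (x ^+ 2)%:E @[n --> \oo] -->
    \int[normal_prob 0 s]_(x in \bigcup_n U n) (x ^+ 2)%:E)%E.
  exact: ge0_nondecreasing_set_cvg_integral.
have cmu : (\int[mu]_(x in U n) (x ^+ 2 * p x)%:E @[n --> \oo] -->
    \int[mu]_(x in \bigcup_n U n) (x ^+ 2 * p x)%:E)%E.
  by apply: ge0_nondecreasing_set_cvg_integral => // n; exact: mEFin.
rewrite UT lebesgue_integral_sqr_normal_pdf// in cmu.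
rewrite UT in cnu.
move: cnu; under eq_fun do rewrite integral_sqr_normal_prob_itv.
move=> cnu.
exact: (cvg_unique _ cnu cmu).
Qed.

End NormalSecondMoment.

(** * Square-integrable random variables *)

Section SquareIntegrable.
Context {R : realType} {dp : measure_display} {Om : measurableType dp}.
Variable P : probability Om R.
Implicit Types f g : Om -> R.

Definition sqint f :=
  measurable_fun setT f /\ P.-integrable setT (fun om => (f om ^+ 2)%:E).

Definition expect f : R := \int[P]_om f om.

Lemma sqint_mul f g : sqint f -> sqint g ->
  P.-integrable setT (fun om => (f om * g om)%:E).
Proof.
move=> [mf intf] [mg intg].
apply: (le_integrable measurableT _ _ (integrableD measurableT intf intg)).
  by apply/measurable_EFinP; apply: measurable_funM.
move=> om _ /=; rewrite lee_fin [leRHS]ger0_norm ?addr_ge0 ?sqr_ge0//.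
rewrite ler_norml; apply/andP; split; rewrite -subr_ge0.
  have -> : f om * g om - - (f om ^+ 2 + g om ^+ 2) =
    ((f om + g om) ^+ 2 + f om ^+ 2 + g om ^+ 2) / 2 by field.
  by rewrite divr_ge0// !addr_ge0 ?sqr_ge0.
have -> : f om ^+ 2 + g om ^+ 2 - f om * g om =
  ((f om - g om) ^+ 2 + f om ^+ 2 + g om ^+ 2) / 2 by field.
by rewrite divr_ge0// !addr_ge0 ?sqr_ge0.
Qed.

Lemma sqint_cst (a : R) : sqint (cst a).
Proof.
split; first exact: measurable_cst.
exact: (finite_measure_integrable_cst P (a ^+ 2) measurableT).
Qed.

Lemma sqint_add f g : sqint f -> sqint g -> sqint (fun om => f om + g om).
Proof.
move=> sf sg; have intfg := sqint_mul sf sg.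
have [[mf intf] [mg intg]] := (sf, sg); split; first exact: measurable_funD.
have := integrableD measurableT (integrableD measurableT intf intg)
  (integrableD measurableT intfg intfg).
apply: eq_integrable => // om _; rewrite -!EFinD; congr EFin; ring.
Qed.

Lemma sqint_scale (a : R) f : sqint f -> sqint (fun om => a * f om).
Proof.
move=> [mf intf]; split; first exact: measurable_funM.
have := integrableZl measurableT (a ^+ 2) intf.
by apply: eq_integrable => // om _; rewrite -EFinM; congr EFin; ring.
Qed.

Lemma sqint_sum (I : Type) (r : seq I) (F : I -> Om -> R) :
  (forall i, sqint (F i)) -> sqint (fun om => \sum_(i <- r) F i om).
Proof.
move=> sF; elim: r => [|i r IH].
  under eq_fun do rewrite big_nil; exact: sqint_cst.
under eq_fun do rewrite big_cons; exact: sqint_add.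
Qed.

Lemma sqint_integrable f : sqint f -> P.-integrable setT (fun om => (f om)%:E).
Proof.
move=> sf; have := sqint_mul sf (sqint_cst 1).
by apply: eq_integrable => // om _; rewrite /cst mulr1.
Qed.

Lemma expectE f : P.-integrable setT (fun om => (f om)%:E) ->
  (\int[P]_om (f om)%:E = (expect f)%:E)%E.
Proof. by move=> /(integrable_fin_num measurableT) fi; rewrite /expect /Rintegral fineK. Qed.

Lemma expectD f g : P.-integrable setT (fun om => (f om)%:E) ->
  P.-integrable setT (fun om => (g om)%:E) ->
  expect (fun om => f om + g om) = expect f + expect g.
Proof. exact: RintegralD. Qed.

Lemma expectZ (a : R) f : P.-integrable setT (fun om => (f om)%:E) ->
  expect (fun om => a * f om) = a * expect f.
Proof. exact: RintegralZl. Qed.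

Lemma expect_sum (I : Type) (r : seq I) (F : I -> Om -> R) :
  (forall i, P.-integrable setT (fun om => (F i om)%:E)) ->
  expect (fun om => \sum_(i <- r) F i om) = \sum_(i <- r) expect (F i) /\
  P.-integrable setT (fun om => (\sum_(i <- r) F i om)%:E).
Proof.
move=> iF; elim: r => [|i r [IH ir]].
  rewrite big_nil; under eq_fun do rewrite big_nil.
  split; first by rewrite /expect Rintegral_cst// mul0r.
  under eq_fun do rewrite big_nil.
  exact: (finite_measure_integrable_cst P 0 measurableT).
split; last first.
  under eq_fun do rewrite big_cons EFinD.
  exact: (integrableD measurableT (iF i) ir).
under eq_fun do rewrite big_cons.
by rewrite big_cons expectD// IH.
Qed.

(** Independence makes the joint law the product of the two laws; Fubini then brings out the zero
    mean of [g]. *)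
Lemma expect_mul_indep f g : sqint f -> sqint g ->
  (forall A B : set R, measurable A -> measurable B ->
    P (f @^-1` A `&` g @^-1` B) = (P (f @^-1` A) * P (g @^-1` B))%E) ->
  expect g = 0 -> expect (fun om => f om * g om) = 0.
Proof.
move=> sf sg fg g0.
have [[mf _] [mg _]] := (sf, sg).
have ifg := sqint_mul sf sg.
pose f' : {mfun Om >-> R} := mfun_Sub (mem_set mf).
pose g' : {mfun Om >-> R} := mfun_Sub (mem_set mg).
have mh : measurable_fun setT (fun om => (f om, g om)) by exact: measurable_fun_pair.
pose h : {mfun Om >-> (R * R)%type} := mfun_Sub (mem_set mh).
pose mu := distribution P f'; pose nu := distribution P g'.
pose mn := distribution P h.
have prodE (D : set (R * R)) : measurable D -> (mu \x nu)%E D = mn D.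
  by apply: product_measure_unique => A B mA mB; exact: fg.
pose m (z : R * R) : \bar R := (z.1 * z.2)%:E.
have mm : measurable_fun setT m.
  by apply/measurable_EFinP; apply: measurable_funM.
have im : mn.-integrable setT m.
  by apply: integrable_pushforward.
have im' : (mu \x nu)%E.-integrable setT m.
  move/integrableP : im => [_ im]; apply/integrableP; split => //.
  by rewrite (eq_measure_integral mn)// => D mD _; exact: prodE.
rewrite /expect /Rintegral.
have -> : (\int[P]_om (f om * g om)%:E = \int[mn]_z m z)%E.
  by rewrite integral_pushforward.
have -> : (\int[mn]_z m z = \int[(mu \x nu)%E]_z m z)%E.
  by apply: eq_measure_integral => D mD _; exact/esym/prodE.
have ig : nu.-integrable setT (fun y => y%:E).
  apply: integrable_pushforward => //.
    by apply/measurable_EFinP.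
  by rewrite preimage_setT; exact: (sqint_integrable sg).
have nu0 : (\int[nu]_y y%:E = 0)%E.
  have -> : (\int[nu]_y y%:E = \int[P]_om (g om)%:E)%E.
    rewrite integral_pushforward ?preimage_setT//.
    exact: (sqint_integrable sg).
  by rewrite (expectE (sqint_integrable sg)) g0.
rewrite -integral12_prod_meas1//.
under eq_integral => x _.
  rewrite /fubini_F /m/=; under eq_integral do rewrite EFinM.
  rewrite integralZl// nu0 mule0.
  over.
by rewrite integral0.
Qed.

End SquareIntegrable.

(** * Second moments of random vectors *)

Section RandomVectors.
Context {R : realType} {dp : measure_display} {Om : measurableType dp}.
Variable P : probability Om R.

Definition sqintv n (Z : Om -> 'cV[R]_n) := forall i, sqint P (Defs.coord Z i).

Definition cross m n (Z : Om -> 'cV[R]_m) (Z' : Om -> 'cV[R]_n) : 'M[R]_(m, n) :=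
  \matrix_(i, j) expect P (fun om => Z om i 0 * Z' om j 0).

Lemma sqintv_mul m n (M : 'M[R]_(m, n)) Z :
  sqintv Z -> sqintv (fun om => M *m Z om).
Proof.
move=> sZ i; rewrite /Defs.coord; under eq_fun do rewrite mxE.
by apply: sqint_sum => j; apply: sqint_scale; exact: sZ.
Qed.

Lemma sqintv_add n (Z Z' : Om -> 'cV[R]_n) :
  sqintv Z -> sqintv Z' -> sqintv (fun om => Z om + Z' om).
Proof.
move=> sZ sZ' i; rewrite /Defs.coord; under eq_fun do rewrite mxE.
by apply: sqint_add; [exact: sZ|exact: sZ'].
Qed.

Lemma sqintv_mstack m L (s : Om -> nat -> 'cV[R]_m) t0 :
  (forall t, sqintv (s ^~ t)) -> sqintv (fun om => mstack L (s om) t0).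
Proof.
by move=> ss i; rewrite /Defs.coord /mstack; under eq_fun do rewrite mxE; exact: ss.
Qed.

Lemma sqintv_col m p (Z : Om -> 'cV[R]_m) (Z' : Om -> 'cV[R]_p) :
  sqintv Z -> sqintv Z' -> sqintv (fun om => col_mx (Z om) (Z' om)).
Proof.
move=> sZ sZ'.
have -> : (fun om => col_mx (Z om) (Z' om)) =
  (fun om => col_mx 1%:M 0 *m Z om + col_mx 0 1%:M *m Z' om).
  apply/funext => om.
  by rewrite !mul_col_mx !mul1mx !mul0mx add_col_mx addr0 add0r.
by apply: sqintv_add; exact: sqintv_mul.
Qed.

Lemma cross_tr m n (Z : Om -> 'cV[R]_m) (Z' : Om -> 'cV[R]_n) :
  (cross Z Z')^T = cross Z' Z.
Proof.
apply/matrixP => i j; rewrite !mxE; congr expect.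
by apply/funext => om; rewrite mulrC.
Qed.

Lemma cross_mull m n p (M : 'M[R]_(m, n)) Z (Z' : Om -> 'cV[R]_p) :
  sqintv Z -> sqintv Z' -> cross (fun om => M *m Z om) Z' = M *m cross Z Z'.
Proof.
move=> sZ sZ'; apply/matrixP => i j; rewrite !mxE.
under eq_fun do rewrite mxE mulr_suml.
have iF k : P.-integrable setT (fun om => (M i k * Z om k 0 * Z' om j 0)%:E).
  by apply: sqint_mul (sZ' j); apply: sqint_scale; exact: sZ.
have [-> _] := expect_sum (index_enum 'I_n) iF.
apply: eq_bigr => k _; rewrite mxE -expectZ//; last exact: sqint_mul (sZ k) (sZ' j).
by congr expect; apply/funext => om; rewrite mulrA.
Qed.

Lemma crossDl m n (Z1 Z2 : Om -> 'cV[R]_m) (Z : Om -> 'cV[R]_n) :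
  sqintv Z1 -> sqintv Z2 -> sqintv Z ->
  cross (fun om => Z1 om + Z2 om) Z = cross Z1 Z + cross Z2 Z.
Proof.
move=> s1 s2 sZ; apply/matrixP => i j; rewrite !mxE.
rewrite -expectD; [|exact: sqint_mul (s1 i) (sZ j)|exact: sqint_mul (s2 i) (sZ j)].
by congr expect; apply/funext => om; rewrite mxE mulrDl.
Qed.

Lemma cross_mulr m n p (M : 'M[R]_(m, n)) Z (Z' : Om -> 'cV[R]_p) :
  sqintv Z -> sqintv Z' -> cross Z' (fun om => M *m Z om) = cross Z' Z *m M^T.
Proof. by move=> sZ sZ'; rewrite -cross_tr cross_mull// trmx_mul cross_tr. Qed.

Lemma crossDr m n (Z1 Z2 : Om -> 'cV[R]_m) (Z : Om -> 'cV[R]_n) :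
  sqintv Z1 -> sqintv Z2 -> sqintv Z ->
  cross Z (fun om => Z1 om + Z2 om) = cross Z Z1 + cross Z Z2.
Proof. by move=> s1 s2 sZ; rewrite -cross_tr crossDl// linearD/= !cross_tr. Qed.

Lemma quadE n (W : 'M[R]_n) (v : 'cV[R]_n) :
  quad W v = \sum_i \sum_j W i j * (v j 0 * v i 0).
Proof.
rewrite /quad mxE; under eq_bigr do rewrite mxE mulr_suml.
rewrite exchange_big/=; apply: eq_bigr => i _; apply: eq_bigr => j _.
by rewrite !mxE; ring.
Qed.

Lemma expect_quad n (W : 'M[R]_n) Z : sqintv Z ->
  expect P (fun om => quad W (Z om)) = \tr (W *m cross Z Z) /\
  P.-integrable setT (fun om => (quad W (Z om))%:E).
Proof.
move=> sZ.
have iF i j : P.-integrable setT (fun om => (W i j * (Z om j 0 * Z om i 0))%:E).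
  have := integrableZl measurableT (W i j) (sqint_mul (sZ j) (sZ i)).
  by apply: eq_integrable.
have S i := expect_sum (index_enum 'I_n) (iF i).
have [S2 I2] := expect_sum (index_enum 'I_n) (fun i => (S i).2).
split; last by under eq_fun do rewrite quadE.
under eq_fun do rewrite quadE.
rewrite S2 /mxtrace; apply: eq_bigr => i _.
rewrite (S i).1 mxE; apply: eq_bigr => j _.
by rewrite mxE expectZ//; exact: sqint_mul (sZ j) (sZ i).
Qed.

Lemma cross_psd n (Z : Om -> 'cV[R]_n) : sqintv Z -> psdmx (cross Z Z).
Proof.
move=> sZ; split=> [|v]; first exact: cross_tr.
have sv : sqintv (fun om => v^T *m Z om) by exact: sqintv_mul.
have [E _] := expect_quad 1%:M sv.
have -> : quad (cross Z Z) v = expect P (fun om => quad 1%:M (v^T *m Z om)).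
  rewrite E mul1mx cross_mull// cross_mulr// trmxK mulmxA.
  by rewrite /quad /mxtrace big_ord1.
apply: Rintegral_ge0 => om _.
rewrite /quad mulmx1 mxE; apply: sumr_ge0 => i _.
by rewrite mxE -expr2 sqr_ge0.
Qed.

Section Gaussian.
Variables (n : nat) (V : 'M[R]_n) (X : Om -> 'cV[R]_n).
Hypothesis V_psd : psdmx V.
Hypothesis X_gaussian : gaussian P V X.

Let lin (a : 'cV[R]_n) om := (a^T *m X om) 0 0.

Let linE a om : lin a om = \sum_i a i 0 * X om i 0.
Proof. by rewrite /lin mxE; apply: eq_bigr => i _; rewrite mxE. Qed.

Let measurable_lin a : measurable_fun setT (lin a).
Proof.
have -> : lin a = fun om => \sum_i a i 0 * X om i 0.
  by apply/funext => om; rewrite linE.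
apply: measurable_sum => i.
apply: measurable_funM; first exact: measurable_cst.
exact: X_gaussian.1.
Qed.

Let integral_sqr_lin a : (\int[P]_om (lin a om ^+ 2)%:E = (quad V a)%:E)%E.
Proof.
have mlin : @measurable_fun _ _ Om (measurableTypeR R) setT (lin a) by exact: measurable_lin.
pose f : {mfun Om >-> measurableTypeR R} :=
  @mfun_Sub _ _ Om (measurableTypeR R) (lin a) (mem_set mlin).
have msqr : measurable_fun setT (fun x : measurableTypeR R => (x ^+ 2)%:E).
  by apply/measurable_EFinP; exact: exprn_measurable.
have -> : (\int[P]_om (lin a om ^+ 2)%:E = \int[distribution P f]_x (x ^+ 2)%:E)%E.
  by rewrite ge0_integral_distribution// => y; rewrite lee_fin sqr_ge0.
have law D : measurable D -> distribution P f D = (if quad V a == 0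
    then \d_(0 : measurableTypeR R) D else normal_prob 0 (Num.sqrt (quad V a)) D).
  by move=> mD; exact: (X_gaussian.2 a D mD).
have V0 : 0 <= quad V a by exact: V_psd.2.
have [q0|q0] := eqVneq (quad V a) 0.
  rewrite (@eq_measure_integral _ (measurableTypeR R) R setT
    (\d_(0 : measurableTypeR R)))//; last first.
    by move=> D mD _; have := law D mD; rewrite q0 eqxx.
  by rewrite integral_dirac// diracT mul1e q0 expr2 mulr0.
have -> : (\int[distribution P f]_x (x ^+ 2)%:E =
    \int[normal_prob 0 (Num.sqrt (quad V a))]_x (x ^+ 2)%:E)%E.
  by apply: eq_measure_integral => D mD _; have := law D mD; rewrite (negbTE q0).
rewrite integral_sqr_normal_prob ?sqr_sqrtr//.
by rewrite sqrtr_gt0 lt_neqAle eq_sym q0.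
Qed.

Lemma sqint_gaussian_lin a : sqint P (lin a).
Proof.
split; first exact: measurable_lin.
apply/integrableP; split.
  by apply/measurable_EFinP; apply: measurable_funX; exact: measurable_lin.
under eq_integral => om _ do rewrite gee0_abs ?lee_fin ?sqr_ge0//.
by rewrite integral_sqr_lin ltry.
Qed.

Let lin_delta i : lin (delta_mx i 0) = Defs.coord X i.
Proof.
apply/funext => om; rewrite linE (bigD1 i)//= big1 ?addr0 => [|j ji].
  by rewrite mxE !eqxx mul1r.
by rewrite mxE (negbTE ji) mul0r.
Qed.

Lemma sqintv_gaussian : sqintv X.
Proof. by move=> i; rewrite -lin_delta; exact: sqint_gaussian_lin. Qed.

Let expect_sqr_lin a : expect P (fun om => lin a om ^+ 2) = quad V a.
Proof. by rewrite /expect /Rintegral integral_sqr_lin. Qed.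

(** Polarization of the variances of the functionals [lin a]. *)
Lemma cross_gaussian : cross X X = V.
Proof.
have bil a b : expect P (fun om => lin a om * lin b om) = (a^T *m V *m b) 0 0.
  have sq : expect P (fun om => lin (a + b) om ^+ 2) = quad V a + quad V b +
      2 * expect P (fun om => lin a om * lin b om).
    have sa := sqint_gaussian_lin a; have sb := sqint_gaussian_lin b.
    rewrite -expectZ; last exact: sqint_mul.
    rewrite -!expect_sqr_lin -expectD; [|exact: sa.2|exact: sb.2].
    rewrite -expectD; last 2 first.
    - exact: (integrableD measurableT sa.2 sb.2).
    - have := integrableZl measurableT 2 (sqint_mul sa sb).
      by apply: eq_integrable.
    congr expect; apply/funext => om.
    have -> : lin (a + b) om = lin a om + lin b om.
      by rewrite /lin linearD/= mulmxDl mxE.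
    by ring.
  have sym : (b^T *m V *m a) 0 0 = (a^T *m V *m b) 0 0.
    have -> : b^T *m V *m a = (a^T *m V *m b)^T.
      by rewrite !trmx_mul trmxK V_psd.1 mulmxA.
    by rewrite mxE.
  have D11 (M N : 'M[R]_1) : (M + N) 0 0 = M 0 0 + N 0 0 by rewrite mxE.
  have trD : (a + b)^T = a^T + b^T by rewrite linearD.
  move: sq; rewrite expect_sqr_lin /quad trD.
  rewrite !mulmxDl !mulmxDr !D11 sym; lra.
apply/matrixP => i j; rewrite mxE.
have -> : V i j = ((delta_mx i 0)^T *m V *m delta_mx j 0 : 'M[R]_1) 0 0.
  by rewrite trmx_delta -rowE -colE !mxE.
by rewrite -bil !lin_delta.
Qed.

(** [lin a] and [lin (- a)] have the same law, so the mean equals its opposite. *)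
Lemma expect_gaussian i : expect P (Defs.coord X i) = 0.
Proof.
have mlin a : @measurable_fun _ _ Om (measurableTypeR R) setT (lin a).
  exact: measurable_lin.
pose f a : {mfun Om >-> measurableTypeR R} :=
  @mfun_Sub _ _ Om (measurableTypeR R) (lin a) (mem_set (mlin a)).
have mE : measurable_fun setT (EFin : measurableTypeR R -> \bar R).
  by apply/measurable_EFinP.
have lawE a : (\int[P]_om (lin a om)%:E = \int[distribution P (f a)]_x x%:E)%E.
  rewrite integral_distribution//.
  exact: (sqint_integrable (sqint_gaussian_lin a)).
pose a : 'cV[R]_n := delta_mx i 0.
have trN : (- a)^T = - a^T by rewrite linearN.
have qN : quad V (- a) = quad V a.
  by rewrite /quad trN mulNmx mulmxN mulNmx opprK.
have EN : (\int[P]_om (lin (- a) om)%:E = \int[P]_om (lin a om)%:E)%E.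
  rewrite !lawE; apply: eq_measure_integral => D mD _.
  have := X_gaussian.2 (- a) D mD; rewrite qN -(X_gaussian.2 a D mD); exact.
have lN : lin (- a) = fun om => -1 * lin a om.
  by apply/funext => om; rewrite /lin trN mulNmx mxE mulN1r.
have ia := sqint_integrable (sqint_gaussian_lin a).
have : expect P (lin (- a)) = expect P (lin a) by rewrite /expect /Rintegral EN.
by rewrite lN expectZ// -/a lin_delta; lra.
Qed.

End Gaussian.
End RandomVectors.

(** * Vectors uncorrelated with future noise *)

Section Uncorrelated.
Context {R : realType} {dp : measure_display} {Om : measurableType dp}.
Variable P : probability Om R.
Context {n : nat} (V : 'M[R]_n) (d : nat -> Om -> 'cV[R]_n).
Hypothesis V_psd : psdmx V.
Hypothesis d_iid : iid_gaussian P V d.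

Lemma sqintv_noise t : sqintv P (d t).
Proof. exact: sqintv_gaussian V_psd (d_iid.1 t). Qed.

Lemma cross_noise t : cross P (d t) (d t) = V.
Proof. exact: cross_gaussian V_psd (d_iid.1 t). Qed.

(** The second-order trace of independence from future noise: it is stable under linear maps and
    sums, and it makes the cross terms of [uncorr_step] vanish. *)
Definition uncorr L m (Z : Om -> 'cV[R]_m) :=
  sqintv P Z /\ forall t, (L <= t)%N -> cross P Z (d t) = 0.

Lemma events_coord m (Z : Om -> 'cV[R]_m) i (D : set R) :
  measurable D -> events Z (Defs.coord Z i @^-1` D).
Proof. by move=> mD; exists i, D. Qed.

Lemma uncorr_noise L s : (s < L)%N -> uncorr L (d s).
Proof.
move=> sL; split=> [|t Lt]; first exact: sqintv_noise.
have st : s != t by rewrite neq_ltn (leq_trans sL Lt).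
apply/matrixP => i j; rewrite mxE [RHS]mxE.
apply: expect_mul_indep; [exact: sqintv_noise|exact: sqintv_noise| |].
  move=> A B mA mB.
  pose E u := if u == s then Defs.coord (d s) i @^-1` A
                        else Defs.coord (d t) j @^-1` B.
  have Es : E s = Defs.coord (d s) i @^-1` A by rewrite /E eqxx.
  have Et : E t = Defs.coord (d t) j @^-1` B by rewrite /E eq_sym (negbTE st).
  have := d_iid.2 [:: s; t] E.
  rewrite /= inE st => /(_ isT); rewrite big_cons big_seq1 Es Et => <-; last first.
    move=> u; rewrite !inE => /orP[|] /eqP ->.
      by rewrite Es; apply: sub_sigma_algebra; exact: events_coord.
    by rewrite Et; apply: sub_sigma_algebra; exact: events_coord.
  congr (P _); rewrite -Es -Et; apply/seteqP; split => om.
    by move=> [h1 h2] u /=; rewrite !inE => /orP[|] /eqP ->.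
  move=> h; split; apply: h; rewrite /= !inE eqxx ?orbT//.
exact: expect_gaussian V_psd (d_iid.1 t) j.
Qed.

Lemma uncorr_admissible L m (Z : Om -> 'cV[R]_m) :
  admissible P d L Z -> uncorr L Z.
Proof.
move=> [mZ sZ iZ]; have sqZ : sqintv P Z by move=> i; split; [exact: mZ|exact: sZ].
split=> // t Lt; apply/matrixP => i j; rewrite mxE [RHS]mxE.
apply: expect_mul_indep; [exact: sqZ|exact: sqintv_noise| |].
  move=> A B mA mB; apply: iZ; apply: sub_sigma_algebra.
    by left; exact: events_coord.
  by exists t => //; exact: events_coord.
exact: expect_gaussian V_psd (d_iid.1 t) j.
Qed.

Lemma uncorr_mul L m p (M : 'M[R]_(m, p)) Z :
  uncorr L Z -> uncorr L (fun om => M *m Z om).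
Proof.
move=> [sZ cZ]; split=> [|t Lt]; first exact: sqintv_mul.
by rewrite cross_mull// ?cZ ?mulmx0//; exact: sqintv_noise.
Qed.

Lemma uncorr_add L m (Z Z' : Om -> 'cV[R]_m) :
  uncorr L Z -> uncorr L Z' -> uncorr L (fun om => Z om + Z' om).
Proof.
move=> [sZ cZ] [sZ' cZ']; split=> [|t Lt]; first exact: sqintv_add.
by rewrite crossDl// ?cZ ?cZ' ?addr0//; exact: sqintv_noise.
Qed.

Lemma uncorr_cst0 L m : uncorr L (fun=> 0 : 'cV[R]_m).
Proof.
split=> [i|t Lt].
  by rewrite /Defs.coord; under eq_fun do rewrite mxE; exact: sqint_cst.
apply/matrixP => i j; rewrite mxE [RHS]mxE /expect.
under eq_fun do rewrite mxE mul0r.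
by rewrite Rintegral_cst// mul0r.
Qed.

Lemma uncorrW L L' m (Z : Om -> 'cV[R]_m) : (L <= L')%N -> uncorr L Z -> uncorr L' Z.
Proof. by move=> LL' [sZ cZ]; split=> // t L't; apply: cZ; exact: leq_trans L't. Qed.

Lemma uncorr_stack L m k (s : nat -> Om -> 'cV[R]_m) t0 :
  (forall i, (i < k)%N -> uncorr L (s (t0 + i)%N)) ->
  uncorr L (fun om => stack k (s ^~ om) t0).
Proof.
move=> us; split=> [i|t Lt].
  rewrite /Defs.coord /stack; under eq_fun do rewrite mxE.
  exact: (us _ (ltn_ord _)).1.
apply/matrixP => i j; rewrite mxE [RHS]mxE.
have [_ /(_ t Lt)/matrixP/(_ (tagnat.sig2 i) j)] := us _ (ltn_ord (tagnat.sig1 i)).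
by rewrite mxE [RHS]mxE => <-; congr expect; apply/funext => om; rewrite mxE.
Qed.

Lemma uncorr_col L m p (Z : Om -> 'cV[R]_m) (Z' : Om -> 'cV[R]_p) :
  uncorr L Z -> uncorr L Z' -> uncorr L (fun om => col_mx (Z om) (Z' om)).
Proof.
move=> uZ uZ'.
have -> : (fun om => col_mx (Z om) (Z' om)) =
  (fun om => col_mx 1%:M 0 *m Z om + col_mx 0 1%:M *m Z' om).
  apply/funext => om.
  by rewrite !mul_col_mx !mul1mx !mul0mx add_col_mx addr0 add0r.
by apply: uncorr_add; exact: uncorr_mul.
Qed.

Lemma uncorr_step L m p (Phi : 'M[R]_(p, m)) (Gam : 'M[R]_(p, n)) Z :
  uncorr L Z ->
  uncorr L.+1 (fun om => Phi *m Z om + Gam *m d L om) /\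
  cross P (fun om => Phi *m Z om + Gam *m d L om)
          (fun om => Phi *m Z om + Gam *m d L om) =
    Phi *m cross P Z Z *m Phi^T + Gam *m V *m Gam^T.
Proof.
move=> uZ; split.
  by apply: uncorr_add; apply: uncorr_mul; [exact: uncorrW uZ|exact: uncorr_noise].
have [sZ cZ] := uZ; have sd := sqintv_noise L.
have s1 := sqintv_mul Phi sZ; have s2 := sqintv_mul Gam sd.
rewrite crossDl ?crossDr//; last exact: sqintv_add.
rewrite !cross_mull// !cross_mulr// cross_noise cZ//.
by rewrite -(cross_tr P Z (d L)) cZ// trmx0 !mul0mx !mulmx0 addr0 add0r !mulmxA.
Qed.

End Uncorrelated.

(** * Average costs *)

Section AverageCost.
Context {R : realType} {dp : measure_display} {Om : measurableType dp}.
Variable P : probability Om R.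
Context {ny nu : nat}.
Variables (Q : 'M[R]_ny) (Wu : 'M[R]_nu).
Variables (y : nat -> Om -> 'cV[R]_ny) (u : nat -> Om -> 'cV[R]_nu).
Variables (t0 L : nat).
Hypotheses (L_gt0 : (0 < L)%N) (t0L : (t0 <= L)%N).
Hypotheses (sqy : forall t, (t0 <= t)%N -> sqintv P (y t))
  (squ : forall t, (t0 <= t)%N -> sqintv P (u t)).
Hypotheses (posQ : posdefmx Q) (posWu : posdefmx Wu).

Definition mean_cost t : R := expect P (fun om => quad Q (y t om) + quad Wu (u t om)).

Lemma mean_costE t : (t0 <= t)%N ->
  mean_cost t = \tr (Q *m cross P (y t) (y t)) + \tr (Wu *m cross P (u t) (u t)).
Proof.
move=> tt; have [ey iy] := expect_quad Q (sqy tt); have [eu iu] := expect_quad Wu (squ tt).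
by rewrite /mean_cost expectD// ey eu.
Qed.

Lemma mean_cost_ge0 t : 0 <= mean_cost t.
Proof.
apply: Rintegral_ge0 => om _; apply: addr_ge0; first exact: (posdef_psd posQ).2.
exact: (posdef_psd posWu).2.
Qed.

Let total T := \sum_(t0 <= t < T.+1) mean_cost t.

Let average_costE : average_cost P Q Wu t0 y u =
  limn (fun T : nat => (T%:R^-1 * total T)%:E).
Proof.
rewrite /average_cost; congr (limn _); apply/funext => T.
have iq t : (t0 <= t)%N -> P.-integrable setT
    (fun om => (quad Q (y t om) + quad Wu (u t om))%:E).
  move=> tt; have [_ iy] := expect_quad Q (sqy tt); have [_ iu] := expect_quad Wu (squ tt).
  exact: (integrableD measurableT iy iu).
have tE (F : nat -> R) : \sum_(t0 <= t < T.+1) F t = \sum_(0 <= i < T.+1 - t0) F (i + t0)%N.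
  by rewrite -[in LHS](add0n t0) big_addn.
have [es its] := expect_sum (P := P) (index_iota 0 (T.+1 - t0))
  (fun i => iq (i + t0)%N (leq_addl i t0)).
rewrite /total tE -es -(expectZ _ its) unlock -expectE; last first.
  by have := integrableZl measurableT (T%:R^-1) its.
by congr (integral _ _ _); apply/funext => om; rewrite tE.
Qed.

Local Notation late := (fun s => mean_cost (L + s)).

Let head := \sum_(t0 <= t < L) mean_cost t.

Let head_ge0 : 0 <= head.
Proof. by apply: sumr_ge0 => t _; exact: mean_cost_ge0. Qed.

(** [average_cost] divides by [T] a sum that includes the term at [T]. For [T = m + L - 1] this sum
    is the head below [L] and exactly [m] late terms. *)
Let shifted m : (m + L.-1)%:R^-1 * total (m + L.-1) =
  (m + L.-1)%:R^-1 * head + (1 - L.-1%:R / (m + L.-1)%:R) * mean late m.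
Proof.
rewrite /total -addnS prednK// (@big_cat_nat _ _ _ L)//= ?leq_addl// -/head mulrDr; congr (_ + _).
rewrite -[in LHS](add0n L) big_addn addnK big_mkord.
have [->|m0] := posnP m; first by rewrite /mean !big_ord0 !mulr0.
under eq_bigr do rewrite addnC.
rewrite /mean; move: (\sum_(i < m) _) => c.
have mR : (m%:R : R) != 0 by rewrite pnatr_eq0 -lt0n.
have nR : ((m + L.-1)%:R : R) != 0 by rewrite pnatr_eq0 -lt0n addn_gt0 m0.
have -> : 1 - L.-1%:R / (m + L.-1)%:R = m%:R / (m + L.-1)%:R :> R.
  by rewrite -[X in X - _](divff nR) -mulrBl natrD addrK.
move: (m%:R : R) mR ((m + L.-1)%:R : R) nR => n nR k kR.
by field; rewrite kR nR.
Qed.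

Lemma average_cost_cvg l : mean late @ \oo --> l ->
  average_cost P Q Wu t0 y u = l%:E.
Proof.
move=> ql; rewrite average_costE; apply/cvg_lim => //; apply: cvg_EFin; first exact: nearW.
rewrite -(cvg_shiftn L.-1); under eq_fun do rewrite /= shifted.
have nV : (m + L.-1)%:R^-1 @[m --> \oo] --> (0 : R).
  by rewrite (cvg_shiftn L.-1 (fun m => m%:R^-1 : R)); exact: cvg_natV.
rewrite -[l]add0r -[X in X + _](mul0r head) -[l]mul1r.
apply: cvgD; first exact: cvgMl.
apply: cvgM => //; rewrite -[X in _ --> X]subr0 -(mulr0 (L.-1%:R : R)).
by apply: cvgB; [exact: cvg_cst|exact: cvgMr].
Qed.

Lemma average_cost_cvgy : mean late @ \oo --> +oo ->
  average_cost P Q Wu t0 y u = +oo%E.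
Proof.
move=> ql; rewrite average_costE; apply/cvg_lim => //; apply/cvgeryP.
rewrite -(cvg_shiftn L.-1).
have LR : 0 < (L%:R : R) by rewrite ltr0n.
(* The factor of [mean late m] is [m / (m + L - 1)], which is at least [1 / L] for [m > 0]. *)
apply: (@ger_cvgy _ _ _ _ (fun m => L%:R^-1 * mean late m)).
  near=> m; rewrite /= shifted.
  have m0 : (0 < m)%N by near: m; exists 1%N.
  have q0 : 0 <= mean late m.
    by apply: mulr_ge0 => //; apply: sumr_ge0 => t _; exact: mean_cost_ge0.
  apply: ler_wpDl; first exact: mulr_ge0.
  apply: ler_wpM2r => //.
  have nR : 0 < ((m + L.-1)%:R : R) by rewrite ltr0n addn_gt0 m0.
  rewrite lerBrDr -lerBrDl ler_pdivrMr// -(ler_pM2l LR) mulrA mulrBr mulr1 divff ?gt_eqF//.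
  have -> : (L%:R : R) - 1 = L.-1%:R by rewrite -[in LHS](prednK L_gt0) -addn1 natrD addrK.
  rewrite -!natrM ler_nat mulnC leq_mul2l -(prednK m0) addSn -addnS prednK//.
  by rewrite leq_addl orbT.
move/cvgryPge : ql => ql; apply/cvgryPge => M.
by apply: filterS (ql (L%:R * M)) => m h; rewrite ler_pdivlMl.
Unshelve. all: by end_near. Qed.

End AverageCost.

(** * Costs of controller loops and history loops *)

Section ControllerCost.
Context {R : realType} {nx nu ny L : nat}.
Variables (A : 'M[R]_nx) (B : 'M[R]_(nx, nu)) (C : 'M[R]_(ny, nx)).
Variables (Vw : 'M[R]_nx) (Vv Q : 'M[R]_ny) (Wu : 'M[R]_nu).
Context {dp : measure_display} {Om : measurableType dp}.
Variable P : probability Om R.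
Variable d : nat -> Om -> 'cV[R]_(nx + ny).
Hypothesis L_gt0 : (0 < L)%N.
Hypothesis psdV : psdmx (block_mx Vw 0 0 Vv).
Hypothesis posVv : posdefmx Vv.
Hypothesis d_iid : iid_gaussian P (block_mx Vw 0 0 Vv) d.
Hypotheses (posQ : posdefmx Q) (posWu : posdefmx Wu).
Variables (X Y : 'M[R]_nx).
Hypotheses (stdX : standard_dare_solution A B (C^T *m Q *m C) Wu X)
  (stdY : standard_dare_solution A^T C^T Vw Vv Y).

Local Notation J := (lqg_cost A B Vw Vv Q Wu X Y).

Let psdVw : psdmx Vw. Proof. exact: psdmx_block_diag_ul psdV. Qed.

Section Loop.
Variables (k : controller R nu ny) (xi0 : Om -> 'cV[R]_(xdim k)).
Hypothesis uxi0 : uncorr P d L xi0.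

Local Notation y := (fun t om => s_y A B C (d ^~ om) (xi0 om) t).
Local Notation u := (fun t om => s_u A B C (d ^~ om) (xi0 om) t).
Local Notation Phi := (loop_mx A B C (cG k) (cH k) (cF k)).
Local Notation Gam := (block_mx 1%:M 0 0 (cH k)).

Definition loop_state t om := col_mx (s_x A B C (d ^~ om) (xi0 om) t)
  (s_xi A B C (d ^~ om) (xi0 om) t).
Local Notation Z := loop_state.

Lemma loop_state_rec t : Z t.+1 = fun om => Phi *m Z t om + Gam *m d t om.
Proof.
apply/funext => om; rewrite /loop_state s_x_rec s_xi_rec -[d t om]vsubmxK.
rewrite /loop_mx !mul_block_col !mul0mx !add0r addr0 mul1mx add_col_mx.
rewrite /s_u /s_y mulmxDr !mulmxA; congr col_mx.
by rewrite addrA; congr (_ + _); rewrite addrC.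
Qed.

Lemma uncorr_state_early t : (t <= L)%N -> uncorr P d L (Z t).
Proof.
elim: t => [|t IH] tL.
  by apply: (uncorr_col psdV d_iid); [exact: uncorr_cst0|exact: uxi0].
rewrite loop_state_rec.
apply: (uncorr_add psdV d_iid); apply: (uncorr_mul psdV d_iid); first exact/IH/ltnW.
exact: (uncorr_noise psdV d_iid tL).
Qed.

Lemma uncorr_state s : uncorr P d (L + s) (Z (L + s)%N).
Proof.
elim: s => [|s IH]; first by rewrite addn0; exact: uncorr_state_early.
by rewrite addnS loop_state_rec; exact: (uncorr_step psdV d_iid Phi Gam IH).1.
Qed.

(** Counted from time [L]: before it the state may be correlated with the noise, and the covariance
    recursion may fail. *)
Definition loop_moment s := cross P (Z (L + s)%N) (Z (L + s)%N).
Local Notation S := loop_moment.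

Lemma loop_moment_rec s : S s.+1 = Phi *m S s *m Phi^T + loop_noise Vw Vv (cH k).
Proof.
rewrite /loop_moment addnS loop_state_rec (uncorr_step psdV d_iid Phi Gam (uncorr_state s)).2.
congr (_ + _); rewrite tr_block_mx !mulmx_block /loop_noise.
by rewrite !(trmx0, trmx1, mulmx0, mul0mx, mul1mx, mulmx1, addr0, add0r).
Qed.

Lemma loop_moment_psd0 : psdmx (S 0%N).
Proof. exact: cross_psd (uncorr_state 0).1. Qed.

Let yE t : y t = fun om => row_mx C 0 *m Z t om + row_mx 0 1%:M *m d t om.
Proof.
apply/funext => om; rewrite /Z mul_row_col mul0mx addr0 -[d t om]vsubmxK mul_row_col.
by rewrite mul0mx mul1mx add0r.
Qed.

Let uE t : u t = fun om => row_mx 0 (cF k) *m Z t om.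
Proof. by apply/funext => om; rewrite /Z mul_row_col mul0mx add0r. Qed.

Lemma sqintv_state t : sqintv P (Z t).
Proof.
have [tL|/ltnW Lt] := leqP t L; first exact: (uncorr_state_early tL).1.
by rewrite -(subnKC Lt); exact: (uncorr_state _).1.
Qed.

Lemma sqintv_s_y t : sqintv P (y t).
Proof.
rewrite /= yE; apply: sqintv_add; apply: sqintv_mul; first exact: sqintv_state.
exact: (sqintv_noise psdV d_iid).
Qed.

Lemma sqintv_s_u t : sqintv P (u t).
Proof. by rewrite /= uE; apply: sqintv_mul; exact: sqintv_state. Qed.

Definition late_cost s := mean_cost P Q Wu y u (L + s).

Lemma late_costE : late_cost = loop_cost C Vv Q Wu (cF k) S.
Proof.
apply/funext => s; rewrite /late_cost (@mean_costE _ _ _ _ _ _ _ _ _ _ 0%N) //; last 2 first.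
- by move=> t _; exact: sqintv_s_y.
- by move=> t _; exact: sqintv_s_u.
rewrite /= yE (uncorr_step psdV d_iid (row_mx C 0) (row_mx 0 1%:M) (uncorr_state s)).2.
have sZ := sqintv_state (L + s); have sFZ := sqintv_mul (row_mx 0 (cF k)) sZ.
rewrite uE cross_mull ?cross_mulr//.
rewrite -/(loop_moment s) /loop_cost /loop_weight.
rewrite [X in Wu *m X]mulmxA -[loop_moment s]submxK !tr_row_mx.
rewrite !(mul_row_block, mulmx_block, mul_row_col) mxtrace_block.
rewrite !(trmx0, trmx1, mulmx0, mul0mx, mul1mx, mulmx1, addr0, add0r).
rewrite !mulmxDr !mxtraceD addrAC; congr (_ + _ + _).
  by rewrite -!mulmxA [RHS]mxtrace_mulC !mulmxA.
by rewrite -!mulmxA [RHS]mxtrace_mulC !mulmxA.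
Qed.

Lemma late_cost_ge : avg_ge late_cost J.
Proof.
rewrite late_costE => e.
exact: (loop_cost_lower psdVw posVv posQ posWu stdX stdY loop_moment_rec loop_moment_psd0).
Qed.

(** In both cases the averages converge, so the [limn] in the cost is a genuine limit and inherits
    lower bounds. *)
Lemma s_cost_cases :
  (exists l, mean late_cost @ \oo --> l /\ s_cost P A B C Q Wu d xi0 = l%:E) \/
  mean late_cost @ \oo --> +oo /\ s_cost P A B C Q Wu d xi0 = +oo%E.
Proof.
have [] := cesaro_linrec (q := late_cost).
- by move=> s; exact: mean_cost_ge0.
- by rewrite late_costE; exact: lyapunov_linrec loop_moment_rec.
- move=> [l ql]; left; exists l; split=> //.
  by apply: (average_cost_cvg L_gt0) ql => // t _; [exact: sqintv_s_y|exact: sqintv_s_u].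
- move=> ql; right; split=> //.
  by apply: (average_cost_cvgy L_gt0) ql => // t _; [exact: sqintv_s_y|exact: sqintv_s_u].
Qed.

Lemma s_cost_ge : (J%:E <= s_cost P A B C Q Wu d xi0)%E.
Proof.
have [[l [ql ->]]|[_ ->]] := s_cost_cases; last exact: leey.
by rewrite lee_fin; exact: lim_mean_ge late_cost_ge ql.
Qed.

Lemma s_cost_eq : avg_le late_cost J -> s_cost P A B C Q Wu d xi0 = J%:E.
Proof.
move=> ql; apply: (average_cost_cvg L_gt0) => //.
- by move=> t _; exact: sqintv_s_y.
- by move=> t _; exact: sqintv_s_u.
- exact: cvg_mean_avg late_cost_ge ql.
Qed.

End Loop.

Section LqgLoop.
Local Notation klqg := (lqg_controller A B C Wu Vv X Y).
Variable xi0 : Om -> 'cV[R]_(xdim klqg).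
Hypothesis uxi0 : uncorr P d L xi0.

Lemma lqg_late_cost_le : avg_le (late_cost xi0) J.
Proof.
rewrite late_costE//; apply: (lqg_loop_cost_le psdVw posVv posWu stdX stdY).
  exact: (loop_moment_rec uxi0).
exact: (loop_moment_psd0 uxi0).
Qed.

Lemma lqg_s_cost : s_cost P A B C Q Wu d xi0 = J%:E.
Proof. exact: s_cost_eq uxi0 lqg_late_cost_le. Qed.

End LqgLoop.

Section IohLoop.
Hypothesis obsA : lstep_observable L A C.
Variable uini : nat -> Om -> 'cV[R]_nu.
Hypothesis uini_adm : admissible P d L (fun om => stack L (uini ^~ om) 0).
Variable K : 'M[R]_(nu, nz L nu ny).

Definition ioh_start om : 'cV[R]_(xdim (ioh_controller K)) :=
  ioh_xi0 K (ini_z A B C (d ^~ om) L (uini ^~ om)).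

Lemma uncorr_uini t : (t < L)%N -> uncorr P d L (uini t).
Proof.
move=> tL; pose E : 'M[R]_(nu, blk L nu) :=
  \mxrow_(j < L) (if j == Ordinal tL then 1%:M else 0 : 'M[R]_nu).
have -> : uini t = fun om => E *m stack L (uini ^~ om) 0.
  apply/funext => om; rewrite /E /stack mul_mxrow_mxcol (bigD1 (Ordinal tL))//= eqxx mul1mx.
  by rewrite big1 ?addr0// => j /negbTE ->; rewrite mul0mx.
apply: (uncorr_mul psdV d_iid); exact: uncorr_admissible psdV d_iid _ _ _ uini_adm.
Qed.

Lemma uncorr_ini_x t : (t <= L)%N ->
  uncorr P d L (fun om => ini_x A B (d ^~ om) (uini ^~ om) t).
Proof.
elim: t => [|t IH] tL; first exact: uncorr_cst0.
have ud := uncorr_noise psdV d_iid tL.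
apply: (uncorr_add psdV d_iid); last first.
  have -> : (fun om => wn (d ^~ om) t) = fun om => row_mx 1%:M 0 *m d t om.
    by apply/funext => om; rewrite -[d t om in RHS]vsubmxK mul_row_col mul1mx mul0mx addr0.
  exact: (uncorr_mul psdV d_iid).
apply: (uncorr_add psdV d_iid); apply: (uncorr_mul psdV d_iid); first exact/IH/ltnW.
exact: uncorr_uini.
Qed.

Lemma uncorr_ioh_start : uncorr P d L ioh_start.
Proof.
apply: (uncorr_mul psdV d_iid); apply: (uncorr_col psdV d_iid).
  exact: uncorr_admissible psdV d_iid _ _ _ uini_adm.
apply: (uncorr_stack (s := fun t om => ini_y A B C (d ^~ om) (uini ^~ om) t)) => i iL.
rewrite add0n.
have ud := uncorr_noise psdV d_iid iL.
apply: (uncorr_add psdV d_iid).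
  by apply: (uncorr_mul psdV d_iid); exact/uncorr_ini_x/ltnW.
have -> : (fun om => vn (d ^~ om) i) = fun om => row_mx 0 1%:M *m d i om.
  by apply/funext => om; rewrite -[d i om in RHS]vsubmxK mul_row_col mul1mx mul0mx add0r.
exact: (uncorr_mul psdV d_iid).
Qed.

(** The signals agree from time [L] on; the stages before it, counted only in [s_cost], disappear in
    the average. *)
Lemma ioh_costE : h_cost P A B C Q Wu d uini K = s_cost P A B C Q Wu d ioh_start.
Proof.
have sy t := sqintv_s_y uncorr_ioh_start t; have su t := sqintv_s_u uncorr_ioh_start t.
have hy t om : (L <= t)%N -> h_y A B C (d ^~ om) (uini ^~ om) K t =
    s_y A B C (d ^~ om) (ioh_start om) t by exact: ioh_h_y.
have hu t om : (L <= t)%N -> h_u A B C (d ^~ om) (uini ^~ om) K t =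
    s_u A B C (d ^~ om) (ioh_start om) t by exact: ioh_h_u.
have shy t : (L <= t)%N -> sqintv P (fun om => h_y A B C (d ^~ om) (uini ^~ om) K t).
  by move=> Lt; have := sy t; congr sqintv; apply/funext => om; rewrite hy.
have shu t : (L <= t)%N -> sqintv P (fun om => h_u A B C (d ^~ om) (uini ^~ om) K t).
  by move=> Lt; have := su t; congr sqintv; apply/funext => om; rewrite hu.
have late_h : (fun s => mean_cost P Q Wu
    (fun t om => h_y A B C (d ^~ om) (uini ^~ om) K t)
    (fun t om => h_u A B C (d ^~ om) (uini ^~ om) K t) (L + s)) = late_cost ioh_start.
  by apply/funext => s; rewrite /late_cost /mean_cost; congr expect; apply/funext => om;
     rewrite hy ?hu ?leq_addr.
have [[l [ql ->]]|[ql ->]] := s_cost_cases uncorr_ioh_start.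
  by apply: (average_cost_cvg L_gt0 (leqnn L) shy shu) => //; rewrite late_h.
by apply: (average_cost_cvgy L_gt0 (leqnn L) shy shu) => //; rewrite late_h.
Qed.

End IohLoop.

End ControllerCost.

(** * Perturbation of costs by vanishing signals *)

Section CostPerturbation.
Context {R : realType} {dp : measure_display} {Om : measurableType dp}.
Variable P : probability Om R.

(** Young's inequality, from nonnegativity of the form at [e *: a - b]. *)
Lemma quad_young n (W : 'M[R]_n) (a b : 'cV[R]_n) (e : R) : psdmx W -> 0 < e ->
  quad W (a + b) <= (1 + e) * quad W a + (1 + e^-1) * quad W b.
Proof.
move=> psdW e0; have := psdW.2 (e *: a - b); rewrite /quad.
have bE : (b^T *m W *m a) 0 0 = (a^T *m W *m b) 0 0.
  transitivity ((b^T *m W *m a)^T 0 0); first by rewrite [RHS]mxE.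
  by rewrite !trmx_mul trmxK psdW.1 mulmxA.
have ZE (c : R) (M : 'M[R]_1) : (c *: M) 0 0 = c * M 0 0 by rewrite mxE.
rewrite !(trmxD, trmxN) linearZ/= !(mulmxDl, mulmxDr, mulNmx, mulmxN) -!scalemxAl -!scalemxAr.
rewrite !(mxDE, mxNE, ZE) bE; move: (_ 0 0) (_ 0 0) (_ 0 0) => qb c qa h.
have : 0 <= e^-1 * (e * (e * qa) - e * c - (e * c - qb)).
  apply: mulr_ge0; first by rewrite invr_ge0 ltW.
  by apply: le_trans h _; rewrite le_eqVlt; apply/orP; left; apply/eqP; ring.
have -> : e^-1 * (e * (e * qa) - e * c - (e * c - qb)) = e * qa + e^-1 * qb - 2 * c.
  by field; rewrite gt_eqF.
lra.
Qed.

Variables (ny nu : nat) (Q : 'M[R]_ny) (Wu : 'M[R]_nu).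
Hypotheses (psdQ : psdmx Q) (psdWu : psdmx Wu).

(** The times [t] and [t'] differ because the deviation of two loops is counted from time [L]. *)
Lemma mean_cost_young (y yd : nat -> Om -> 'cV[R]_ny) (u ud : nat -> Om -> 'cV[R]_nu) e t t' :
  0 < e -> sqintv P (y t) -> sqintv P (u t) -> sqintv P (yd t') -> sqintv P (ud t') ->
  mean_cost P Q Wu (fun=> fun om => y t om + yd t' om) (fun=> fun om => u t om + ud t' om) t <=
  (1 + e) * mean_cost P Q Wu y u t + (1 + e^-1) * mean_cost P Q Wu yd ud t'.
Proof.
move=> e0 sy su syd sud.
have int (y1 : Om -> 'cV[R]_ny) (u1 : Om -> 'cV[R]_nu) : sqintv P y1 -> sqintv P u1 ->
    P.-integrable setT (fun om => (quad Q (y1 om) + quad Wu (u1 om))%:E).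
  move=> s1 s2; have [_ i1] := expect_quad Q s1; have [_ i2] := expect_quad Wu s2.
  exact: (integrableD measurableT i1 i2).
have ia := int _ _ (sqintv_add sy syd) (sqintv_add su sud).
have ib := int _ _ sy su; have id := int _ _ syd sud.
have ib' := integrableZl measurableT (1 + e) ib.
have id' := integrableZl measurableT (1 + e^-1) id.
rewrite /mean_cost -(expectZ _ ib) -(expectZ _ id) -expectD//.
apply: (le_Rintegral measurableT ia (integrableD measurableT ib' id')) => om _.
have h1 := quad_young (y t om) (yd t' om) psdQ e0.
have h2 := quad_young (u t om) (ud t' om) psdWu e0.
by apply: le_trans (lerD h1 h2) _; rewrite !mulrDr; lra.
Qed.

Lemma mean_cost_null m (Phi : 'M[R]_m) (D : Om -> 'cV[R]_m)
    (Cy : 'M[R]_(ny, m)) (Cu : 'M[R]_(nu, m)) :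
  schur_stable Phi -> sqintv P D ->
  mean_cost P Q Wu (fun s om => Cy *m (Phi ^+ s *m D om))
    (fun s om => Cu *m (Phi ^+ s *m D om)) @ \oo --> (0 : R).
Proof.
move=> sPhi sD.
pose V s := Phi ^+ s *m cross P D D *m (Phi ^+ s)^T.
have Es s p (M : 'M[R]_(p, m)) :
    cross P (fun om => M *m (Phi ^+ s *m D om)) (fun om => M *m (Phi ^+ s *m D om)) =
    M *m V s *m M^T.
  have sPD := sqintv_mul (Phi ^+ s) sD.
  rewrite cross_mull ?cross_mulr//; [|exact: sqintv_mul].
  by rewrite cross_mull ?cross_mulr// /V !mulmxA.
have -> : mean_cost P Q Wu (fun s om => Cy *m (Phi ^+ s *m D om))
      (fun s om => Cu *m (Phi ^+ s *m D om)) =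
    fun s => \tr (Q *m (Cy *m V s *m Cy^T)) + \tr (Wu *m (Cu *m V s *m Cu^T)).
  apply/funext => s; rewrite (@mean_costE _ _ _ _ _ _ _ _ _ _ 0%N) ?Es//.
    by move=> t _; do 2 apply: sqintv_mul.
  by move=> t _; do 2 apply: sqintv_mul.
have mul0 p q r (M : nat -> 'M[R]_(p, q)) (N : nat -> 'M[R]_(q, r)) N0 :
    mcvg (F := \oo) M 0 -> mcvg (F := \oo) N N0 -> mcvg (F := \oo) (fun s => M s *m N s) 0.
  by move=> M0 NN; rewrite -[X in mcvg _ X](mul0mx p N0); exact: mcvg_mul.
have mulC p q r (M : 'M[R]_(p, q)) (N : nat -> 'M[R]_(q, r)) :
    mcvg (F := \oo) N 0 -> mcvg (F := \oo) (fun s => M *m N s) 0.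
  by move=> N0; rewrite -[X in mcvg _ X](mulmx0 r M); apply: mcvg_mul => //; exact: mcvg_cst.
have cPhi : mcvg (F := \oo) V 0.
  apply: (mul0); last by apply: mcvg_tr; exact: mcvg_pow.
  by apply: (mul0); [exact: mcvg_pow|exact: mcvg_cst].
have lim0 p (W : 'M[R]_p) (M : 'M[R]_(p, m)) :
    \tr (W *m (M *m V s *m M^T)) @[s --> \oo] --> (0 : R).
  rewrite -[X in _ --> X](mxtrace0 R p); apply: cvg_mxtrace; apply: (mulC).
  by apply: (mul0); [exact: mulC|exact: mcvg_cst].
by rewrite -[X in _ --> X]addr0; apply: cvgD; exact: lim0.
Qed.

End CostPerturbation.

(** * The eliminated gain attains the LQG cost *)

Section OptimalGain.
Context {R : realType} {nx nu ny L : nat}.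
Variables (A : 'M[R]_nx) (B : 'M[R]_(nx, nu)) (C : 'M[R]_(ny, nx)).
Variables (Vw : 'M[R]_nx) (Vv Q : 'M[R]_ny) (Wu : 'M[R]_nu).
Context {dp : measure_display} {Om : measurableType dp}.
Variable P : probability Om R.
Variable d : nat -> Om -> 'cV[R]_(nx + ny).
Hypothesis L_gt0 : (0 < L)%N.
Hypothesis psdV : psdmx (block_mx Vw 0 0 Vv).
Hypothesis posVv : posdefmx Vv.
Hypothesis d_iid : iid_gaussian P (block_mx Vw 0 0 Vv) d.
Hypotheses (posQ : posdefmx Q) (posWu : posdefmx Wu).
Variables (X Y : 'M[R]_nx).
Hypotheses (stdX : standard_dare_solution A B (C^T *m Q *m C) Wu X)
  (stdY : standard_dare_solution A^T C^T Vw Vv Y).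
Hypothesis obsA : lstep_observable L A C.
Variable uini : nat -> Om -> 'cV[R]_nu.
Hypothesis uini_adm : admissible P d L (fun om => stack L (uini ^~ om) 0).
Variable kmin : controller R nu ny.
Local Notation klqg := (lqg_controller A B C Wu Vv X Y).
Hypothesis kminP : minimal_realization kmin klqg.
Hypothesis obsK : lstep_observable L (cG kmin) (cF kmin).

Local Notation J := (lqg_cost A B Vw Vv Q Wu X Y).
Local Notation K0 := (ioh_gain L (cG kmin) (cH kmin) (cF kmin)).

Lemma lqg_gain_stabilizing : stabilizing_gains L A B C K0.
Proof.
apply: (ioh_gain_stabilizing L_gt0 obsA kminP obsK).
apply: schur_separation; last exact: schur_stable_tr (schur_filter posVv stdY).
have [_ _ _] := stdX; congr schur_stable.
by rewrite /F_lqg mulmxN !mulmxA.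
Qed.

Local Notation xa := (ioh_start A B C d uini K0).
(** The LQG loop at rest is the reference: it obeys the history law of [K0] exactly, with no
    transient. *)
Let xb : Om -> 'cV[R]_(xdim klqg) := fun=> 0.

Local Notation xOf x0 om := (s_x A B C (d ^~ om) (x0 om)).
Local Notation uOf x0 om := (s_u A B C (d ^~ om) (x0 om)).
Local Notation yOf x0 om := (s_y A B C (d ^~ om) (x0 om)).

Let uxa : uncorr P d L xa. Proof. exact: (uncorr_ioh_start A B C psdV d_iid uini_adm K0). Qed.
Let uxb : uncorr P d L xb. Proof. exact: uncorr_cst0. Qed.

(* Started at rest, [kmin] answers the same outputs with the same inputs. *)
Lemma lqg_ioh_law om t :
  uOf xb om (t + L)%N = K0 *m col_mx (mstack L (uOf xb om) t) (mstack L (yOf xb om) t).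
Proof.
pose xi := fix xi t := if t is s.+1 then cG kmin *m xi s + cH kmin *m yOf xb om s
  else 0 : 'cV[R]_(xdim kmin).
have xi_rec s : xi s.+1 = cG kmin *m xi s + cH kmin *m yOf xb om s by [].
have uE s : uOf xb om s = cF kmin *m xi s.
  have eta_rec := @s_xi_rec _ _ _ _ A B C (d ^~ om) klqg (xb om).
  by rewrite (realizes_response kminP.1 xi_rec eta_rec).
rewrite uE (ioh_gainE obsK _ xi_rec); congr (_ *m col_mx _ _).
by apply: eq_mxcol => i; rewrite uE.
Qed.

Let ha om := hist L C (d ^~ om) (xOf xa om) (uOf xa om).
Let hb om := hist L C (d ^~ om) (xOf xb om) (uOf xb om).
Let D om := ha om 0 - hb om 0.

(** Both histories follow the closed loop of [K0] under the same noise, so their difference follows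
    it without noise. *)
Let gapE om s : ha om s = hb om s + Theta_cl A B C K0 ^+ s *m D om.
Proof.
elim: s => [|s IH]; first by rewrite expr0 mul1mx addrC subrK.
have a_rec t := hist_closed_loop L_gt0 obsA (@s_x_rec _ _ _ _ A B C (d ^~ om) _ (xa om))
  (ioh_law _ _ _ _ _ _ L_gt0) t.
have b_rec t := hist_closed_loop L_gt0 obsA (@s_x_rec _ _ _ _ A B C (d ^~ om) _ (xb om))
  (lqg_ioh_law om) t.
rewrite /ha /hb a_rec b_rec -/(ha om s) -/(hb om s) IH mulmxDr exprS -[_ * _]/(_ *m _) !mulmxA.
by rewrite addrAC.
Qed.

Let yaE om s : yOf xa om (L + s)%N =
  yOf xb om (L + s)%N + Psi L A B C *m (Theta_cl A B C K0 ^+ s *m D om).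
Proof.
rewrite addnC !s_yE !(hist_y obsA (@s_x_rec _ _ _ _ A B C (d ^~ om) _ _)).
by rewrite -/(ha om s) -/(hb om s) gapE mulmxDr addrAC.
Qed.

Let uaE om s : uOf xa om (L + s)%N =
  uOf xb om (L + s)%N + (K0 *m Gamma L) *m (Theta_cl A B C K0 ^+ s *m D om).
Proof.
rewrite addnC lqg_ioh_law (ioh_law _ _ _ _ _ _ L_gt0) -!hist_Gamma.
by rewrite -/(ha om s) -/(hb om s) gapE !mulmxDr !mulmxA.
Qed.

Let sqD : sqintv P D.
Proof.
have sq k (x0 : Om -> 'cV[R]_(xdim k)) : uncorr P d L x0 ->
    sqintv P (fun om => hist L C (d ^~ om) (xOf x0 om) (uOf x0 om) 0).
  move=> ux.
  have sd M n (N : 'M[R]_(n, _)) := sqintv_mul N (sqintv_noise psdV d_iid M).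
  apply: sqintv_col; apply: sqintv_col; apply: sqintv_mstack => t.
  - exact: (sqintv_s_u A B C psdV d_iid ux).
  - exact: (sqintv_s_y A B C psdV d_iid ux).
  - have := sd t _ (row_mx 1%:M 0); congr sqintv; apply/funext => om.
    by rewrite -[d t om]vsubmxK mul_row_col mul1mx mul0mx addr0.
  - have := sd t _ (row_mx 0 1%:M); congr sqintv; apply/funext => om.
    by rewrite -[d t om]vsubmxK mul_row_col mul1mx mul0mx add0r.
have -> : D = fun om => ha om 0 + (- 1%:M) *m hb om 0.
  by apply/funext => om; rewrite mulNmx mul1mx.
by apply: sqintv_add; [|apply: sqintv_mul]; apply: sq.
Qed.

(** The two loops differ by a signal whose second moment vanishes; Young's inequality absorbs the
    cross terms at the price of a factor [1 + e']. *)
Lemma lqg_gain_late_cost : avg_le (late_cost A B C Q Wu P d (L := L) xa) J.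
Proof.
have Jb : avg_le (late_cost A B C Q Wu P d (L := L) xb) J by exact: lqg_late_cost_le.
have psdQ := posdef_psd posQ; have psdWu := posdef_psd posWu.
pose qd s := mean_cost P Q Wu
  (fun s om => Psi L A B C *m (Theta_cl A B C K0 ^+ s *m D om))
  (fun s om => (K0 *m Gamma L) *m (Theta_cl A B C K0 ^+ s *m D om)) s.
have qd0 : avg_le qd 0 by apply: avg_le_null; exact: mean_cost_null lqg_gain_stabilizing sqD.
have young e s : 0 < e -> late_cost A B C Q Wu P d (L := L) xa s <=
    (1 + e) * late_cost A B C Q Wu P d (L := L) xb s + (1 + e^-1) * qd s.
  move=> e0.
  have := mean_cost_young psdQ psdWu
    (y := fun t om => yOf xb om t) (u := fun t om => uOf xb om t)
    (yd := fun s om => Psi L A B C *m (Theta_cl A B C K0 ^+ s *m D om))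
    (ud := fun s om => (K0 *m Gamma L) *m (Theta_cl A B C K0 ^+ s *m D om))
    (t := (L + s)%N) (t' := s) e0
    (sqintv_s_y A B C psdV d_iid uxb _) (sqintv_s_u A B C psdV d_iid uxb _)
    (sqintv_mul _ (sqintv_mul _ sqD)) (sqintv_mul _ (sqintv_mul _ sqD)).
  apply: le_trans; rewrite /late_cost /mean_cost le_eqVlt; apply/orP; left; apply/eqP.
  by congr expect; apply/funext => om; rewrite yaE uaE.
have J0 : 0 <= J.
  by apply: stage_cost_ge0 => //; [exact: psdmx_block_diag_ul psdV|case: stdX|case: stdY].
apply: avg_le_slack => e e0.
have J1 : 0 < J + 1 by rewrite ltr_wpDl.
(* Chosen so that [(1 + e') * J <= J + e]; [J + 1] is positive, while [J] is only known to be
   nonnegative. *)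
pose e' := e / (J + 1); have e'0 : 0 < e' by rewrite divr_gt0.
apply: (avg_le_le (fun s => young _ s e'0)).
have ge0 c : 0 < c -> 0 <= 1 + c :> R by move=> c0; rewrite addr_ge0// ltW.
have e'V : 0 < e'^-1 by rewrite invr_gt0.
apply: avg_leW (avg_leD (avg_leZ (ge0 _ e'0) Jb) (avg_leZ (ge0 _ e'V) qd0)).
rewrite mulr0 addr0 mulrDl mul1r lerD2l /e' mulrAC ler_pdivrMr// ler_pM2l//.
by rewrite lerDl.
Qed.

Lemma lqg_gain_cost : h_cost P A B C Q Wu d uini K0 = J%:E.
Proof.
rewrite (ioh_costE B L_gt0 psdV d_iid posQ posWu obsA uini_adm).
exact: (s_cost_eq L_gt0 psdV posVv d_iid posQ posWu stdX stdY uxa lqg_gain_late_cost).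
Qed.

End OptimalGain.

Theorem theorem1 (R : realType) (nx nu ny L : nat)
  (A : 'M[R]_nx) (B : 'M[R]_(nx, nu)) (C : 'M[R]_(ny, nx))
  (Vw : 'M[R]_nx) (Vv : 'M[R]_ny) (Q : 'M[R]_ny) (Wu : 'M[R]_nu)
  (dp : measure_display) (Om : measurableType dp) (P : probability Om R)
  (d : nat -> Om -> 'cV[R]_(nx + ny))
  (uini : nat -> Om -> 'cV[R]_nu)
  (X Y : 'M[R]_nx) (kmin : controller R nu ny) :
  (0 < L)%N ->
  stabilizable A B ->
  observable A C ->
  psdmx (block_mx Vw 0 0 Vv) ->
  posdefmx Vv ->
  iid_gaussian P (block_mx Vw 0 0 Vv) d ->
  posdefmx Q ->
  posdefmx Wu ->
  lstep_observable L A C ->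
  stabilizing_gains L A B C !=set0 ->
  admissible P d L (fun om => stack L (uini ^~ om) 0) ->
  standard_dare_solution A B (C^T *m Q *m C) Wu X ->
  standard_dare_solution A^T C^T Vw Vv Y ->
  minimal_realization kmin (lqg_controller A B C Wu Vv X Y) ->
  lstep_observable L (cG kmin) (cF kmin) ->
  (exists K : 'M[R]_(nu, nz L nu ny), optimal_gain P A B C Q Wu d uini K) /\
  forall Ks : 'M[R]_(nu, nz L nu ny), optimal_gain P A B C Q Wu d uini Ks ->
    let xis := fun om => ioh_xi0 Ks (ini_z A B C (d ^~ om) L (uini ^~ om)) in
    [/\ forall K : 'M[R]_(nu, nz L nu ny),
          (h_cost P A B C Q Wu d uini Ks <= h_cost P A B C Q Wu d uini K)%E,
        h_cost P A B C Q Wu d uini Ks = s_cost P A B C Q Wu d xis,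
        forall xi0 : Om -> 'cV[R]_(xdim (lqg_controller A B C Wu Vv X Y)),
          admissible P d L xi0 ->
          s_cost P A B C Q Wu d xis = s_cost P A B C Q Wu d xi0
      & nu = 1%N -> optimal_controller P A B C Q Wu d L L xis].
Proof.
move=> L0 _ _ psdV posVv d_iid posQ posWu obsA _ uini_adm stdX stdY kminP obsK.
set J := lqg_cost A B Vw Vv Q Wu X Y.
have s_ge k (xi0 : Om -> 'cV[R]_(xdim k)) : uncorr P d L xi0 ->
    (J%:E <= s_cost P A B C Q Wu d xi0)%E.
  by move=> uxi0; exact: (s_cost_ge L0 psdV posVv d_iid posQ posWu stdX stdY uxi0).
have h_s (K : 'M[R]_(nu, nz L nu ny)) :
    h_cost P A B C Q Wu d uini K = s_cost P A B C Q Wu d (ioh_start A B C d uini K).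
  by rewrite (ioh_costE B L0 psdV d_iid posQ posWu obsA uini_adm).
have h_ge (K : 'M[R]_(nu, nz L nu ny)) : (J%:E <= h_cost P A B C Q Wu d uini K)%E.
  by rewrite h_s; apply: s_ge; exact: (uncorr_ioh_start A B C psdV d_iid uini_adm).
have K0_stab := lqg_gain_stabilizing L0 posVv stdX stdY obsA kminP obsK.
have K0_cost := lqg_gain_cost L0 psdV posVv d_iid posQ posWu stdX stdY obsA uini_adm kminP obsK.
split.
  by exists (ioh_gain L (cG kmin) (cH kmin) (cF kmin)); split=> // K _; rewrite K0_cost.
move=> Ks [_ Ks_opt] xis.
have Ks_cost : h_cost P A B C Q Wu d uini Ks = J%:E.
  by apply/eqP; rewrite eq_le h_ge andbT -K0_cost Ks_opt.
have xis_cost : s_cost P A B C Q Wu d xis = J%:E by rewrite -Ks_cost h_s.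
split=> [K||xi0 xi0_adm|nu1].
- by rewrite Ks_cost.
- by rewrite h_s.
- rewrite xis_cost; apply/esym/(lqg_s_cost L0 psdV posVv d_iid posQ posWu stdX stdY).
  exact: uncorr_admissible psdV d_iid _ _ _ xi0_adm.
(* The realization has dimension [blk L nu], which is [L] when [nu = 1]. *)
- split=> [|k' xi0' _ xi0'_adm]; first by rewrite /= sum_nat_const card_ord nu1 muln1.
  by rewrite xis_cost; apply: s_ge; exact: uncorr_admissible psdV d_iid _ _ _ xi0'_adm.
Qed.
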